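(* The tree monad $\mathbb{T}^\times$ is essentially finitary over the class of all $\mathrm{MSO}$-definable $\mathbb{T}^\times$-algebras.
   Context: Sorts are $\Xi=\omega$ (arities). For $A\in\mathsf{Pos}^\omega$ (an $\omega$-sorted family of partial orders) and $n<\omega$, $\mathbb{T}^\times_nA$ is the set of finite or infinite trees with ordered successors whose vertices are labelled by elements of $A$ or by variable symbols $x_0,\dots,x_{n-1}$ (new symbols of arity $0$), where a vertex labelled by an element of $A_k$ has exactly $k$ successors, variable-labelled vertices are leaves (variables may occur any number of times), and the root is labelled by an element of $A$; trees are ordered by $s\leq t$ iff they have the same shape and labels satisfy $s(v)\leq t(v)$ vertexwise (variables comparable only to themselves). $\mathbb{T}^\times$ is a monad with $\mathrm{sing}(a)=a(x_0,\dots,x_{n-1})$ for $a\in A_n$ and $\mathrm{flat}$ which, for a tree $T$ with vertices $v$ labelled by trees $T(v)$, takes the disjoint union of the $T(v)$, replaces each leaf of $T(v)$ labelled $x_i$ by an edge to the root of $T(u)$ for $u$ the $(i+1)$-st successor of $v$, and unravels the result into a tree. A $\mathbb{T}^\times$-algebra is $\langle A,\pi\rangle$ with $\pi\circ\mathbb{T}^\times\pi=\pi\circ\mathrm{flat}$, $\pi\circ\mathrm{sing}=\mathrm{id}$; it is finitary if each $A_n$ is finite and it is generated by a finite subset. A tree $t\in\mathbb{T}^\times_n\Sigma$ over a finite unordered $\Sigma$ is identified with the structure $\langle\mathrm{dom}(t),\preceq,(S_i)_{i<\omega},(P_c)_{c\in\Sigma},(Q_i)_{i<n},R\rangle$ ($\preceq$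 tree order with root least, $S_i$ the $i$-th successor relation, $P_c$ the $c$-labelled vertices, $Q_i$ the $x_i$-labelled vertices, $R$ the root); a language $K\subseteq\mathbb{T}^\times_n\Sigma$ is MSO-definable if it is the set of trees satisfying a monadic second-order sentence; for a finite ordered $C$, $K\subseteq\mathbb{T}^\times C$ is MSO-definable if its preimage under $\mathbb{T}^\times\iota$ is, $\iota$ the identity from $C$ with trivial order to $C$. A finitary algebra is MSO-definable if for every finite $C\subseteq A$ and $a\in A$ the set $\pi^{-1}(\uparrow a)\cap\mathbb{T}^\times C$ is MSO-definable. A monad $\mathbb{M}$ is essentially finitary over a class $\mathcal{C}$ of $\mathbb{M}$-algebras if there is a monad $\mathbb{M}^\circ$ commuting with directed colimits and a morphism of monads $\varrho:\mathbb{M}^\circ\Rightarrow\mathbb{M}$ (natural transformation compatible with units and multiplications) that is dense over the closure of $\mathcal{C}$ under binary products: for all $\mathfrak{A}$ in that closure, $C\subseteq A$, and $s\in\mathbb{M}C$ there is $s^\circ\in\mathbb{M}^\circ C$ with $\pi(\varrho(s^\circ))=\pi(s)$. *)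

(* Defs.v *)
From Stdlib Require Import List Arith PeanoNat Lia Eqdep_dec
  ProofIrrelevance FunctionalExtensionality.
Import ListNotations.
Set Implicit Arguments.

Record Pos := {
  car :> Type;
  le : car -> car -> Prop;
  le_refl : forall x, le x x;
  le_trans : forall x y z, le x y -> le y z -> le x z;
  le_antisym : forall x y, le x y -> le y x -> x = y }.

Definition PosW := nat -> Pos.

Definition monotone (A B : PosW) (f : forall n, A n -> B n) : Prop :=
  forall n x y, le (A n) x y -> le (B n) (f n x) (f n y).

Record hom (A B : PosW) := {
  hfun :> forall n, A n -> B n;
  hmono : monotone A B hfun }.

Definition idh (A : PosW) : hom A A.
Proof. refine {| hfun := fun n x => x |}. intros n x y h; exact h. Defined.

Definition comph (A B C : PosW) (g : hom B C) (f : hom A B) : hom A C.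
Proof.
  refine {| hfun := fun n x => g n (f n x) |}.
  intros n x y h; apply (hmono g), (hmono f), h.
Defined.

Definition SubPos (P : Pos) (C : P -> Prop) : Pos.
Proof.
  refine {| car := {x : P | C x};
            le := fun x y => le P (proj1_sig x) (proj1_sig y) |}.
  - intros x; apply le_refl.
  - intros x y z; apply le_trans.
  - intros [x hx] [y hy] h1 h2; apply subset_eq_compat, le_antisym; assumption.
Defined.

Definition Sub (A : PosW) (C : forall n, A n -> Prop) : PosW :=
  fun n => @SubPos (A n) (C n).

Definition incl (A : PosW) (C : forall n, A n -> Prop) : forall n, Sub A C n -> A n :=
  fun n x => proj1_sig x.
Arguments incl {A} C n x.

Definition ProdPos (P Q : Pos) : Pos.
Proof.
  refine {| car := (P * Q)%type;
            le := fun x y => le P (fst x) (fst y) /\ le Q (snd x) (snd y) |}.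
  - intros x; split; apply le_refl.
  - intros x y z [h1 h2] [h3 h4]; split; eapply le_trans; eassumption.
  - intros [x1 x2] [y1 y2] [h1 h2] [h3 h4]; simpl in *.
    f_equal; apply le_antisym; assumption.
Defined.

Definition ProdW (A B : PosW) : PosW := fun n => ProdPos (A n) (B n).

Inductive label (A : PosW) : Type :=
  | Node (k : nat) (a : A k)
  | Var (i : nat).
Arguments Var {A} i.
Arguments Node {A} k a.

(* Trees with ordered successors: vertices are addresses (lists of
   successor indices); [t w = None] means w is not a vertex. *)
Definition rawtree (A : PosW) := list nat -> option (label A).

(* well-formedness of an element of T^x_n A:
   - the root is labelled by an element of A,
   - variables are among x_0..x_{n-1},
   - w.c is a vertex iff w is an A_k-labelled vertex and c < k
     (so A_k-labelled vertices have exactly k successors, variables are leaves,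
      and the domain is prefix closed). *)
Definition wf (A : PosW) (n : nat) (t : rawtree A) : Prop :=
  (exists k a, t [] = Some (Node k a)) /\
  (forall w i, t w = Some (Var i) -> i < n) /\
  (forall w c, t (w ++ [c]) <> None <-> exists k a, t w = Some (Node k a) /\ c < k).
Arguments wf A n t : clear implicits.

Definition lab_le (A : PosW) (l1 l2 : label A) : Prop :=
  match l1, l2 with
  | Node k a, Node k' b => exists e : k = k', le (A k') (eq_rect k (fun j => A j) a k' e) b
  | Var i, Var j => i = j
  | _, _ => False
  end.

Definition opt_le (A : PosW) (o1 o2 : option (label A)) : Prop :=
  match o1, o2 with
  | None, None => True
  | Some l1, Some l2 => lab_le l1 l2
  | _, _ => False
  end.

Definition Tcar (A : PosW) (n : nat) := {t : rawtree A | wf A n t}.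

Definition Tle (A : PosW) (n : nat) (s t : Tcar A n) : Prop :=
  forall w, opt_le (proj1_sig s w) (proj1_sig t w).

Lemma lab_le_refl (A : PosW) (l : label A) : lab_le l l.
Proof. destruct l; simpl; [exists eq_refl; apply le_refl | reflexivity]. Qed.

Lemma lab_le_trans (A : PosW) (l1 l2 l3 : label A) :
  lab_le l1 l2 -> lab_le l2 l3 -> lab_le l1 l3.
Proof.
  destruct l1 as [k1 a1|i1], l2 as [k2 a2|i2], l3 as [k3 a3|i3]; simpl; try tauto.
  - intros [e1 h1] [e2 h2]; subst; simpl in *. exists eq_refl; simpl.
    eapply le_trans; eassumption.
  - intros; congruence.
Qed.

Lemma lab_le_antisym (A : PosW) (l1 l2 : label A) :
  lab_le l1 l2 -> lab_le l2 l1 -> l1 = l2.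
Proof.
  destruct l1 as [k1 a1|i1], l2 as [k2 a2|i2]; simpl; try tauto.
  - intros [e1 h1] [e2 h2]; subst.
    rewrite (UIP_refl_nat _ e2) in h2. simpl in *.
    f_equal; apply le_antisym; assumption.
  - intros ->; reflexivity.
Qed.

Definition TPos (A : PosW) (n : nat) : Pos.
Proof.
  refine {| car := Tcar A n; le := @Tle A n |}.
  - intros t w; destruct (proj1_sig t w); simpl; [apply lab_le_refl|exact I].
  - intros x y z h1 h2 w; specialize (h1 w); specialize (h2 w).
    destruct (proj1_sig x w), (proj1_sig y w), (proj1_sig z w); simpl in *;
      try tauto; eapply lab_le_trans; eassumption.
  - intros [x hx] [y hy] h1 h2; apply subset_eq_compat.
    apply functional_extensionality; intros w.
    specialize (h1 w); specialize (h2 w); simpl in *.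
    destruct (x w), (y w); simpl in *; try tauto.
    f_equal; apply lab_le_antisym; assumption.
Defined.

Definition lab_map (A B : PosW) (f : forall n, A n -> B n) (l : label A) : label B :=
  match l with Node k a => Node k (f k a) | Var i => Var i end.
Arguments lab_map {A B} f l.

Definition Tmap_raw (A B : PosW) (f : forall n, A n -> B n) (t : rawtree A) : rawtree B :=
  fun w => option_map (lab_map f) (t w).
Arguments Tmap_raw {A B} f t _.

Lemma Tmap_wf (A B : PosW) (f : forall n, A n -> B n) n t :
  wf A n t -> wf B n (Tmap_raw f t).
Proof.
  unfold Tmap_raw; intros [[k [a hr]] [hv hc]]; split; [|split].
  - exists k, (f k a); rewrite hr; reflexivity.
  - intros w i h; destruct (t w) as [[]|] eqn:E; simpl in h; try discriminate.
    inversion h; subst; eapply hv; eassumption.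
  - intros w c; specialize (hc w c).
    destruct (t (w ++ [c])) as [l1|] eqn:E1, (t w) as [[k' a'|i']|] eqn:E2; simpl.
    + split; intros _; [exists k', (f k' a'); split; [reflexivity|]|congruence].
      destruct hc as [hc1 _]; destruct (hc1 ltac:(congruence)) as [k0 [a0 [h0 h0']]].
      inversion h0; subst; assumption.
    + destruct hc as [hc1 _]; destruct (hc1 ltac:(congruence)) as [k0 [a0 [h0 h0']]];
        discriminate.
    + destruct hc as [hc1 _]; destruct (hc1 ltac:(congruence)) as [k0 [a0 [h0 h0']]];
        discriminate.
    + split; intros h; [congruence|].
      destruct h as [k0 [a0 [h h']]]; inversion h; subst.
      destruct hc as [_ hc2]; exfalso; apply hc2; eauto.
    + split; intros h; [congruence|]. destruct h as [k0 [a0 [h h']]]; discriminate.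
    + split; intros h; [congruence|]. destruct h as [k0 [a0 [h h']]]; discriminate.
Qed.

Arguments Tmap_wf {A B} f {n t} _.

Definition Tmap (A B : PosW) (f : forall n, A n -> B n) (n : nat) (t : Tcar A n) : Tcar B n :=
  exist _ (Tmap_raw f (proj1_sig t)) (Tmap_wf f (proj2_sig t)).
Arguments Tmap {A B} f {n} t.

Definition sing_raw (A : PosW) (n : nat) (a : A n) : rawtree A :=
  fun w => match w with
           | [] => Some (Node n a)
           | [i] => if i <? n then Some (Var i) else None
           | _ => None
           end.
Arguments sing_raw {A n} a _.

Lemma sing_wf (A : PosW) (n : nat) (a : A n) : wf A n (sing_raw a).
Proof.
  split; [|split].
  - exists n, a; reflexivity.
  - intros [|i [|j w]] i' h; simpl in h; try discriminate.
    destruct (i <? n) eqn:E; inversion h; subst; apply Nat.ltb_lt; assumption.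
  - intros [|i [|j w]] c; simpl.
    + destruct (c <? n) eqn:E; split; intros h.
      * exists n, a; split; [reflexivity|apply Nat.ltb_lt; assumption].
      * discriminate.
      * congruence.
      * destruct h as [k [b [h1 h2]]]; inversion h1; subst.
        apply Nat.ltb_nlt in E; contradiction.
    + split; intros h; [congruence|destruct h as [k [b [h1 h2]]]].
      destruct (i <? n); discriminate.
    + split; intros h; [congruence|destruct h as [k [b [h1 h2]]]; discriminate].
Qed.
Arguments sing_wf {A n} a.

Definition sing (A : PosW) (n : nat) (a : A n) : Tcar A n :=
  exist _ (sing_raw a) (sing_wf a).
Arguments sing {A n} a.

(* multiplication: flat.  A tree T in T^x_n (T^x A) has vertices v labelled by
   trees T(v).  A vertex of flat(T) is reached by walking through the inner
   trees: the state (v, p) means "at position p of the inner tree T(v)";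
   whenever the inner child reached is a leaf labelled x_i, we follow the
   edge to the root of T(v.i) (the (i+1)-st successor of v); if that vertex
   of T is a variable x_j, we reach an x_j-labelled leaf of flat(T).
   This computes exactly the unravelling of the glued graph. *)
Inductive fstate := FIn (v p : list nat) | FOut (j : nat) | FBad.

Section Flat.
Variables (A : PosW) (n : nat) (T : Tcar (TPos A) n).

Definition inner (v p : list nat) : option (label A) :=
  match proj1_sig T v with
  | Some (Node k t) => proj1_sig t p
  | _ => None
  end.

Definition fstep (s : fstate) (c : nat) : fstate :=
  match s with
  | FIn v p =>
      match inner v p with
      | Some (Node _ _) =>
          match inner v (p ++ [c]) with
          | Some (Node _ _) => FIn v (p ++ [c])
          | Some (Var i) =>
              match proj1_sig T (v ++ [i]) with
              | Some (Node _ _) => FIn (v ++ [i]) []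
              | Some (Var j) => FOut j
              | None => FBad
              end
          | None => FBad
          end
      | _ => FBad
      end
  | _ => FBad
  end.

Definition flab (s : fstate) : option (label A) :=
  match s with
  | FIn v p => match inner v p with Some (Node k a) => Some (Node k a) | _ => None end
  | FOut j => Some (Var j)
  | FBad => None
  end.

Definition flat_raw : rawtree A := fun w => flab (fold_left fstep w (FIn [] [])).

Definition good (s : fstate) : Prop :=
  match s with
  | FIn v p => exists k a, inner v p = Some (Node k a)
  | FOut j => j < n
  | FBad => True
  end.

Lemma good_init : good (FIn [] []).
Proof.
  destruct (proj2_sig T) as [[k [t hr]] _]. simpl. unfold inner. rewrite hr.
  destruct (proj2_sig t) as [[k' [a' hr']] _]. eauto.
Qed.

Lemma root_node (v : list nat) k (t : Tcar A k) :
  proj1_sig T v = Some (@Node (TPos A) k t) -> exists k' a', inner v [] = Some (Node k' a').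
Proof.
  intros h; unfold inner; rewrite h. destruct (proj2_sig t) as [[k' [a' hr']] _]; eauto.
Qed.

Lemma fstep_spec (s : fstate) (c : nat) : good s ->
  good (fstep s c) /\
  (flab (fstep s c) <> None <-> exists k a, flab s = Some (Node k a) /\ c < k).
Proof.
  destruct s as [v p|j|]; simpl; intros hg.
  2,3: split; [exact I|split; [tauto|intros [k [a [h _]]]; discriminate]].
  destruct hg as [k [a hin]]. rewrite hin.
  assert (Hv : exists kv (tv : Tcar A kv), proj1_sig T v = Some (@Node (TPos A) kv tv)
                 /\ forall q, inner v q = proj1_sig tv q).
  { revert hin; unfold inner.
    destruct (proj1_sig T v) as [[kv tv|jv]|] eqn:Ev; try discriminate.
    intros _; exists kv, tv; split; [reflexivity|intros q; reflexivity]. }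
  destruct Hv as [kv [tv [Ev Hinner]]].
  rewrite Hinner in hin.
  destruct (proj2_sig tv) as [_ [hvv hcv]].
  destruct (proj2_sig T) as [_ [hvT hcT]].
  specialize (hcv p c). rewrite hin in hcv.
  rewrite (Hinner (p ++ [c])).
  destruct (proj1_sig tv (p ++ [c])) as [[k1 a1|i1]|] eqn:Ec.
  - simpl. rewrite (Hinner (p ++ [c])), Ec. split; [eauto|].
    split; [intros _|intros _; discriminate].
    destruct hcv as [h1 _]. destruct (h1 ltac:(discriminate)) as [k0 [a0 [h0 h0']]].
    inversion h0; subst. eauto.
  - assert (Hi : i1 < kv) by (eapply hvv; eassumption).
    assert (HT : proj1_sig T (v ++ [i1]) <> None)
      by (apply hcT; exists kv, tv; split; assumption).
    destruct hcv as [h1 _]. destruct (h1 ltac:(discriminate)) as [k0 [a0 [h0 h0']]].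
    inversion h0; subst.
    destruct (proj1_sig T (v ++ [i1])) as [[k2 t2|j2]|] eqn:E2; [| |congruence].
    + simpl. split.
      * eapply root_node; eassumption.
      * destruct (root_node _ E2) as [k' [a' hr]]. rewrite hr.
        split; [intros _; eauto|intros _; discriminate].
    + simpl. split; [eapply hvT; eassumption|split; [intros _; eauto|discriminate]].
  - simpl. split; [exact I|]. split; [tauto|]. intros [k0 [a0 [h0 h0']]].
    inversion h0; subst. destruct hcv as [_ h2].
    exfalso; apply h2; eauto.
Qed.

Lemma good_reach (w : list nat) : good (fold_left fstep w (FIn [] [])).
Proof.
  induction w as [|c w IH] using rev_ind.
  - apply good_init.
  - rewrite fold_left_app; simpl. apply fstep_spec, IH.
Qed.

Lemma flat_wf : wf A n flat_raw.
Proof.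
  split; [|split].
  - unfold flat_raw; simpl. destruct good_init as [k [a h]]. rewrite h. eauto.
  - intros w i; unfold flat_raw. pose proof (good_reach w) as hg.
    destruct (fold_left fstep w (FIn [] [])) as [v p|j|]; simpl in *.
    + destruct (inner v p) as [[]|]; discriminate.
    + intros h; inversion h; subst; assumption.
    + discriminate.
  - intros w c; unfold flat_raw. rewrite fold_left_app; simpl.
    apply fstep_spec, good_reach.
Qed.

End Flat.

Definition flat (A : PosW) (n : nat) (T : Tcar (TPos A) n) : Tcar A n :=
  exist _ (flat_raw T) (flat_wf T).
Arguments flat {A n} T.

Record Alg := {
  acar : PosW;
  api : hom (TPos acar) acar;
  alg_sing : forall n (a : acar n), api n (sing a) = a;
  alg_flat : forall n (T : Tcar (TPos acar) n), api n (flat T) = api n (Tmap api T) }.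

Definition Tincl (A : PosW) (C : forall n, A n -> Prop) (n : nat)
  (t : Tcar (Sub A C) n) : Tcar A n := Tmap (incl C) t.
Arguments Tincl {A C n} t.

Definition finite_type (X : Type) : Prop := exists l : list X, forall x, In x l.

Definition finite_subset (A : PosW) (C : forall n, A n -> Prop) : Prop :=
  exists l : list {k : nat & A k}, forall k a, C k a -> In (existT _ k a) l.
Arguments finite_subset {A} C.

Definition generated_by (X : Alg) (C : forall n, acar X n -> Prop) : Prop :=
  forall n (a : acar X n), exists t : Tcar (Sub (acar X) C) n, api X n (Tincl t) = a.

Definition finitary (X : Alg) : Prop :=
  (forall n, finite_type (acar X n)) /\
  exists C : forall n, acar X n -> Prop, finite_subset C /\ generated_by X C.

(* Structure of t in T^x_n Sigma:
   <dom t, tree order (root least), S_i (i-th successor), P_c (c-labelled),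
    Q_i (x_i-labelled), R (root)>.
   L is the type of labels c = (k, a) with a in Sigma_k.
   First-order variables and set variables are named by natural numbers. *)
Inductive mso (L : Type) : Type :=
  | MLe (x y : nat)
  | MSucc (i x y : nat)
  | MLab (c : L) (x : nat)
  | MVarLab (i x : nat)
  | MRoot (x : nat)
  | MEq (x y : nat)
  | MIn (x X : nat)
  | MNot (f : mso L)
  | MAnd (f g : mso L)
  | MEx (x : nat) (f : mso L)
  | MExS (X : nat) (f : mso L).
Arguments MLe {L} x y.  Arguments MSucc {L} i x y.  Arguments MLab {L} c x.
Arguments MVarLab {L} i x.  Arguments MRoot {L} x.  Arguments MEq {L} x y.
Arguments MIn {L} x X.  Arguments MNot {L} f.  Arguments MAnd {L} f g.
Arguments MEx {L} x f.  Arguments MExS {L} X f.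

Fixpoint mso_closed_in (L : Type) (fv sv : list nat) (f : mso L) : Prop :=
  match f with
  | MLe x y | MEq x y => In x fv /\ In y fv
  | MSucc _ x y => In x fv /\ In y fv
  | MLab _ x | MVarLab _ x | MRoot x => In x fv
  | MIn x X => In x fv /\ In X sv
  | MNot g => mso_closed_in fv sv g
  | MAnd g h => mso_closed_in fv sv g /\ mso_closed_in fv sv h
  | MEx x g => mso_closed_in (x :: fv) sv g
  | MExS X g => mso_closed_in fv (X :: sv) g
  end.

Definition sentence (L : Type) (f : mso L) : Prop := mso_closed_in [] [] f.

Definition upd {V : Type} (e : nat -> V) (x : nat) (v : V) : nat -> V :=
  fun y => if Nat.eqb y x then v else e y.

Fixpoint sat (P : PosW) (t : rawtree P) (fo : nat -> list nat)
  (so : nat -> list nat -> Prop) (f : mso {k : nat & P k}) : Prop :=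
  match f with
  | MLe x y => exists u, fo y = fo x ++ u
  | MSucc i x y => fo y = fo x ++ [i]
  | MLab c x => exists k a, t (fo x) = Some (Node k a) /\ existT _ k a = c
  | MVarLab i x => t (fo x) = Some (Var i)
  | MRoot x => fo x = []
  | MEq x y => fo x = fo y
  | MIn x X => so X (fo x)
  | MNot g => ~ sat t fo so g
  | MAnd g h => sat t fo so g /\ sat t fo so h
  | MEx x g => exists w, t w <> None /\ sat t (upd fo x w) so g
  | MExS X g => exists S : list nat -> Prop,
                  (forall w, S w -> t w <> None) /\ sat t fo (upd so X S) g
  end.

(* K subset of T^x_n P is MSO-definable: there is a sentence whose models
   (among trees of T^x_n P) are exactly the elements of K.  Only the
   underlying (unordered) labels are used, i.e. this is definability of the
   preimage of K under T^x iota. *)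
Definition mso_definable (P : PosW) (n : nat) (K : Tcar P n -> Prop) : Prop :=
  exists f : mso {k : nat & P k}, sentence f /\
    forall t : Tcar P n, K t <-> sat (proj1_sig t) (fun _ => []) (fun _ _ => False) f.

Definition mso_definable_alg (X : Alg) : Prop :=
  forall (C : forall n, acar X n -> Prop), finite_subset C ->
  forall n (a : acar X n),
    mso_definable (fun t : Tcar (Sub (acar X) C) n => le (acar X n) a (api X n (Tincl t))).

Definition MSO_alg (X : Alg) : Prop := finitary X /\ mso_definable_alg X.

Record RawAlg := { rcar : PosW; rpi : forall n, Tcar rcar n -> rcar n }.
Arguments rpi r n t : clear implicits.

Definition raw_of (X : Alg) : RawAlg := {| rcar := acar X; rpi := api X |}.

Definition raw_prod (X Y : RawAlg) : RawAlg :=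
  {| rcar := ProdW (rcar X) (rcar Y);
     rpi := fun n t =>
       (rpi X n (Tmap (fun k (z : ProdW (rcar X) (rcar Y) k) => fst z) t),
        rpi Y n (Tmap (fun k (z : ProdW (rcar X) (rcar Y) k) => snd z) t)) |}.

Inductive prod_closure (Q : Alg -> Prop) : RawAlg -> Prop :=
  | pc_base (X : Alg) : Q X -> prod_closure Q (raw_of X)
  | pc_prod (X Y : RawAlg) :
      prod_closure Q X -> prod_closure Q Y -> prod_closure Q (raw_prod X Y).

Record Monad := {
  MO : PosW -> PosW;
  Mmap : forall A B, hom A B -> hom (MO A) (MO B);
  Munit : forall A, hom A (MO A);
  Mmult : forall A, hom (MO (MO A)) (MO A);
  Mmap_id : forall A n x, Mmap (idh A) n x = x;
  Mmap_comp : forall A B C (f : hom A B) (g : hom B C) n x,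
      Mmap (comph g f) n x = Mmap g n (Mmap f n x);
  Munit_nat : forall A B (f : hom A B) n x,
      Mmap f n (Munit A n x) = Munit B n (f n x);
  Mmult_nat : forall A B (f : hom A B) n x,
      Mmap f n (Mmult A n x) = Mmult B n (Mmap (Mmap f) n x);
  Mmult_unit_l : forall A n x, Mmult A n (Munit (MO A) n x) = x;
  Mmult_unit_r : forall A n x, Mmult A n (Mmap (Munit A) n x) = x;
  Mmult_assoc : forall A n x,
      Mmult A n (Mmult (MO A) n x) = Mmult A n (Mmap (Mmult A) n x) }.
Arguments Mmap m {A B} f.

Record DDiag := {
  dI : Type;
  dle : dI -> dI -> Prop;
  dle_refl : forall i, dle i i;
  dle_trans : forall i j k, dle i j -> dle j k -> dle i k;
  d_inhabited : inhabited dI;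
  d_upper : forall i j, exists k, dle i k /\ dle j k;
  dobj : dI -> PosW;
  dmap : forall i j, dle i j -> hom (dobj i) (dobj j);
  dmap_id : forall i (h : dle i i) n x, dmap h n x = x;
  dmap_comp : forall i j k (h1 : dle i j) (h2 : dle j k) (h3 : dle i k) n x,
      dmap h3 n x = dmap h2 n (dmap h1 n x) }.
Arguments dmap d i j _ : clear implicits.

Definition is_cocone (I : Type) (lei : I -> I -> Prop) (obj : I -> PosW)
  (mp : forall i j, lei i j -> hom (obj i) (obj j)) (L : PosW)
  (c : forall i, hom (obj i) L) : Prop :=
  forall i j (h : lei i j) n x, c j n (mp i j h n x) = c i n x.
Arguments is_cocone : clear implicits.

Definition is_colimit (I : Type) (lei : I -> I -> Prop) (obj : I -> PosW)
  (mp : forall i j, lei i j -> hom (obj i) (obj j)) (L : PosW)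
  (c : forall i, hom (obj i) L) : Prop :=
  is_cocone I lei obj mp L c /\
  forall (X : PosW) (x : forall i, hom (obj i) X), is_cocone I lei obj mp X x ->
    exists u : hom L X,
      (forall i n y, u n (c i n y) = x i n y) /\
      forall u' : hom L X, (forall i n y, u' n (c i n y) = x i n y) ->
        forall n y, u' n y = u n y.
Arguments is_colimit : clear implicits.

Definition preserves_directed_colimits (M : Monad) : Prop :=
  forall (D : DDiag) (L : PosW) (c : forall i, hom (dobj D i) L),
    is_colimit (dI D) (dle D) (dobj D) (dmap D) L c ->
    is_colimit (dI D) (dle D) (fun i => MO M (dobj D i))
      (fun i j h => Mmap M (dmap D i j h)) (MO M L) (fun i => Mmap M (c i)).

Definition monad_morphism (M : Monad) (rho : forall A, hom (MO M A) (TPos A)) : Prop :=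
  (forall (A B : PosW) (f : hom A B) n x, Tmap f (rho A n x) = rho B n (Mmap M f n x)) /\
  (forall (A : PosW) n (a : A n), rho A n (Munit M A n a) = sing a) /\
  (forall (A : PosW) n x, rho A n (Mmult M A n x) = flat (Tmap (rho A) (rho (MO M A) n x))).

Definition dense (M : Monad) (rho : forall A, hom (MO M A) (TPos A))
  (Q : RawAlg -> Prop) : Prop :=
  forall X, Q X ->
  forall (C : forall n, rcar X n -> Prop) n (s : Tcar (Sub (rcar X) C) n),
    exists s0 : MO M (Sub (rcar X) C) n,
      rpi X n (Tincl (rho _ n s0)) = rpi X n (Tincl s).

Definition essentially_finitary (Q : Alg -> Prop) : Prop :=
  exists (M : Monad) (rho : forall A, hom (MO M A) (TPos A)),
    preserves_directed_colimits M /\ monad_morphism M rho /\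
    dense M rho (prod_closure Q).

(* Main.v *)
From Stdlib Require Import List Arith PeanoNat Lia Cantor Eqdep_dec.
From Stdlib Require Import Classical ClassicalEpsilon FunctionalExtensionality
  PropExtensionality ProofIrrelevance.
Require Import Defs.
Import ListNotations.
Set Implicit Arguments.

(* The finitary monad consists of the trees with finitely many labels.  Density means that a
   tree s over C, possibly with infinitely many labels (of unbounded arities), can be replaced
   by a tree with finitely many labels from C and the same product.  By the argument of Rabin,
   the set of trees with a given product over a finite set of generators is recognised by a
   parity automaton.  Writing each c in C as the product of a tree t_c of generators, one sees
   that the automaton only needs to know the effect of t_c: which states it may send into
   which subtrees, with which priorities, and from which states it may be rejected inside t_c.
   There are finitely many effects for each subtree, so the labels of s are the moves of a
   parity game with finitely many positions.  The tree s provides a winning strategy, and a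
   positional winning strategy provides the required tree, with one label for each position.
   Products of algebras correspond to conjunctions of automata. *)

(** Three games are solved: for complements of tree languages, for the effects, and for the final
    choice of labels. Each needs a deterministic parity condition on branches, so branch conditions
    go through [oreg], which has easy closure properties, and one determinisation theorem serves all
    three. A position may have infinitely many moves, so a game is given by a forcing predicate;
    determinacy asks only that the positions embed into the natural numbers and that the priorities
    are bounded. An infinite alphabet does no harm because [infrec] allows an arbitrary relation
    between a label and the letters it contributes to the branches; only the letters have to be
    finite in number. *)

Lemma choose (A B : Type) (R : A -> B -> Prop) :
  (forall a, exists b, R a b) -> exists f, forall a, R a (f a).
Proof.
  intros h. exists (fun a => proj1_sig (constructive_indefinite_description _ (h a))).
  intros a. apply proj2_sig.
Qed.

Lemma pred_ext (A : Type) (P Q : A -> Prop) : (forall a, P a <-> Q a) -> P = Q.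
Proof.
  intros h; apply functional_extensionality; intros a.
  apply propositional_extensionality, h.
Qed.

Lemma sig_ext (A : Type) (P : A -> Prop) (x y : {a | P a}) :
  proj1_sig x = proj1_sig y -> x = y.
Proof. destruct x, y; simpl; intros; subst; f_equal; apply proof_irrelevance. Qed.

(** * Finite types *)

Lemma fin_surj (A B : Type) (f : A -> B) :
  finite_type A -> (forall b, exists a, f a = b) -> finite_type B.
Proof.
  intros [l hl] hf. exists (map f l). intros b. destruct (hf b) as [a <-]. apply in_map, hl.
Qed.

Lemma fin_sig (A : Type) (P : A -> Prop) :
  (exists l, forall x, P x -> In x l) -> finite_type {x | P x}.
Proof.
  intros [l hl].
  exists (flat_map (fun x => match excluded_middle_informative (P x) with
                             | left h => [exist _ x h] | right _ => [] end) l).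
  intros [x hx]. apply in_flat_map. exists x. split; [auto|].
  destruct (excluded_middle_informative (P x)); [|tauto].
  left. apply sig_ext; reflexivity.
Qed.

Lemma fin_lt (n : nat) : finite_type {i | i < n}.
Proof. apply fin_sig. exists (seq 0 n). intros x h; apply in_seq; lia. Qed.

Lemma fin_prod (A B : Type) : finite_type A -> finite_type B -> finite_type (A * B).
Proof.
  intros [l hl] [l' hl']. exists (list_prod l l'). intros [a b]. apply in_prod; auto.
Qed.

Lemma fin_option (A : Type) : finite_type A -> finite_type (option A).
Proof.
  intros [l hl]. exists (None :: map Some l). intros [a|]; [right; apply in_map, hl|left; auto].
Qed.

Lemma fin_unit : finite_type unit.
Proof. exists [tt]. intros []; simpl; auto. Qed.

Lemma fin_Prop : finite_type Prop.
Proof.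
  exists [True; False]. intros P. destruct (classic P) as [h|h]; [left|right; left];
    apply propositional_extensionality; tauto.
Qed.

Lemma fin_fun (A B : Type) : finite_type A -> finite_type B -> finite_type (A -> B).
Proof.
  intros [l hl] [lb hlb].
  destruct (classic (exists f0 : A -> B, True)) as [[f0 _]|h0].
  2: { exists []. intros f; apply h0; exists f; trivial. }
  (* The claim is relativised to the arguments in a list so that induction applies; agreement on an
     enumeration of [A] is equality. *)
  assert (H : forall l, exists L : list (A -> B),
             forall f, exists g, In g L /\ forall a, In a l -> f a = g a).
  { clear l hl. induction l as [|a l [L IH]].
    - exists [f0]. intros f; exists f0; split; [left; reflexivity|intros a []].
    - exists (map (fun p x => if excluded_middle_informative (x = a) then snd p else fst p x)
                (list_prod L lb)).
      intros f. destruct (IH f) as [g [hg e]].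
      eexists; split.
      + apply in_map, in_prod; [exact hg|apply (hlb (f a))].
      + intros x hx; simpl. destruct (excluded_middle_informative (x = a)); [congruence|].
        apply e. destruct hx; [congruence|assumption]. }
  destruct (H l) as [L hL]. exists L. intros f. destruct (hL f) as [g [hg e]].
  replace f with g; [assumption|]. apply functional_extensionality; intros; symmetry; auto.
Qed.

Lemma fin_pred (A : Type) : finite_type A -> finite_type (A -> Prop).
Proof. intros h; apply fin_fun; [exact h|apply fin_Prop]. Qed.

Lemma bounded_lists (A : Type) (P : A -> Prop) :
  (exists l, forall a, P a -> In a l) -> forall n,
  exists L, forall u : list A, length u <= n -> Forall P u -> In u L.
Proof.
  intros [l hl]. induction n as [|n [L IH]].
  - exists [[]]. intros [|a u] h _; simpl in *; [auto|lia].
  - exists ([] :: map (fun p => fst p :: snd p) (list_prod l L)).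
    intros [|a u] h hF; [left; reflexivity|right]. inversion hF; subst.
    change (a :: u) with ((fun p : A * list A => fst p :: snd p) (a, u)).
    apply in_map, in_prod; auto. apply IH; [simpl in h; lia|assumption].
Qed.

Lemma fin_bound (A : Type) (f : A -> nat) : finite_type A -> exists N, forall a, f a < N.
Proof.
  intros [l hl]. exists (S (list_max (map f l))). intros a.
  apply Nat.lt_succ_r.
  destruct (list_max_le (map f l) (list_max (map f l))) as [h _].
  specialize (h (Nat.le_refl _)). rewrite Forall_forall in h. apply h, in_map, hl.
Qed.

(** * Infinitely often *)

Definition Inf (P : nat -> Prop) : Prop := forall n, exists m, n <= m /\ P m.

Lemma Inf_impl (P Q : nat -> Prop) : (forall n, P n -> Q n) -> Inf P -> Inf Q.
Proof. intros h H n; destruct (H n) as [m [? ?]]; eauto. Qed.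

Lemma not_Inf (P : nat -> Prop) : ~ Inf P -> exists n, forall m, n <= m -> ~ P m.
Proof.
  intros h. apply not_all_ex_not in h. destruct h as [n h]. exists n. intros m hm hp.
  apply h; eauto.
Qed.

Lemma Inf_or (P Q : nat -> Prop) : Inf (fun n => P n \/ Q n) -> Inf P \/ Inf Q.
Proof.
  intros h. apply NNPP; intros hn. apply not_or_and in hn. destruct hn as [h1 h2].
  apply not_Inf in h1; apply not_Inf in h2. destruct h1 as [n1 h1], h2 as [n2 h2].
  destruct (h (n1 + n2)) as [m [hm [hp|hp]]]; [apply (h1 m)|apply (h2 m)]; auto; lia.
Qed.

Lemma Inf_fin (A : Type) (R : A -> nat -> Prop) :
  finite_type A -> Inf (fun n => exists a, R a n) -> exists a, Inf (R a).
Proof.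
  intros [l hl] h.
  assert (H : Inf (fun n => exists a, In a l /\ R a n)).
  { eapply Inf_impl; [|exact h]. intros n [a ha]; eauto. }
  clear h hl. induction l as [|a l IH].
  - destruct (H 0) as [m [_ [a [[] _]]]].
  - destruct (@Inf_or (R a) (fun n => exists a, In a l /\ R a n)) as [h|h]; eauto.
    eapply Inf_impl; [|exact H]. intros n [b [[<-|hb] hr]]; eauto.
Qed.

(** * Infinite words and factorisations *)

Definition slice (X : Type) (w : nat -> X) (i j : nat) : list X := map w (seq i (j - i)).

(** Starting at 0 and increasing strictly, the intervals from [c i] to [c (S i)] are nonempty and
    partition the natural numbers. *)
Definition cut (c : nat -> nat) : Prop := c 0 = 0 /\ forall i, c i < c (S i).

Lemma slice_S (X : Type) (w : nat -> X) i j :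
  i <= j -> slice w i (S j) = slice w i j ++ [w j].
Proof.
  intros h. unfold slice. replace (S j - i) with (S (j - i)) by lia.
  rewrite seq_S, map_app. simpl. repeat f_equal; lia.
Qed.

Lemma slice_nil (X : Type) (w : nat -> X) i : slice w i i = [].
Proof. unfold slice. rewrite Nat.sub_diag. reflexivity. Qed.

Lemma slice_length (X : Type) (w : nat -> X) i j : length (slice w i j) = j - i.
Proof. unfold slice. rewrite length_map, length_seq. reflexivity. Qed.

Lemma slice_nth (X : Type) (w : nat -> X) i j k :
  k < j - i -> nth_error (slice w i j) k = Some (w (i + k)).
Proof.
  intros h. unfold slice. rewrite nth_error_map, nth_error_seq.
  destruct (k <? j - i) eqn:E; [reflexivity|]. apply Nat.ltb_ge in E; lia.
Qed.

Lemma in_slice (X : Type) (w : nat -> X) i j x :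
  In x (slice w i j) <-> exists n, i <= n < j /\ w n = x.
Proof.
  unfold slice. rewrite in_map_iff. split.
  - intros [n [h hn]]. apply in_seq in hn. exists n; split; [lia|assumption].
  - intros [n [h hn]]. exists n; split; [assumption|apply in_seq; lia].
Qed.

Lemma map_slice (X Y : Type) (f : X -> Y) (w : nat -> X) i j :
  map f (slice w i j) = slice (fun n => f (w n)) i j.
Proof. unfold slice. rewrite map_map. reflexivity. Qed.

Lemma slice_app (X : Type) (w : nat -> X) i j k :
  i <= j <= k -> slice w i k = slice w i j ++ slice w j k.
Proof.
  intros h. induction k as [|k IH].
  - replace j with 0 by lia. rewrite slice_nil, app_nil_r. reflexivity.
  - destruct (Nat.eq_dec j (S k)) as [->|hj].
    + rewrite slice_nil, app_nil_r. reflexivity.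
    + rewrite !slice_S, IH, app_assoc by lia. reflexivity.
Qed.

Lemma cut_mono c i j : cut c -> i <= j -> c i <= c j.
Proof. intros [_ hc]. induction 1 as [|j hj IH]; [lia|specialize (hc j); lia]. Qed.

Lemma cut_ge c i : cut c -> i <= c i.
Proof. intros [h0 hc]. induction i as [|i IH]; [lia|specialize (hc i); lia]. Qed.

Lemma cut_idx c n : cut c -> exists i, c i <= n < c (S i).
Proof.
  intros hc. destruct hc as [h0 hS]. induction n as [|n [i hi]].
  - exists 0. specialize (hS 0); lia.
  - destruct (Nat.eq_dec (S n) (c (S i))).
    + exists (S i). specialize (hS (S i)); lia.
    + exists i; lia.
Qed.

Lemma cut_idx_unique c n i j :
  cut c -> c i <= n < c (S i) -> c j <= n < c (S j) -> i = j.
Proof.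
  intros hc h1 h2. destruct (Nat.lt_trichotomy i j) as [h|[h|h]]; [exfalso| |exfalso]; auto.
  - pose proof (cut_mono hc h); lia.
  - pose proof (cut_mono hc h); lia.
Qed.

(** The letter at [n] is read off from the unique block whose interval contains [n]. *)
Lemma glue (X : Type) (c : nat -> nat) (L : nat -> list X) :
  cut c -> (forall i, length (L i) = c (S i) - c i) ->
  exists w, forall i, slice w (c i) (c (S i)) = L i.
Proof.
  intros hc hL.
  destruct (@choose nat X
    (fun n x => forall i, c i <= n < c (S i) -> nth_error (L i) (n - c i) = Some x)) as [w hw].
  { intros n. destruct (cut_idx n hc) as [i hi].
    destruct (nth_error (L i) (n - c i)) as [x|] eqn:E.
    - exists x. intros j hj. rewrite (@cut_idx_unique c n j i hc hj hi). assumption.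
    - apply nth_error_None in E. rewrite hL in E. lia. }
  exists w. intros i. apply nth_error_ext. intros k.
  destruct (Nat.lt_ge_cases k (c (S i) - c i)) as [h|h].
  - rewrite slice_nth by assumption. rewrite <- (hw (c i + k) i) by lia.
    f_equal; lia.
  - rewrite (proj2 (nth_error_None _ _)) by (rewrite slice_length; lia).
    symmetry; apply nth_error_None. rewrite hL; lia.
Qed.

Lemma Inf_cut (c : nat -> nat) (P : nat -> Prop) : cut c ->
  (Inf P <-> Inf (fun i => exists n, c i <= n < c (S i) /\ P n)).
Proof.
  intros hc. split; intros h n.
  - destruct (h (c n)) as [m [hm hp]]. destruct (cut_idx m hc) as [i hi].
    exists i; split; [|eauto]. destruct (Nat.le_gt_cases n i); [assumption|].
    pose proof (@cut_mono c (S i) n hc ltac:(lia)); lia.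
  - destruct (h n) as [i [hi [m [hm hp]]]]. exists m; split; [|assumption].
    pose proof (cut_ge i hc); lia.
Qed.

(** * Omega-regular languages *)

(* Omega-regularity without an acceptance condition: membership depends only on the types,
   in some finite automaton, of the factors of an arbitrary factorisation.  In this form
   closure under projection needs no Ramsey argument. *)
Definition oreg (X : Type) (W : (nat -> X) -> Prop) : Prop :=
  exists (Q : Type) (q0 : Q) (step : Q -> X -> Q), finite_type Q /\
    forall w w' c c', cut c -> cut c' ->
      (forall i, fold_left step (slice w (c i) (c (S i))) q0 =
                 fold_left step (slice w' (c' i) (c' (S i))) q0) ->
      W w -> W w'.

Lemma oreg_ext (X : Type) (W W' : (nat -> X) -> Prop) :
  (forall w, W w <-> W' w) -> oreg W -> oreg W'.
Proof.
  intros h [Q [q0 [step [hf H]]]]. exists Q, q0, step; split; [assumption|].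
  intros w w' c c' hc hc' e. rewrite <- !h. exact (H _ _ _ _ hc hc' e).
Qed.

Lemma oreg_not (X : Type) (W : (nat -> X) -> Prop) : oreg W -> oreg (fun w => ~ W w).
Proof.
  intros [Q [q0 [step [hf H]]]]. exists Q, q0, step; split; [assumption|].
  intros w w' c c' hc hc' e h h'. apply h. refine (H _ _ _ _ hc' hc _ h').
  intros i; symmetry; apply e.
Qed.

Lemma fold_left_pair (X Q R : Type) (f : Q -> X -> Q) (g : R -> X -> R) l q r :
  fold_left (fun s x => (f (fst s) x, g (snd s) x)) l (q, r) =
  (fold_left f l q, fold_left g l r).
Proof. revert q r; induction l as [|x l IH]; intros; simpl; [reflexivity|apply IH]. Qed.

Lemma oreg_and (X : Type) (W W' : (nat -> X) -> Prop) :
  oreg W -> oreg W' -> oreg (fun w => W w /\ W' w).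
Proof.
  intros [Q [q0 [f [hf H]]]] [R [r0 [g [hg H']]]].
  exists (Q * R)%type, (q0, r0), (fun s x => (f (fst s) x, g (snd s) x)).
  split; [apply fin_prod; assumption|].
  intros w w' c c' hc hc' e [h1 h2].
  split; [refine (H _ _ _ _ hc hc' _ h1)|refine (H' _ _ _ _ hc hc' _ h2)];
    intros i; specialize (e i); rewrite !fold_left_pair in e; congruence.
Qed.

Lemma oreg_or (X : Type) (W W' : (nat -> X) -> Prop) :
  oreg W -> oreg W' -> oreg (fun w => W w \/ W' w).
Proof.
  intros h h'. apply oreg_ext with (W := fun w => ~ (~ W w /\ ~ W' w)).
  - intros w; split; [intros; apply NNPP|]; tauto.
  - apply oreg_not, oreg_and; apply oreg_not; assumption.
Qed.

Lemma oreg_const (X : Type) (P : Prop) : @oreg X (fun _ => P).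
Proof. exists unit, tt, (fun _ _ => tt). split; [apply fin_unit|auto]. Qed.

Lemma oreg_ex_lt (X : Type) (W : nat -> (nat -> X) -> Prop) N :
  (forall k, oreg (W k)) -> oreg (fun w => exists k, k < N /\ W k w).
Proof.
  intros h. induction N as [|N IH].
  - apply oreg_ext with (W := fun _ => False); [|apply oreg_const].
    intros w; split; [tauto|intros [k [hk _]]; lia].
  - eapply oreg_ext; [|exact (oreg_or IH (h N))]. intros w; split.
    + intros [[k [hk hw]]|hw]; [exists k|exists N]; split; auto.
    + intros [k [hk hw]]. destruct (Nat.eq_dec k N) as [->|]; [auto|].
      left; exists k; split; [lia|assumption].
Qed.

Lemma fold_left_map (X Z Q : Type) (step : Q -> X -> Q) (f : Z -> X) l q :
  fold_left (fun q z => step q (f z)) l q = fold_left step (map f l) q.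
Proof. revert q; induction l as [|x l IH]; intros; simpl; [reflexivity|apply IH]. Qed.

Lemma oreg_pre (X Z : Type) (f : Z -> X) (W : (nat -> X) -> Prop) :
  oreg W -> oreg (fun z => W (fun n => f (z n))).
Proof.
  intros [Q [q0 [step [hf H]]]]. exists Q, q0, (fun q z => step q (f z)).
  split; [assumption|]. intros w w' c c' hc hc' e. refine (H _ _ _ _ hc hc' _).
  intros i; specialize (e i). rewrite !(fold_left_map step f), !map_slice in e. exact e.
Qed.

(** Subset construction: the type of a factor is the set of types of its preimages. If the types
    agree, each factor of [w'] has a preimage of the same type as the corresponding factor of [z],
    and these preimages are glued to the required word. *)
Lemma oreg_image (X Z : Type) (f : Z -> X) (W : (nat -> Z) -> Prop) :
  oreg W -> oreg (fun w => exists z, (forall n, f (z n) = w n) /\ W z).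
Proof.
  intros [Q [q0 [step [hf H]]]].
  set (step' := fun (q : Q -> Prop) (x : X) =>
                  fun s' => exists s z, q s /\ f z = x /\ step s z = s').
  exists (Q -> Prop), (fun q => q = q0), step'. split; [apply fin_pred; assumption|].
  assert (E : forall l s, fold_left step' l (fun q => q = q0) s <->
                          exists zl, map f zl = l /\ fold_left step zl q0 = s).
  { induction l as [|x l IH] using rev_ind; intros s.
    - simpl. split.
      + intros ->; exists []; auto.
      + intros [[|z zl] [h1 h2]]; [simpl in h2; auto|discriminate].
    - rewrite fold_left_app; simpl. unfold step' at 1. split.
      + intros [s1 [z [h1 [h2 h3]]]]. apply IH in h1. destruct h1 as [zl [h4 h5]].
        exists (zl ++ [z]). rewrite map_app, fold_left_app; simpl. split; congruence.
      + intros [zl [h1 h2]]. apply map_eq_app in h1. destruct h1 as [l1 [l2 [-> [h3 h4]]]].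
        destruct l2 as [|z [|z' l2]]; try discriminate. rewrite fold_left_app in h2.
        exists (fold_left step l1 q0), z. simpl in *. split; [apply IH; eauto|].
        split; congruence. }
  intros w w' c c' hc hc' e [z [hz hW]].
  destruct (@choose nat (list Z) (fun i zl => map f zl = slice w' (c' i) (c' (S i)) /\
     fold_left step zl q0 = fold_left step (slice z (c i) (c (S i))) q0)) as [L hL].
  { intros i. apply E. rewrite <- e. apply E. exists (slice z (c i) (c (S i))).
    split; [|reflexivity]. rewrite map_slice. unfold slice. apply map_ext. assumption. }
  destruct (@glue Z c' L hc') as [z' hz'].
  { intros i. destruct (hL i) as [h _]. apply (f_equal (@length _)) in h.
    rewrite length_map, slice_length in h. assumption. }
  exists z'; split.
  - intros n. destruct (cut_idx n hc') as [i hi].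
    destruct (hL i) as [h _]. rewrite <- hz', map_slice in h.
    apply (f_equal (fun l => nth_error l (n - c' i))) in h.
    rewrite !slice_nth in h by lia. replace (c' i + (n - c' i)) with n in h by lia.
    congruence.
  - refine (H z z' c c' hc hc' _ hW). intros i. rewrite hz'. symmetry; apply hL.
Qed.

(** The type of a factor says whether [phi] occurs in it; occurring infinitely often means occurring
    in infinitely many factors. *)
Lemma oreg_Inf (X : Type) (phi : X -> Prop) : oreg (fun w => Inf (fun n => phi (w n))).
Proof.
  exists Prop, False, (fun q x => q \/ phi x). split; [apply fin_Prop|].
  assert (E : forall l q, fold_left (fun q x => q \/ phi x) l q <-> q \/ exists x, In x l /\ phi x).
  { induction l as [|x l IH]; intros q; simpl.
    - split; [auto|intros [h|[x [[] _]]]; assumption].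
    - rewrite IH. split.
      + intros [[h|h]|[y [h h']]]; eauto.
      + intros [h|[y [[<-|h] h']]]; eauto. }
  intros w w' c c' hc hc' e h.
  apply (Inf_cut (fun n => phi (w n)) hc) in h. apply (Inf_cut (fun n => phi (w' n)) hc').
  eapply Inf_impl; [|exact h]. intros i [n [hn hp]].
  assert (h1 : fold_left (fun q x => q \/ phi x) (slice w (c i) (c (S i))) False).
  { apply E. right. exists (w n). split; [apply in_slice; eauto|assumption]. }
  rewrite e in h1. apply E in h1. destruct h1 as [[]|[x [h1 h2]]].
  apply in_slice in h1. destruct h1 as [m [hm <-]]. eauto.
Qed.

(** The type of a factor consists of its first letter, its last letter and the validity of all steps
    inside it. The steps across a cut are then checked on the last letter of one factor and the
    first of the next. *)
Lemma oreg_step (X : Type) (phi : X -> X -> Prop) :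
  finite_type X -> oreg (fun w => forall n, phi (w n) (w (S n))).
Proof.
  intros hX.
  set (step := fun (q : option (X * X) * Prop) x =>
     match fst q with
     | None => (Some (x, x), snd q)
     | Some (a, b) => (Some (a, x), snd q /\ phi b x)
     end).
  exists (option (X * X) * Prop)%type, (None, True), step.
  split; [apply fin_prod; [apply fin_option, fin_prod; assumption|apply fin_Prop]|].
  assert (E : forall w i j, i <= j ->
    fold_left step (slice w i (S j)) (None, True) =
    (Some (w i, w j), forall n, i <= n -> n < j -> phi (w n) (w (S n)))).
  { intros w i j h. induction h as [|j h IH].
    - rewrite slice_S, slice_nil by lia. simpl. unfold step; simpl. f_equal.
      apply propositional_extensionality; split; [intros; lia|trivial].
    - rewrite slice_S by lia. rewrite fold_left_app, IH. unfold step; simpl. f_equal.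
      apply propositional_extensionality; split.
      + intros [h1 h2] n h3 h4. destruct (Nat.eq_dec n j) as [->|]; [assumption|].
        apply h1; lia.
      + intros h1; split; [intros; apply h1; lia|apply h1; lia]. }
  assert (E' : forall w c i, cut c ->
    fold_left step (slice w (c i) (c (S i))) (None, True) =
    (Some (w (c i), w (pred (c (S i)))),
      forall n, c i <= n -> S n < c (S i) -> phi (w n) (w (S n)))).
  { intros w c i [_ hc]. specialize (hc i). destruct (c (S i)) as [|k]; [lia|].
    rewrite E by lia. simpl. f_equal. apply propositional_extensionality; split;
    intros h n h1 h2; apply h; lia. }
  intros w w' c c' hc hc' e h n.
  assert (e' : forall i, w (c i) = w' (c' i) /\ w (pred (c (S i))) = w' (pred (c' (S i))) /\
     forall n, c' i <= n -> S n < c' (S i) -> phi (w' n) (w' (S n))).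
  { intros i. specialize (e i). rewrite !E' in e by assumption.
    pose proof (f_equal snd e) as h3; pose proof (f_equal fst e) as h12; simpl in h3, h12.
    split; [congruence|split; [congruence|]]. rewrite <- h3. auto. }
  destruct (cut_idx n hc') as [i hi].
  destruct (Nat.eq_dec (S n) (c' (S i))) as [hn|hn].
  - destruct (e' i) as [_ [h1 _]]. destruct (e' (S i)) as [h2 _].
    replace n with (pred (c' (S i))) at 1 by lia. rewrite hn, <- h1, <- h2.
    destruct hc as [_ hc]. specialize (hc i).
    specialize (h (pred (c (S i)))). replace (S (pred (c (S i)))) with (c (S i)) in h by lia.
    exact h.
  - apply (e' i); lia.
Qed.

Lemma oreg_all (X : Type) (phi : X -> Prop) :
  finite_type X -> oreg (fun w => forall n, phi (w n)).
Proof. intros hX. exact (oreg_step (fun x _ => phi x) hX). Qed.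

Lemma oreg_ex (X : Type) (phi : X -> Prop) :
  finite_type X -> oreg (fun w => exists n, phi (w n)).
Proof.
  intros hX. eapply oreg_ext; [|exact (oreg_not (oreg_all (fun x => ~ phi x) hX))].
  intros w; split; [apply not_all_not_ex|]. intros [n hn] h; apply (h n hn).
Qed.

Lemma oreg_first (X : Type) (phi : X -> Prop) : oreg (fun w => phi (w 0)).
Proof.
  exists (option Prop), None, (fun q x => match q with None => Some (phi x) | _ => q end).
  split; [apply fin_option, fin_Prop|].
  assert (E : forall w c, cut c -> fold_left (fun q x => match q with None => Some (phi x) | _ => q end)
      (slice w (c 0) (c 1)) None = Some (phi (w 0))).
  { intros w c [h0 hc]. specialize (hc 0). rewrite h0 in *. destruct (c 1) as [|k]; [lia|].
    clear hc. induction k as [|k IH].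
    - rewrite slice_S, slice_nil by lia; reflexivity.
    - rewrite slice_S by lia. rewrite fold_left_app, IH; reflexivity. }
  intros w w' c c' hc hc' e. specialize (e 0). rewrite !E in e by assumption.
  injection e as h. rewrite h. trivial.
Qed.

(** * The parity condition *)

(** The limit inferior of [p], as a relation because it need not exist for unbounded [p]. *)
Definition minf (p : nat -> nat) (k : nat) : Prop :=
  Inf (fun n => p n = k) /\ exists N, forall n, N <= n -> k <= p n.

Definition Par (b : bool) (p : nat -> nat) : Prop := exists k, minf p k /\ Nat.even k = b.

Lemma minf_unique p k k' : minf p k -> minf p k' -> k = k'.
Proof.
  intros [h1 [N h2]] [h1' [N' h2']].
  destruct (h1 N') as [n [hn <-]]. destruct (h1' N) as [n' [hn' <-]].
  specialize (h2 n' hn'). specialize (h2' n hn). lia.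
Qed.

Lemma least (P : nat -> Prop) : (exists n, P n) -> exists n, P n /\ forall m, P m -> n <= m.
Proof.
  intros [n hn]. induction n as [n IH] using lt_wf_ind.
  destruct (classic (exists m, m < n /\ P m)) as [[m [h1 h2]]|h]; [eauto|].
  exists n; split; [assumption|]. intros m hm. destruct (Nat.le_gt_cases n m); [assumption|].
  exfalso; eauto.
Qed.

Lemma minf_exists p B : (forall n, p n < B) -> exists k, minf p k.
Proof.
  intros hB.
  destruct (@least (fun k => Inf (fun n => p n = k))) as [k [hk hmin]].
  { destruct (@Inf_fin {i | i < B} (fun k n => p n = proj1_sig k)) as [[k hk] h].
    - apply fin_lt.
    - intros n; exists n; split; [lia|exists (exist _ (p n) (hB n)); reflexivity].
    - exists k; exact h. }
  exists k; split; [assumption|].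
  assert (H : forall j, j <= k -> exists N, forall n, N <= n -> j <= p n).
  { induction j as [|j IH]; intros hj; [exists 0; lia|].
    destruct (IH ltac:(lia)) as [N hN].
    destruct (@not_Inf (fun n => p n = j)) as [N' hN'].
    { intros h. specialize (hmin j h). lia. }
    exists (N + N'). intros n hn. specialize (hN n ltac:(lia)).
    specialize (hN' n ltac:(lia)). lia. }
  apply H; lia.
Qed.

Lemma Par_excl b p : Par b p -> Par (negb b) p -> False.
Proof.
  intros [k [h1 h2]] [k' [h1' h2']]. rewrite (minf_unique h1 h1') in h2.
  destruct b; simpl in *; congruence.
Qed.

Lemma Inf_shift (P : nat -> Prop) m : Inf (fun n => P (m + n)) <-> Inf P.
Proof.
  split; intros h n.
  - destruct (h n) as [k [hk hp]]. exists (m + k); split; [lia|assumption].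
  - destruct (h (m + n)) as [k [hk hp]]. exists (k - m); split; [lia|].
    replace (m + (k - m)) with k by lia. assumption.
Qed.

Lemma minf_shift p m k : minf (fun n => p (m + n)) k <-> minf p k.
Proof.
  unfold minf. rewrite (Inf_shift (fun n => p n = k) m). split; intros [h [N hN]]; split; auto.
  - exists (m + N). intros n hn. specialize (hN (n - m) ltac:(lia)).
    replace (m + (n - m)) with n in hN by lia. assumption.
  - exists N. intros n hn. apply hN. lia.
Qed.

Lemma Par_shift b p m : Par b (fun n => p (m + n)) <-> Par b p.
Proof. unfold Par. split; intros [k hk]; exists k; rewrite minf_shift in *; assumption. Qed.

Lemma Par_ext b p p' : (forall n, p n = p' n) -> Par b p -> Par b p'.
Proof. intros h. replace p' with p; [auto|]. apply functional_extensionality, h. Qed.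

(** For plays that are known only segment by segment, through the set of priorities in each
    segment. *)
Lemma minf_cut p c k : cut c ->
  (minf p k <-> Inf (fun i => exists n, c i <= n < c (S i) /\ p n = k) /\
     exists N, forall i, N <= i -> forall n, c i <= n < c (S i) -> k <= p n).
Proof.
  intros hc. unfold minf. rewrite (Inf_cut (fun n => p n = k) hc).
  split; intros [h [N hN]]; split; auto.
  - exists N. intros i hi n hn. apply hN. pose proof (cut_ge i hc); lia.
  - exists (c N). intros n hn. destruct (cut_idx n hc) as [i hi]. apply (hN i); [|assumption].
    destruct (Nat.le_gt_cases N i); [assumption|].
    pose proof (@cut_mono c (S i) N hc ltac:(lia)); lia.
Qed.

(** * Determinisation *)

Section Determinisation.

Variables (X Q : Type) (q0 : Q) (step : Q -> X -> Q) (N : nat).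
Hypothesis hN : forall l : list Q, NoDup l -> length l <= N.

Definition dup (V : list Q) (i j : nat) : Prop :=
  j < i /\ exists s, nth_error V i = Some s /\ nth_error V j = Some s.

Lemma dup_exists V : N < length V -> exists i j, dup V i j.
Proof.
  intros h. apply NNPP; intros hn. assert (hd : NoDup V).
  { apply NoDup_nth_error. intros i j hi e.
    destruct (nth_error V i) as [s|] eqn:E; [|apply nth_error_None in E; lia].
    destruct (Nat.lt_trichotomy i j) as [h'|[h'|h']]; [|assumption|]; exfalso; apply hn.
    - exists j, i; split; [assumption|]. exists s; auto.
    - exists i, j; split; [assumption|]. exists s; auto. }
  apply hN in hd. lia.
Qed.

(** Any duplicate will do; fixing a choice function makes [dstep] deterministic. *)
Lemma first_dup_exists : exists fd : list Q -> option (nat * nat), forall V,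
  match fd V with
  | Some (i, j) => dup V i j
  | None => forall i j, ~ dup V i j
  end.
Proof.
  apply (@choose (list Q) (option (nat * nat)) (fun V o => match o with
  | Some (i, j) => dup V i j
  | None => forall i j, ~ dup V i j end)).
  intros V. destruct (classic (exists i j, dup V i j)) as [[i [j h]]|h].
  - exists (Some (i, j)). assumption.
  - exists None. intros i j hd; apply h; eauto.
Qed.

Definition remove_at (A : Type) (i : nat) (L : list A) : list A := firstn i L ++ skipn (S i) L.

Lemma nth_remove (A : Type) i (L : list A) k : i < length L ->
  nth_error (remove_at i L) k = if k <? i then nth_error L k else nth_error L (S k).
Proof.
  intros h. unfold remove_at. destruct (k <? i) eqn:E.
  - apply Nat.ltb_lt in E. rewrite nth_error_app1 by (rewrite length_firstn; lia).
    rewrite nth_error_firstn. apply Nat.ltb_lt in E; rewrite E. reflexivity.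
  - apply Nat.ltb_ge in E. rewrite nth_error_app2 by (rewrite length_firstn; lia).
    rewrite length_firstn, nth_error_skipn. f_equal; lia.
Qed.

Lemma length_remove (A : Type) i (L : list A) : i < length L ->
  length (remove_at i L) = pred (length L).
Proof. intros h. unfold remove_at. rewrite length_app, length_firstn, length_skipn. lia. Qed.

Lemma map_remove (A B : Type) (f : A -> B) i L :
  map f (remove_at i L) = remove_at i (map f L).
Proof. unfold remove_at. rewrite map_app, firstn_map, skipn_map. reflexivity. Qed.

Lemma Forall_remove (A : Type) (P : A -> Prop) i L : Forall P L -> Forall P (remove_at i L).
Proof.
  intros h. unfold remove_at. apply Forall_app; split.
  - rewrite <- (firstn_skipn i L) in h. apply Forall_app in h; tauto.
  - rewrite <- (firstn_skipn (S i) L) in h. apply Forall_app in h; tauto.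
Qed.

Variables (fd : list Q -> option (nat * nat)) (acc : Q -> Q -> Prop).
Hypothesis hfd : forall V, match fd V with
  | Some (i, j) => dup V i j
  | None => forall i j, ~ dup V i j
  end.

(* A slot is a position p of the word read so far, remembered through the value of the
   factor from p to the present and the values that the older slots had at time p.  Two
   slots with the same value have merged forever; the younger one is removed. *)
Definition slot : Type := (Q * list Q)%type.
Definition dstate : Type := (list slot * nat)%type.

Definition advance (L : list slot) (x : X) : list slot :=
  map (fun s => (step (fst s) x, snd s)) L ++ [(q0, map (fun s => step (fst s) x) L)].

(** When slot [i] merges into the older slot [j], its entry [e] contains the type of the prefix up
    to its position (slot 0 is position 0) and the type of the factor between the two positions. An
    even priority says that a word of type x, y, y, and so on, for these two types, is accepted.
    Smaller indices get smaller priorities because older slots are more stable. *)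
Definition verdict (i j : nat) (e : list Q) : nat :=
  if excluded_middle_informative (acc (nth 0 e q0) (nth j e q0)) then 2 * i else 2 * i + 1.

(** The priority [2 * N + 2], given when nothing is removed, exceeds every verdict, since removed
    indices are at most [N]. *)
Definition dstep (m : dstate) (x : X) : dstate :=
  let L := advance (fst m) x in
  match fd (map fst L) with
  | None => (L, 2 * N + 2)
  | Some (i, j) => (remove_at i L, verdict i j (snd (nth i L (q0, []))))
  end.

Definition dinit : dstate := ([(q0, [])], 2 * N + 2).

Definition dbounded (m : dstate) : Prop :=
  length (fst m) <= N /\ Forall (fun s => length (snd s) <= N) (fst m) /\ snd m < 2 * N + 3.

Lemma fd_lt V i j : fd V = Some (i, j) -> i < length V.
Proof.
  intros h. pose proof (hfd V) as hV. rewrite h in hV. destruct hV as [_ [s [hs _]]].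
  apply nth_error_Some. congruence.
Qed.

Lemma length_advance L x : length (advance L x) = S (length L).
Proof. unfold advance. rewrite length_app, length_map. apply Nat.add_1_r. Qed.

Lemma dbounded_init : dbounded dinit.
Proof.
  assert (h : 1 <= N). { apply (hN (l := [q0])). repeat constructor; simpl; tauto. }
  unfold dbounded, dinit; simpl. split; [assumption|split; [|lia]].
  repeat constructor; simpl; lia.
Qed.

Lemma dbounded_step m x : dbounded m -> dbounded (dstep m x).
Proof.
  intros [h1 [h2 h3]]. unfold dstep.
  assert (hF : Forall (fun s : slot => length (snd s) <= N) (advance (fst m) x)).
  { unfold advance. apply Forall_app; split.
    - apply Forall_map. simpl. assumption.
    - constructor; [simpl; rewrite length_map; assumption|constructor]. }
  destruct (fd (map fst (advance (fst m) x))) as [[i j]|] eqn:E; unfold dbounded; simpl fst; simpl snd.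
  - pose proof (fd_lt E) as hi. rewrite length_map in hi.
    rewrite length_remove by assumption. rewrite length_advance in *.
    split; [simpl; lia|split; [apply Forall_remove; assumption|]].
    unfold verdict. destruct (excluded_middle_informative _); lia.
  - rewrite length_advance. split; [|split; [assumption|lia]].
    destruct (Nat.le_gt_cases (S (length (fst m))) N); [assumption|exfalso].
    destruct (@dup_exists (map fst (advance (fst m) x))) as [i [j hd]].
    { rewrite length_map, length_advance. lia. }
    pose proof (hfd (map fst (advance (fst m) x))) as h. rewrite E in h. exact (h i j hd).
Qed.

Lemma fin_dbounded : finite_type Q -> finite_type {m | dbounded m}.
Proof.
  intros [l hl]. apply fin_sig.
  destruct (@bounded_lists Q (fun _ => True) (ex_intro _ l (fun a _ => hl a)) N) as [L1 h1].
  destruct (@bounded_lists slot (fun s => length (snd s) <= N)) with (n := N) as [L2 h2].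
  { exists (list_prod l L1). intros [q e] he. apply in_prod; [apply hl|].
    apply h1; [assumption|]. apply Forall_forall; trivial. }
  exists (list_prod L2 (seq 0 (2 * N + 3))). intros [L p] [h3 [h4 h5]].
  apply in_prod; [apply h2; assumption|apply in_seq; simpl in h5; lia].
Qed.

Variable w : nat -> X.

Definition val (i j : nat) : Q := fold_left step (slice w i j) q0.

Lemma val_S i j : i <= j -> val i (S j) = step (val i j) (w j).
Proof. intros h. unfold val. rewrite slice_S by assumption. rewrite fold_left_app. reflexivity. Qed.

Lemma val_merge p q n m : p <= n -> q <= n -> n <= m -> val p n = val q n -> val p m = val q m.
Proof. intros hp hq h e. induction h as [|m h IH]; [assumption|]. rewrite !val_S by lia. congruence. Qed.

(* The list of positions represented by the slots, in order of age. *)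
Fixpoint ghost (n : nat) : list nat :=
  match n with
  | 0 => [0]
  | S n => let G := ghost n ++ [S n] in
           match fd (map (fun p => val p (S n)) G) with
           | None => G
           | Some (i, _) => remove_at i G
           end
  end.

Definition event (n : nat) : option (nat * nat) :=
  fd (map (fun p => val p (S n)) (ghost n ++ [S n])).

Lemma ghost_S n : ghost (S n) = match event n with
  | None => ghost n ++ [S n] | Some (i, _) => remove_at i (ghost n ++ [S n]) end.
Proof. reflexivity. Qed.

(** The second component of the slot opened at [p], computed from the word instead of the run. The
    slot opened at 0 has no older ones, in accordance with [dinit]. *)
Definition entry (p : nat) : list Q :=
  match p with 0 => [] | S n => map (fun p => val p (S n)) (ghost n) end.

Definition drun (n : nat) : dstate := fold_left dstep (slice w 0 n) dinit.

Lemma drun_S n : drun (S n) = dstep (drun n) (w n).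
Proof. unfold drun. rewrite slice_S by lia. rewrite fold_left_app. reflexivity. Qed.

Lemma event_lt n i j : event n = Some (i, j) -> i < length (ghost n ++ [S n]).
Proof. intros h. apply fd_lt in h. rewrite length_map in h. assumption. Qed.

Lemma event_dup n i j : event n = Some (i, j) -> j < i /\ exists p q,
  nth_error (ghost n ++ [S n]) i = Some q /\ nth_error (ghost n) j = Some p /\
  val p (S n) = val q (S n).
Proof.
  intros h. pose proof (event_lt h) as hlt. rewrite length_app in hlt; simpl in hlt.
  pose proof (hfd (map (fun p => val p (S n)) (ghost n ++ [S n]))) as hd.
  unfold event in h. rewrite h in hd. destruct hd as [hj [s [h1 h2]]]. split; [assumption|].
  rewrite nth_error_map in h1, h2.
  destruct (nth_error (ghost n ++ [S n]) i) as [q|]; [|discriminate].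
  destruct (nth_error (ghost n ++ [S n]) j) as [p|] eqn:E; [|discriminate].
  exists p, q. rewrite nth_error_app1 in E by lia. simpl in *. split; [|split]; congruence.
Qed.

Lemma ghost_nth n k : nth_error (ghost (S n)) k =
  match event n with
  | None => nth_error (ghost n ++ [S n]) k
  | Some (i, _) => if k <? i then nth_error (ghost n ++ [S n]) k
                   else nth_error (ghost n ++ [S n]) (S k)
  end.
Proof.
  rewrite ghost_S. destruct (event n) as [[i j]|] eqn:E; [|reflexivity].
  apply nth_remove. eapply event_lt; eassumption.
Qed.

Lemma nth_snoc (A : Type) (L : list A) a k q : nth_error (L ++ [a]) k = Some q ->
  (nth_error L k = Some q /\ k < length L) \/ (k = length L /\ q = a).
Proof.
  intros h. destruct (Nat.lt_ge_cases k (length L)) as [hk|hk].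
  - rewrite nth_error_app1 in h by assumption. auto.
  - rewrite nth_error_app2 in h by assumption. right.
    destruct (k - length L) as [|[|d]] eqn:E; simpl in h; try discriminate.
    split; [lia|congruence].
Qed.

Lemma ghost_le n k p : nth_error (ghost n) k = Some p -> p <= n.
Proof.
  revert k p. induction n as [|n IH]; intros k p h.
  - destruct k as [|[|k]]; simpl in h; try discriminate. inversion h; lia.
  - rewrite ghost_nth in h.
    assert (H : exists k, nth_error (ghost n ++ [S n]) k = Some p).
    { destruct (event n) as [[i j]|]; [destruct (k <? i)|]; eauto. }
    destruct H as [k' H]. apply nth_snoc in H. destruct H as [[H _]|[_ ->]]; [|lia].
    apply IH in H; lia.
Qed.

Lemma ghost_snoc_lt n (IH : forall i j p q, i < j -> nth_error (ghost n) i = Some p ->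
  nth_error (ghost n) j = Some q -> p < q) i j p q :
  i < j -> nth_error (ghost n ++ [S n]) i = Some p ->
  nth_error (ghost n ++ [S n]) j = Some q -> p < q.
Proof.
  intros hij h1 h2. apply nth_snoc in h1; apply nth_snoc in h2.
  destruct h1 as [[h1 h1']|[h1 h1']], h2 as [[h2 h2']|[h2 h2']]; subst; try lia.
  - eapply (IH i j); eassumption.
  - apply ghost_le in h1; lia.
Qed.

Lemma ghost_sorted n i j p q : i < j -> nth_error (ghost n) i = Some p ->
  nth_error (ghost n) j = Some q -> p < q.
Proof.
  revert i j p q. induction n as [|n IH]; intros i j p q hij h1 h2.
  - destruct j as [|[|j]]; simpl in h2; try discriminate; lia.
  - rewrite ghost_nth in h1, h2. pose proof (ghost_snoc_lt n IH) as H.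
    destruct (event n) as [[k l]|]; [|eapply H; eassumption].
    destruct (i <? k) eqn:E1, (j <? k) eqn:E2;
      first [apply Nat.ltb_lt in E1|apply Nat.ltb_ge in E1];
      first [apply Nat.ltb_lt in E2|apply Nat.ltb_ge in E2];
      (eapply H; [|exact h1|exact h2]); lia.
Qed.

Lemma ghost_length n : length (ghost n) <= N.
Proof.
  induction n as [|n IH].
  - apply dbounded_init.
  - rewrite ghost_S. destruct (event n) as [[i j]|] eqn:E.
    + rewrite length_remove by (eapply event_lt; eassumption).
      rewrite length_app; simpl; lia.
    + destruct (Nat.le_gt_cases (length (ghost n ++ [S n])) N) as [h|h]; [assumption|exfalso].
      destruct (@dup_exists (map (fun p => val p (S n)) (ghost n ++ [S n]))) as [i [j hd]].
      { rewrite length_map; assumption. }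
      pose proof (hfd (map (fun p => val p (S n)) (ghost n ++ [S n]))) as h'.
      unfold event in E. rewrite E in h'. exact (h' i j hd).
Qed.

(** Only the younger of two merging slots is removed, and index 0 is never the younger one. Hence
    the head of every later entry is the type of a full prefix. *)
Lemma ghost_head n : nth_error (ghost n) 0 = Some 0.
Proof.
  induction n as [|n IH]; [reflexivity|]. rewrite ghost_nth.
  assert (H : nth_error (ghost n ++ [S n]) 0 = Some 0).
  { rewrite nth_error_app1; [assumption|]. apply nth_error_Some; congruence. }
  destruct (event n) as [[i j]|] eqn:E; [|assumption].
  destruct (event_dup E) as [hj _]. destruct (0 <? i) eqn:E'; [assumption|].
  apply Nat.ltb_ge in E'; lia.
Qed.

Lemma advance_ghost n L : L = map (fun p => (val p n, entry p)) (ghost n) ->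
  advance L (w n) = map (fun p => (val p (S n), entry p)) (ghost n ++ [S n]).
Proof.
  intros ->. unfold advance. rewrite map_app, !map_map.
  assert (e : forall p, In p (ghost n) -> step (val p n) (w n) = val p (S n)).
  { intros p hp. apply In_nth_error in hp. destruct hp as [k hp]. apply ghost_le in hp.
    symmetry; apply val_S; assumption. }
  assert (e' : val (S n) (S n) = q0) by (unfold val; rewrite slice_nil; reflexivity).
  f_equal.
  - apply map_ext_in. intros p hp. simpl. rewrite e by assumption. reflexivity.
  - change ([(q0, map (fun x => step (val x n) (w n)) (ghost n))] =
            [(val (S n) (S n), map (fun p => val p (S n)) (ghost n))]).
    rewrite e', (map_ext_in _ _ _ e). reflexivity.
Qed.

Lemma drun_ghost n : fst (drun n) = map (fun p => (val p n, entry p)) (ghost n).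
Proof.
  induction n as [|n IH]; [reflexivity|].
  rewrite drun_S. unfold dstep. rewrite (advance_ghost _ IH), map_map. simpl fst.
  rewrite ghost_S. unfold event. simpl fst.
  destruct (fd (map (fun p => val p (S n)) (ghost n ++ [S n]))) as [[i j]|]; simpl fst.
  - symmetry; apply map_remove.
  - reflexivity.
Qed.

Lemma drun_prio n : snd (drun (S n)) =
  match event n with
  | None => 2 * N + 2
  | Some (i, j) => verdict i j (entry (nth i (ghost n ++ [S n]) 0))
  end.
Proof.
  rewrite drun_S. unfold dstep. rewrite (advance_ghost _ (drun_ghost n)), map_map. simpl fst.
  destruct (event n) as [[i j]|] eqn:E; pose proof E as E0; unfold event in E; rewrite E; [|reflexivity].
  simpl snd. f_equal. pose proof (event_lt E0) as hlt.
  rewrite nth_indep with (d' := (fun p => (val p (S n), entry p)) 0) by (rewrite length_map; assumption).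
  rewrite (map_nth (fun p => (val p (S n), entry p))). reflexivity.
Qed.

(** [i] is the limit inferior of the removed indices, where no removal counts as [S N]. This value
    cannot be the limit, as without removals the number of slots would grow beyond [N]. *)
Lemma unstable_slot : exists i, Inf (fun n => exists j, event n = Some (i, j)) /\
  exists T, forall n, T <= n -> forall i' j, event n = Some (i', j) -> i <= i'.
Proof.
  set (p := fun n => match event n with Some (i, _) => i | None => S N end).
  destruct (@minf_exists p (S (S N))) as [k [h1 [T h2]]].
  { intros n. unfold p. destruct (event n) as [[i j]|] eqn:E; [|lia].
    apply event_lt in E. rewrite length_app in E. pose proof (ghost_length n). simpl in E; lia. }
  assert (hk : k <= N).
  { destruct (Nat.le_gt_cases k N) as [|h]; [assumption|exfalso].
    assert (H : forall d, d <= length (ghost (T + d))).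
    { induction d as [|d IH]; [lia|]. rewrite Nat.add_succ_r, ghost_S.
      specialize (h2 (T + d) ltac:(lia)). unfold p in h2.
      destruct (event (T + d)) as [[i j]|] eqn:E.
      - apply event_lt in E. rewrite length_app in E. pose proof (ghost_length (T + d)).
        simpl in E; lia.
      - rewrite length_app; simpl; lia. }
    specialize (H (S N)). pose proof (ghost_length (T + S N)). lia. }
  exists k; split.
  - eapply Inf_impl; [|exact h1]. intros n hn. unfold p in hn.
    destruct (event n) as [[i j]|]; [exists j; congruence|lia].
  - exists T. intros n hn i j e. specialize (h2 n hn). unfold p in h2. rewrite e in h2. assumption.
Qed.

Section Stable.
Variables (i0 T : nat).
Hypothesis hInf : Inf (fun n => exists j, event n = Some (i0, j)).
Hypothesis hT : forall n, T <= n -> forall i' j, event n = Some (i', j) -> i0 <= i'.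

Lemma stable_prefix : exists T1, T <= T1 /\ forall n, T1 <= n -> i0 <= length (ghost n) /\
  forall k, k < i0 -> nth_error (ghost n) k = nth_error (ghost T1) k.
Proof.
  (* A removal at [i0] shows that all slots before [i0] exist at this time; later removals do not
     touch them. *)
  destruct (hInf T) as [T1 [h [j e]]]. exists T1; split; [assumption|].
  assert (hl : i0 <= length (ghost T1)).
  { apply event_lt in e. rewrite length_app in e; simpl in e; lia. }
  induction 1 as [|n hn [IH1 IH2]]; [split; auto|].
  assert (H : forall k, k < i0 -> nth_error (ghost (S n)) k = nth_error (ghost T1) k).
  { intros k hk. rewrite <- IH2 by assumption. rewrite ghost_nth.
    destruct (event n) as [[i j']|] eqn:E.
    - apply hT in E; [|lia]. destruct (k <? i) eqn:E'; [|apply Nat.ltb_ge in E'; lia].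
      apply nth_error_app1; lia.
    - apply nth_error_app1; lia. }
  split; [|assumption].
  destruct (Nat.le_gt_cases i0 (length (ghost (S n)))) as [|h']; [assumption|exfalso].
  specialize (H _ h'). rewrite (proj2 (nth_error_None _ _)) in H by lia.
  symmetry in H. apply nth_error_None in H. lia.
Qed.

(** The positions are sorted, so each removal at [i0] deletes the smallest position with index at
    least [i0]. Infinitely many removals push all these positions beyond any bound. *)
Lemma unstable_large B : exists n0, T <= n0 /\ forall n, n0 <= n -> forall k q, i0 <= k ->
  nth_error (ghost n ++ [S n]) k = Some q -> B <= q.
Proof.
  induction B as [|B [n0 [hn0 IH]]]; [exists T; split; [lia|intros; lia]|].
  destruct (hInf (n0 + B)) as [m [hm [j e]]].
  assert (H : forall n, S m <= n -> forall k q, i0 <= k ->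
    nth_error (ghost n) k = Some q -> S B <= q).
  { induction 1 as [|n hn IHn]; intros k q hk hq; rewrite ghost_nth in hq.
    - rewrite e in hq. destruct (k <? i0) eqn:E; [apply Nat.ltb_lt in E; lia|].
      destruct (event_dup e) as [_ [_ [q' [h1 _]]]].
      pose proof (IH m ltac:(lia) i0 q' ltac:(lia) h1).
      pose proof (@ghost_snoc_lt m (@ghost_sorted m) i0 (S k) q' q ltac:(lia) h1 hq). lia.
    - assert (H : exists k, i0 <= k /\ nth_error (ghost n ++ [S n]) k = Some q).
      { destruct (event n) as [[i j']|]; [destruct (k <? i)|]; eauto. }
      destruct H as [k' [hk' H]]. apply nth_snoc in H. destruct H as [[H _]|[_ ->]]; [eauto|lia]. }
  exists (S m); split; [lia|]. intros n hn k q hk hq.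
  apply nth_snoc in hq. destruct hq as [[hq _]|[_ ->]]; [eapply H; eassumption|lia].
Qed.

(* From some time on the slots before i0 are fixed, so infinitely many removed positions q
   merge with the same position p, and val 0 q and val p q can be taken constant.  Cutting
   the word at such positions, far enough apart, gives factors of type x, y, y, y, and so on. *)
Lemma verdict_factor (b : Prop) :
  Inf (fun n => exists j q, event n = Some (i0, j) /\ nth_error (ghost n ++ [S n]) i0 = Some q /\
         (acc (nth 0 (entry q) q0) (nth j (entry q) q0) <-> b)) ->
  finite_type Q ->
  exists x y c, cut c /\ val (c 0) (c 1) = x /\
    (forall i, 1 <= i -> val (c i) (c (S i)) = y) /\ (acc x y <-> b).
Proof.
  intros h hQ. destruct stable_prefix as [T1 [hT1 hst]].
  destruct (@Inf_fin ({j | j < i0} * (Q * Q))%type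
    (fun t n => exists q, event n = Some (i0, proj1_sig (fst t)) /\
       nth_error (ghost n ++ [S n]) i0 = Some q /\
       nth 0 (entry q) q0 = fst (snd t) /\ nth (proj1_sig (fst t)) (entry q) q0 = snd (snd t) /\
       (acc (fst (snd t)) (snd (snd t)) <-> b))) as [[[j hj] [x y]] H].
  { repeat apply fin_prod; try assumption. apply fin_lt. }
  { eapply Inf_impl; [|exact h]. intros n [j [q [h1 [h2 h3]]]].
    destruct (event_dup h1) as [hj _].
    exists (exist _ j hj, (nth 0 (entry q) q0, nth j (entry q) q0)), q. simpl. auto. }
  simpl in H.
  assert (hb : acc x y <-> b). { destruct (H 0) as [n [_ [q hq]]]. apply hq. }
  destruct (nth_error (ghost T1) j) as [p|] eqn:Ep.
  2: { apply nth_error_None in Ep. destruct (hst T1 (le_n _)). lia. }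
  set (gq := fun q => T1 < q /\ val 0 q = x /\ val p q = y /\
     exists n, q <= S n /\ p <= S n /\ val p (S n) = val q (S n)).
  assert (hg : forall B, exists q, B <= q /\ gq q).
  (* Positions beyond [T1] are opened when the first [i0] slots are already fixed, so index [j] in
     their entries always refers to the same [p]. *)
  { intros B. destruct (unstable_large (B + S T1)) as [n0 [hn0 hB]].
    destruct (H (n0 + T1)) as [n [hn [q [h1 [h2 [h3 [h4 _]]]]]]].
    pose proof (hB n ltac:(lia) i0 q (le_n _) h2) as hq.
    exists q; split; [lia|].
    destruct (event_dup h1) as [_ [p' [q' [h5 [h6 h7]]]]].
    rewrite h2 in h5; inversion h5; subst q'; clear h5.
    rewrite (proj2 (hst n ltac:(lia)) j hj), Ep in h6. inversion h6; subst p'; clear h6.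
    assert (hq' : q <= S n).
    { apply nth_snoc in h2. destruct h2 as [[h2 _]|[_ ->]]; [apply ghost_le in h2; lia|lia]. }
    pose proof (ghost_le _ _ Ep) as hp.
    destruct q as [|m]; [lia|].
    assert (E : forall k r, nth_error (ghost m) k = Some r -> nth k (entry (S m)) q0 = val r (S m)).
    { intros k r hr. unfold entry. apply nth_error_nth. rewrite nth_error_map, hr. reflexivity. }
    split; [lia|split; [|split]].
    - rewrite <- h3. symmetry. apply E, ghost_head.
    - rewrite <- h4. symmetry. apply E. rewrite (proj2 (hst m ltac:(lia)) j hj). assumption.
    - exists n. repeat split; auto; lia. }
  (* The next position is taken after the time at which [q] has merged with [p], so [val q q']
     equals [val p q'], which is [y]. *)
  destruct (@choose nat nat (fun q q' => gq q -> gq q' /\ q < q' /\ val q q' = y)) as [f hf].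
  { intros q. destruct (classic (gq q)) as [h1|h1]; [|exists 0; tauto].
    pose proof h1 as [_ [_ [_ [n [h2 [h3 h4]]]]]].
    destruct (hg (S (S n))) as [q' [h5 h6]]. exists q'. intros _. split; [assumption|split; [lia|]].
    destruct h6 as [_ [_ [h6 _]]]. rewrite <- h6. symmetry.
    apply val_merge with (n := S n); auto; lia. }
  destruct (hg 1) as [q1 [h1 h2]].
  assert (hc : forall k, gq (Nat.iter k f q1)).
  { induction k as [|k IH]; [assumption|]. simpl. apply hf; assumption. }
  exists x, y, (fun i => match i with 0 => 0 | S k => Nat.iter k f q1 end).
  split; [split; [reflexivity|]|split; [|split; [|assumption]]].
  - intros [|k]; simpl; [destruct h2; lia|]. apply hf, hc.
  - simpl. apply h2.
  - intros [|k] hk; [lia|]. simpl. apply hf, hc.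
Qed.

End Stable.
End Determinisation.

Record dpa (X : Type) := {
  dst : Type;
  dst_fin : finite_type dst;
  dst0 : dst;
  dtr : dst -> X -> dst;
  dprio : dst -> nat }.

Fixpoint drunfrom (X : Type) (D : dpa X) (m : dst D) (w : nat -> X) (n : nat) : dst D :=
  match n with 0 => m | S n => dtr D (drunfrom D m w n) (w n) end.

(** From some time on the smallest priorities come from removals at the unstable index [i0]. A
    verdict that recurs there yields a factorisation of [w] of type x, y, y, and so on, and
    membership in [W] depends only on this type. So only the verdict that agrees with [W w] can
    recur. *)
Theorem determinise (X : Type) (W : (nat -> X) -> Prop) : oreg W ->
  exists D : dpa X, forall w,
    W w <-> Par true (fun n => dprio D (drunfrom D (dst0 D) w n)).
Proof.
  intros [Q [q0 [step [hQ hW]]]].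
  assert (HN : exists N, forall l : list Q, NoDup l -> length l <= N).
  { destruct hQ as [l hl]. exists (length l). intros l' h'. apply NoDup_incl_length; [assumption|].
    intros q _; apply hl. }
  destruct HN as [N hN]. destruct (first_dup_exists Q) as [fd hfd].
  (* One accepted word of this type suffices: by the hypothesis on [W] all words of the same type
     are then accepted. *)
  set (acc := fun x y => exists w c, cut c /\ fold_left step (slice w (c 0) (c 1)) q0 = x /\
     (forall i, 1 <= i -> fold_left step (slice w (c i) (c (S i))) q0 = y) /\ W w).
  set (dst' := {m : dstate Q | dbounded N m}).
  set (D := {| dst := dst'; dst_fin := fin_dbounded N hQ;
     dst0 := exist (@dbounded Q N) _ (dbounded_init q0 step hN acc) : dst';
     dtr := fun (m : dst') x =>
        exist (@dbounded Q N) _ (dbounded_step q0 step hN fd acc hfd x (proj2_sig m)) : dst';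
     dprio := fun m : dst' => snd (proj1_sig m) |}).
  exists D. intros w.
  (* Shifted by one, since the priority of the initial state does not come from an event. *)
  set (p := fun n => snd (drun q0 step N fd acc w (S n))).
  assert (hp : forall n, dprio D (drunfrom D (dst0 D) w (1 + n)) = p n).
  { assert (h : forall n, proj1_sig (drunfrom D (dst0 D) w n) = drun q0 step N fd acc w n).
    { induction n as [|n IH]; [reflexivity|]. rewrite drun_S, <- IH. reflexivity. }
    intros n. unfold p. rewrite <- h. reflexivity. }
  assert (hPar : forall b, Par b p -> Par b (fun n => dprio D (drunfrom D (dst0 D) w n))).
  { intros b h. apply (Par_shift b _ 1). revert h. apply Par_ext. intros n; symmetry; apply hp. }
  destruct (unstable_slot q0 step hN fd acc hfd w) as [i0 [hInf [T hT]]].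
  assert (hpe : forall n i j, event q0 step fd w n = Some (i, j) ->
     exists q, nth_error (ghost q0 step fd w n ++ [S n]) i = Some q /\
       p n = verdict q0 acc i j (entry q0 step fd w q)).
  { intros n i j e. destruct (event_dup q0 step fd hfd w n e) as [_ [_ [q [h _]]]].
    exists q; split; [assumption|]. unfold p. rewrite (drun_prio q0 step N fd acc hfd), e.
    rewrite (nth_error_nth _ _ 0 h). reflexivity. }
  assert (hge : forall n, T <= n -> 2 * i0 <= p n).
  { intros n hn. destruct (event q0 step fd w n) as [[i j]|] eqn:e.
    - destruct (hpe n i j e) as [q [_ ->]]. pose proof (hT n hn i j e).
      unfold verdict. destruct (excluded_middle_informative _); lia.
    - unfold p. rewrite (drun_prio q0 step N fd acc hfd), e.
      destruct (hInf 0) as [m [_ [j hj]]]. apply (event_lt q0 step fd hfd w) in hj.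
      rewrite length_app in hj. pose proof (ghost_length q0 step hN fd acc hfd w m).
      simpl in hj. lia. }
  assert (hfac : forall b : Prop, Inf (fun n => exists j q, event q0 step fd w n = Some (i0, j) /\
        nth_error (ghost q0 step fd w n ++ [S n]) i0 = Some q /\
        (acc (nth 0 (entry q0 step fd w q) q0) (nth j (entry q0 step fd w q) q0) <-> b)) ->
      (W w <-> b)).
  { intros b h. destruct (verdict_factor q0 step fd acc hfd w hInf hT h hQ)
      as [x [y [c [hc [h1 [h2 h3]]]]]].
    rewrite <- h3. split; intros h4.
    - exists w, c; auto.
    - destruct h4 as [w' [c' [hc' [h5 [h6 h7]]]]]. refine (hW w' w c' c hc' hc _ h7).
      intros [|i]; unfold val in *; [congruence|]. rewrite h6, h2 by lia. reflexivity. }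
  assert (hT1 : Inf (fun n => p n = 2 * i0) -> W w).
  { intros h. apply (hfac True); [|trivial]. intros n.
    destruct (h (n + T)) as [m [hm e]]. exists m; split; [lia|].
    destruct (event q0 step fd w m) as [[i j]|] eqn:E.
    - destruct (hpe m i j E) as [q [h1 h2]]. rewrite e in h2. unfold verdict in h2.
      pose proof (hT m ltac:(lia) i j E).
      destruct (excluded_middle_informative _) as [ha|ha]; [|lia].
      assert (i = i0) by lia; subst. exists j, q; tauto.
    - unfold p in e. rewrite (drun_prio q0 step N fd acc hfd), E in e.
      destruct (hInf 0) as [m' [_ [j hj]]]. apply (event_lt q0 step fd hfd w) in hj.
      rewrite length_app in hj. pose proof (ghost_length q0 step hN fd acc hfd w m').
      simpl in hj. lia. }
  assert (hT2 : Inf (fun n => p n = 2 * i0 + 1) -> ~ W w).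
  { intros h. rewrite (hfac False); [tauto|]. intros n.
    destruct (h (n + T)) as [m [hm e]]. exists m; split; [lia|].
    destruct (event q0 step fd w m) as [[i j]|] eqn:E.
    - destruct (hpe m i j E) as [q [h1 h2]]. rewrite e in h2. unfold verdict in h2.
      pose proof (hT m ltac:(lia) i j E).
      destruct (excluded_middle_informative _) as [ha|ha]; [lia|].
      assert (i = i0) by lia; subst. exists j, q; tauto.
    - unfold p in e. rewrite (drun_prio q0 step N fd acc hfd), E in e.
      destruct (hInf 0) as [m' [_ [j hj]]]. apply (event_lt q0 step fd hfd w) in hj.
      rewrite length_app in hj. pose proof (ghost_length q0 step hN fd acc hfd w m').
      simpl in hj. lia. }
  assert (hor : Inf (fun n => p n = 2 * i0) \/ Inf (fun n => p n = 2 * i0 + 1)).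
  { apply Inf_or. eapply Inf_impl; [|exact hInf]. intros n [j e].
    destruct (hpe n i0 j e) as [q [_ ->]]. unfold verdict.
    destruct (excluded_middle_informative _); auto. }
  assert (e0 : Nat.even (2 * i0) = true).
  { rewrite Nat.even_mul. reflexivity. }
  assert (e1 : Nat.even (2 * i0 + 1) = false).
  { rewrite Nat.even_add, e0. reflexivity. }
  assert (H1 : W w -> Par true p).
  { intros h. exists (2 * i0); split; [split|assumption].
    - destruct hor; [assumption|]. exfalso; exact (hT2 H h).
    - exists T; assumption. }
  assert (H2 : ~ W w -> Par false p).
  { intros h. exists (2 * i0 + 1); split; [split|assumption].
    - destruct hor; [|assumption]. exfalso; exact (h (hT1 H)).
    - destruct (@not_Inf (fun n => p n = 2 * i0)) as [T' hT']; [tauto|].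
      exists (T + T'). intros n hn. specialize (hge n ltac:(lia)). specialize (hT' n ltac:(lia)).
      lia. }
  split; [intros h; apply hPar, H1, h|].
  intros h. apply NNPP; intros h'. exact (Par_excl h (hPar _ (H2 h'))).
Qed.

(** * Positional determinacy of parity games *)

(* A game is given by the family of sets into which player 1 can force the next position:
   [F p U] says that from p player 1 can force the play into U. *)
Definition dual (P : Type) (F : P -> (P -> Prop) -> Prop) : P -> (P -> Prop) -> Prop :=
  fun p U => ~ F p (fun q => ~ U q).

Definition mono (P : Type) (F : P -> (P -> Prop) -> Prop) : Prop :=
  forall p (U U' : P -> Prop), (forall q, U q -> U' q) -> F p U -> F p U'.

(** A positional strategy is a relation: at [p] the player forces the play into [U p]. Only infinite
    plays are judged; where [F p] holds of the empty set the player wins by leaving no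
    continuation. *)
Record strat_win (P : Type) (F : P -> (P -> Prop) -> Prop) (b : bool) (pr : P -> nat)
  (Wr : P -> Prop) (U : P -> P -> Prop) : Prop := {
  sw_move : forall p, Wr p -> F p (U p);
  sw_closed : forall p q, Wr p -> U p q -> Wr q;
  sw_par : forall s, Wr (s 0) -> (forall n, U (s n) (s (S n))) -> Par b (fun n => pr (s n)) }.

Definition Win (P : Type) (F : P -> (P -> Prop) -> Prop) b pr (p : P) : Prop :=
  exists Wr U, strat_win F b pr Wr U /\ Wr p.

Lemma dual_dual (P : Type) (F : P -> (P -> Prop) -> Prop) : dual (dual F) = F.
Proof.
  apply functional_extensionality; intros p. apply pred_ext; intros U. unfold dual.
  replace (fun q => ~ ~ U q) with U.
  - split; [apply NNPP|tauto].
  - apply pred_ext; intros q; split; [tauto|apply NNPP].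
Qed.

Lemma mono_dual (P : Type) (F : P -> (P -> Prop) -> Prop) : mono F -> mono (dual F).
Proof.
  intros h p U U' hU hd hF. apply hd. eapply h; [|exact hF]. simpl. intros q hq hu; auto.
Qed.

Section Play.
Variables (P : Type) (F : P -> (P -> Prop) -> Prop) (b : bool) (pr : P -> nat).

Lemma sw_par_from Wr U s m : strat_win F b pr Wr U -> Wr (s m) ->
  (forall n, m <= n -> U (s n) (s (S n))) -> Par b (fun n => pr (s n)).
Proof.
  intros h hm hs. apply (Par_shift b _ m).
  apply (sw_par h (fun n => s (m + n))); [rewrite Nat.add_0_r; assumption|].
  intros n. rewrite Nat.add_succ_r. apply hs. lia.
Qed.

Lemma nonincreasing_stable (f : nat -> nat) : (forall n, f (S n) <= f n) ->
  exists N, forall n, N <= n -> f n = f N.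
Proof.
  intros h.
  assert (hm : forall m n, m <= n -> f n <= f m).
  { induction 1 as [|n hn IH]; [lia|]. specialize (h n); lia. }
  destruct (@least (fun k => exists n, f n = k)) as [k [[N hN] hk]];
    [exists (f 0), 0; reflexivity|].
  exists N. intros n hn. specialize (hk (f n) (ex_intro _ n eq_refl)). specialize (hm N n hn). lia.
Qed.

(* At each position follow the first strategy, in a fixed enumeration, that wins from
   there; its number can only drop along a play. *)
Lemma win_uniform (code : P -> nat) : (forall p q, code p = code q -> p = q) ->
  exists U, strat_win F b pr (Win F b pr) U.
Proof.
  intros hc.
  destruct (@choose P ((P -> Prop) * (P -> P -> Prop)) (fun p X => Win F b pr p ->
     strat_win F b pr (fst X) (snd X) /\ fst X p)) as [f hf].
  { intros p. destruct (classic (Win F b pr p)) as [[Wr [U h]]|h].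
    - exists (Wr, U); auto.
    - exists (fun _ => True, fun _ _ => True); tauto. }
  destruct (@choose P P (fun q p => Win F b pr q -> Win F b pr p /\ fst (f p) q /\
     forall p', Win F b pr p' -> fst (f p') q -> code p <= code p')) as [g hg].
  { intros q. destruct (classic (Win F b pr q)) as [h|h]; [|exists q; tauto].
    destruct (@least (fun k => exists p, code p = k /\ Win F b pr p /\ fst (f p) q))
      as [k [[p [h1 h2]] h3]].
    { exists (code q), q. split; [reflexivity|]. split; [assumption|]. apply hf, h. }
    exists p. intros _. split; [apply h2|]. split; [apply h2|].
    intros p' h4 h5. rewrite h1. apply h3. eauto. }
  exists (fun q => snd (f (g q)) q). constructor.
  - intros p hp. destruct (hg p hp) as [h1 [h2 _]]. apply (sw_move (proj1 (hf _ h1))), h2.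
  - intros p q hp hq. destruct (hg p hp) as [h1 [h2 _]].
    exists (fst (f (g p))), (snd (f (g p))). split; [apply hf, h1|].
    eapply (sw_closed (proj1 (hf _ h1))); eassumption.
  - intros s h0 hs.
    assert (hW : forall n, Win F b pr (s n)).
    { induction n as [|n IH]; [assumption|]. destruct (hg _ IH) as [h1 [h2 _]].
      exists (fst (f (g (s n)))), (snd (f (g (s n)))). split; [apply hf, h1|].
      eapply (sw_closed (proj1 (hf _ h1))); [exact h2|apply hs]. }
    destruct (@nonincreasing_stable (fun n => code (g (s n)))) as [N hN].
    { intros n. destruct (hg _ (hW n)) as [h1 [h2 _]].
      apply (hg (s (S n)) (hW (S n))); [assumption|].
      eapply (sw_closed (proj1 (hf _ h1))); [exact h2|apply hs]. }
    destruct (hg _ (hW N)) as [h1 [h2 _]].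
    eapply sw_par_from; [apply hf, h1|exact h2|].
    intros n hn. specialize (hs n). cbv beta in hs. rewrite (hc _ _ (hN n hn)) in hs. assumption.
Qed.

End Play.

Section Determinacy.
Variables (P : Type) (code : P -> nat) (pr : P -> nat).
Hypothesis hcode : forall p q, code p = code q -> p = q.

(** The game is decided at [p], won or lost whatever the target. The induction on priorities decides
    the positions of low priority in this way. *)
Definition terminal (F : P -> (P -> Prop) -> Prop) (p : P) : Prop :=
  (forall U, F p U) \/ (forall U, ~ F p U).

Lemma terminal_dual F p : terminal F p -> terminal (dual F) p.
Proof. intros [h|h]; [right|left]; intros U; unfold dual; auto. Qed.

(** The first move goes into the winning region, after which the uniform strategy takes over. *)
Lemma win_step (F : P -> (P -> Prop) -> Prop) b p : F p (Win F b pr) -> Win F b pr p.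
Proof.
  intros hp. destruct (win_uniform F b pr code hcode) as [U hU].
  exists (fun q => Win F b pr q \/ q = p),
    (fun q => if excluded_middle_informative (Win F b pr q) then U q else Win F b pr).
  split; [constructor|right; reflexivity].
  - intros q [hq| ->]; destruct (excluded_middle_informative _); try tauto; apply (sw_move hU);
      assumption.
  - intros q r hq hr. left. destruct (excluded_middle_informative _); [|assumption].
    eapply (sw_closed hU); eassumption.
  - intros s h0 hs.
    assert (h1 : Win F b pr (s 1)).
    { specialize (hs 0). cbv beta in hs. destruct (excluded_middle_informative _); [|assumption].
      eapply (sw_closed hU); eassumption. }
    assert (h : forall n, 1 <= n -> Win F b pr (s n) /\ U (s n) (s (S n))).
    { induction 1 as [|n hn [IH1 IH2]].
      - split; [assumption|]. specialize (hs 1). cbv beta in hs.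
        destruct (excluded_middle_informative _); tauto.
      - assert (h2 : Win F b pr (s (S n))) by (eapply (sw_closed hU); eassumption).
        split; [assumption|]. specialize (hs (S n)). cbv beta in hs.
        destruct (excluded_middle_informative _); tauto. }
    eapply sw_par_from; [exact hU|exact h1|]. apply h.
Qed.

(* The priority d is the least one and good for player 1.  Let A be the region of player 2.
   Outside A, make the positions of priority d wins for player 1: by induction this game is
   determined, and player 2 cannot win it anywhere outside A.  Player 1 combines his
   strategy there with moves that avoid A. *)
Lemma determinacy_step F b d : mono F -> (forall p, pr p < d -> terminal F p) ->
  Nat.even d = b ->
  (forall F', mono F' -> (forall p, pr p < S d -> terminal F' p) ->
     forall p, Win F' b pr p \/ Win (dual F') (negb b) pr p) ->
  forall p, Win F b pr p \/ Win (dual F) (negb b) pr p.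
Proof.
  intros hm hterm hd IH.
  set (A := Win (dual F) (negb b) pr).
  destruct (win_uniform (dual F) (negb b) pr code hcode) as [UA hA]. fold A in hA.
  set (F' := fun p U => ~ A p /\ (pr p = d \/ F p U)).
  assert (hm' : mono F').
  { intros p U U' hU [h1 [h2|h2]]; split; auto. right; eapply hm; eassumption. }
  assert (hterm' : forall p, pr p < S d -> terminal F' p).
  { intros p hp. unfold terminal, F'. destruct (classic (A p)) as [h|h]; [right; tauto|].
    destruct (Nat.eq_dec (pr p) d) as [h'|h']; [left; auto|].
    destruct (hterm p ltac:(lia)) as [h1|h1]; [left; auto|right].
    intros U [_ [h2|h2]]; [lia|exact (h1 U h2)]. }
  (* A strategy of player 2 for the modified game is a real one: it is followed until the play
     enters [A], and from there on [UA] is used. *)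
  assert (hA' : forall p, Win (dual F') (negb b) pr p -> A p).
  { intros p [Wr [U [hU hp]]].
    exists (fun q => A q \/ Wr q),
      (fun q => if excluded_middle_informative (A q) then UA q else U q).
    split; [constructor|auto].
    - intros q hq. destruct (excluded_middle_informative (A q)) as [h|h].
      + apply (sw_move hA); assumption.
      + destruct hq as [hq|hq]; [tauto|]. pose proof (sw_move hU q hq) as h1.
        intros h2. apply h1. split; [assumption|right; assumption].
    - intros q r hq hr. destruct (excluded_middle_informative (A q)) as [h|h].
      + left; eapply (sw_closed hA); eassumption.
      + right. destruct hq as [hq|hq]; [tauto|]. eapply (sw_closed hU); eassumption.
    - intros s h0 hs. destruct (classic (exists n, A (s n))) as [[n hn]|hn].
      + assert (H : forall k, n <= k -> A (s k) /\ UA (s k) (s (S k))).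
        { induction 1 as [|k hk [IH1 IH2]].
          - split; [assumption|]. specialize (hs n). cbv beta in hs.
            destruct (excluded_middle_informative _); tauto.
          - assert (h2 : A (s (S k))) by (eapply (sw_closed hA); eassumption).
            split; [assumption|]. specialize (hs (S k)). cbv beta in hs.
            destruct (excluded_middle_informative _); tauto. }
        eapply sw_par_from; [exact hA|exact hn|apply H].
      + apply (sw_par hU).
        * destruct h0; [|assumption]. exfalso; eauto.
        * intros n. specialize (hs n). cbv beta in hs.
          destruct (excluded_middle_informative _); [exfalso; eauto|assumption]. }
  intros p. destruct (classic (A p)) as [hp|hp]; [right; exact hp|left].
  destruct (win_uniform F' b pr code hcode) as [U hU].
  assert (hW : forall q, Win F' b pr q <-> ~ A q).
  { intros q; split.
    - intros h. pose proof (sw_move hU q h) as [h' _]. assumption.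
    - intros h. destruct (IH F' hm' hterm' q) as [h'|h']; [assumption|].
      exfalso; apply h, hA', h'. }
  exists (fun q => ~ A q), (fun q r => (pr q = d /\ ~ A r) \/ (d < pr q /\ U q r)).
  split; [constructor|assumption].
  - intros q hq. destruct (Nat.lt_trichotomy (pr q) d) as [h|[h|h]].
    + pose proof (sw_move hU q (proj2 (hW q) hq)) as [_ [h'|h']]; [lia|].
      destruct (hterm q h) as [h1|h1]; [apply h1|destruct (h1 _ h')].
    (* At priority [d] some move avoids [A]: otherwise player 2 could force the play into [A], and
       [q] itself would belong to [A]. *)
    + apply NNPP; intros hn. apply hq. apply win_step.
      intros hF. apply hn. eapply hm; [|exact hF]. intros r hr. left; split; assumption.
    + pose proof (sw_move hU q (proj2 (hW q) hq)) as [_ [h'|h']]; [lia|].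
      eapply hm; [|exact h']. auto.
  - intros q r hq [[_ h]|[_ h]]; [assumption|].
    apply hW. eapply (sw_closed hU); [apply hW; exact hq|exact h].
  - intros s h0 hs.
    assert (hstay : forall n, ~ A (s n)).
    { induction n as [|n IHn]; [assumption|]. destruct (hs n) as [[_ h]|[_ h]]; [assumption|].
      apply hW. eapply (sw_closed hU); [apply hW; exact IHn|exact h]. }
    (* The strategy relation is empty at priorities below [d]. So either [d] recurs and is the least
       priority, or eventually the play follows [U] alone. *)
    destruct (classic (Inf (fun n => pr (s n) = d))) as [hi|hi].
    + exists d; split; [split; [assumption|]|assumption].
      exists 0. intros n _. destruct (hs n) as [[h _]|[h _]]; lia.
    + apply not_Inf in hi. destruct hi as [N hN].
      eapply sw_par_from with (m := N); [exact hU|apply hW, hstay|].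
      intros n hn. destruct (hs n) as [[h _]|[_ h]]; [exfalso; eapply hN; eassumption|assumption].
Qed.

(** Downward induction on [d], where all positions of priority below [d] are terminal: at [d = B]
    every position is decided. If the parity of [d] suits the other player, the step is applied to
    the dual game. *)
Theorem determinacy (B : nat) (hB : forall p, pr p < B) F b : mono F ->
  forall p, Win F b pr p \/ Win (dual F) (negb b) pr p.
Proof.
  enough (H : forall k d, d + k = B -> forall F b, mono F ->
     (forall p, pr p < d -> terminal F p) ->
     forall p, Win F b pr p \/ Win (dual F) (negb b) pr p).
  { intros hm. apply (H B 0 eq_refl F b hm). intros; lia. }
  clear F b. induction k as [|k IH]; intros d hd F b hm ht.
  - intros p.
    assert (E : forall F b p, mono F -> (forall U, F p U) -> Win F b pr p).
    { clear. intros F b p hm h.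
      exists (fun q => F q (fun _ => False)), (fun _ _ => False). split; [constructor|apply h].
      - auto.
      - intros q r _ [].
      - intros s _ hs. destruct (hs 0). }
    destruct (ht p) as [h|h]; [specialize (hB p); lia| |].
    + left; auto.
    + right. apply E; [apply mono_dual, hm|]. intros U; apply h.
  - assert (IH' : forall F' b, mono F' -> (forall p, pr p < S d -> terminal F' p) ->
       forall p, Win F' b pr p \/ Win (dual F') (negb b) pr p).
    { intros F' b'. apply IH. lia. }
    destruct (Bool.bool_dec (Nat.even d) b) as [e|e].
    + apply determinacy_step with (d := d); auto.
    + intros p. destruct (@determinacy_step (dual F) (negb b) d) with (p := p) as [h|h].
      * apply mono_dual, hm.
      * intros q hq; apply terminal_dual, ht, hq.
      * destruct (Nat.even d), b; simpl; congruence.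
      * intros F'; apply IH'.
      * right; assumption.
      * left. rewrite dual_dual, Bool.negb_involutive in h. assumption.
Qed.

End Determinacy.

(** Allows a strategy to be checked on plays from [p] only. The winning region consists of the
    positions reachable with [U], and a play from such a position becomes a play from [p] when its
    history is put in front. *)
Lemma win_reach (P : Type) (F : P -> (P -> Prop) -> Prop) b pr (U : P -> P -> Prop) p :
  (forall q, F q (U q)) ->
  (forall s, s 0 = p -> (forall n, U (s n) (s (S n))) -> Par b (fun n => pr (s n))) ->
  Win F b pr p.
Proof.
  intros hF hp.
  exists (fun q => exists s m, s 0 = p /\ s m = q /\ forall n, n < m -> U (s n) (s (S n))), U.
  split; [constructor|exists (fun _ => p), 0; repeat split; intros; lia].
  - auto.
  - intros q r [s [m [h0 [h1 h2]]]] hr.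
    exists (fun n => if n <=? m then s n else r), (S m).
    split; [assumption|]. split.
    + destruct (S m <=? m) eqn:E; [apply Nat.leb_le in E; lia|reflexivity].
    + intros n hn. destruct (Nat.leb_spec n m), (Nat.leb_spec (S n) m); try lia.
      * apply h2; lia.
      * replace n with m by lia. rewrite h1. assumption.
  - intros s' [s [m [h0 [h1 h2]]]] hs.
    set (t := fun n => if n <=? m then s n else s' (n - m)).
    assert (ht : Par b (fun n => pr (t n))).
    { apply hp; unfold t; [assumption|].
      intros n. destruct (Nat.leb_spec n m), (Nat.leb_spec (S n) m); try lia.
      - apply h2; lia.
      - replace (S n - m) with 1 by lia. replace n with m by lia. rewrite h1. apply hs.
      - replace (S n - m) with (S (n - m)) by lia. apply hs. }
    apply (Par_shift b _ m) in ht. revert ht. apply Par_ext. intros n. f_equal. unfold t.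
    destruct (Nat.leb_spec (m + n) m).
    + replace n with 0 by lia. rewrite Nat.add_0_r. assumption.
    + f_equal; lia.
Qed.

(** * Recognisable sets of trees *)

(** Injections into the natural numbers supply the enumeration of positions needed by
    [win_uniform]. *)
Lemma fin_code (A : Type) : finite_type A ->
  exists code : A -> nat, forall a b, code a = code b -> a = b.
Proof.
  intros [l hl].
  destruct (@choose A nat (fun a n => nth_error l n = Some a)) as [f hf].
  { intros a. apply In_nth_error, hl. }
  exists f. intros a b e. pose proof (hf a) as ha. rewrite e, hf in ha. congruence.
Qed.

Lemma prod_code (A B : Type) (ca : A -> nat) (cb : B -> nat) :
  (forall a b, ca a = ca b -> a = b) -> (forall a b, cb a = cb b -> a = b) ->
  exists code : A * B -> nat, forall a b, code a = code b -> a = b.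
Proof.
  intros ha hb. exists (fun p => Cantor.to_nat (ca (fst p), cb (snd p))).
  intros [a b] [a' b'] e. apply Cantor.to_nat_inj in e. simpl in e. inversion e.
  f_equal; auto.
Qed.

Lemma list_code (A : Type) (ca : A -> nat) : (forall a b, ca a = ca b -> a = b) ->
  exists code : list A -> nat, forall a b, code a = code b -> a = b.
Proof.
  intros ha.
  set (f := fix f l := match l with [] => 0 | a :: l => S (Cantor.to_nat (ca a, f l)) end).
  exists f. induction a as [|a l IH]; intros [|a' l'] e; try discriminate; [reflexivity|].
  change (S (Cantor.to_nat (ca a, f l)) = S (Cantor.to_nat (ca a', f l'))) in e.
  apply Nat.succ_inj, Cantor.to_nat_inj in e. inversion e. f_equal; auto.
Qed.

Definition pre (A : Type) (d : nat -> A) (n : nat) : list A := slice d 0 n.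

Lemma pre_S (A : Type) (d : nat -> A) n : pre d (S n) = pre d n ++ [d n].
Proof. apply slice_S; lia. Qed.

Lemma drunfrom_unique (X : Type) (D : dpa X) w (m : nat -> dst D) : m 0 = dst0 D ->
  (forall n, m (S n) = dtr D (m n) (w n)) -> forall n, m n = drunfrom D (dst0 D) w n.
Proof. intros h0 h n. induction n as [|n IH]; simpl; [assumption|]. rewrite h, IH; reflexivity. Qed.

Lemma dpa_bound (X : Type) (D : dpa X) : exists B, forall m, dprio D m < B.
Proof. apply fin_bound, dst_fin. Qed.

(** * Games in which labels are proposed along a branch *)

Section Arena.
Variables (Dir Sig Gam Z : Type) (D : dpa (Sig * Gam * Dir))
  (st : Z -> Dir -> Z) (lab : Z -> Sig).

Definition gnext (p : Z * dst D) (g : Gam) (d : Dir) : Z * dst D :=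
  (st (fst p) d, dtr D (snd p) (lab (fst p), g, d)).

(** Player 1 proposes a label, player 2 answers with a direction, so that an infinite play selects a
    branch. The tree is the unfolding of [st] and [lab]. *)
Definition arena (p : Z * dst D) (U : Z * dst D -> Prop) : Prop :=
  exists g, forall d, U (gnext p g d).

Definition gprio (p : Z * dst D) : nat := dprio D (snd p).

Lemma mono_arena : mono arena.
Proof. intros p U U' hU [g hg]; exists g; auto. Qed.

Lemma arena_determined (code : Z -> nat) : (forall a b, code a = code b -> a = b) ->
  forall p, Win arena true gprio p \/ Win (dual arena) false gprio p.
Proof.
  intros hcode. destruct (fin_code (dst_fin D)) as [cm hcm].
  destruct (prod_code _ _ hcode hcm) as [cp hcp]. destruct (dpa_bound D) as [B hB].
  exact (@determinacy _ cp gprio hcp B (fun p => hB (snd p)) arena true mono_arena).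
Qed.

Lemma arena_dual p U : dual arena p U <-> forall g, exists d, U (gnext p g d).
Proof.
  unfold dual, arena. split.
  - intros h g. apply NNPP; intros hn. apply h. exists g. intros d hd; apply hn; eauto.
  - intros h [g hg]. destruct (h g) as [d hd]. exact (hg d hd).
Qed.

(* By determinacy, labels that depend on the address can be replaced by labels that depend
   only on the state z and on the state of the automaton. *)
Theorem arena_spec (W : (nat -> Sig * Gam * Dir) -> Prop) (code : Z -> nat) (z0 : Z) :
  (forall w, W w <-> Par true (fun n => dprio D (drunfrom D (dst0 D) w n))) ->
  (forall a b, code a = code b -> a = b) ->
  ((exists l : list Dir -> Gam, forall d,
      W (fun n => (lab (fold_left st (pre d n) z0), l (pre d n), d n))) <->
   Win arena true gprio (z0, dst0 D)).
Proof.
  intros hW hcode. split.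
  - intros [l hl].
    destruct (arena_determined code hcode (z0, dst0 D)) as [h|[Wr [U [hU h0]]]]; [assumption|exfalso].
    assert (hd0 : exists d0 : Dir, True).
    { pose proof (sw_move hU _ h0) as h. rewrite arena_dual in h.
      destruct (h (l [])) as [d _]. exists d; trivial. }
    destruct hd0 as [d0 _].
    destruct (@choose (Z * dst D * Gam) Dir (fun x d => Wr (fst x) ->
       U (fst x) (gnext (fst x) (snd x) d))) as [adv hadv].
    { intros [p g]. simpl. destruct (classic (Wr p)) as [hp|hp]; [|exists d0; tauto].
      pose proof (sw_move hU _ hp) as h. rewrite arena_dual in h.
      destruct (h g) as [d hd]. exists d; auto. }
    set (x := fun n => Nat.iter n (fun x : list Dir * (Z * dst D) =>
       let d := adv (snd x, l (fst x)) in (fst x ++ [d], gnext (snd x) (l (fst x)) d))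
       ([], (z0, dst0 D))).
    set (d := fun n => adv (snd (x n), l (fst (x n)))).
    assert (hv : forall n, fst (x n) = pre d n).
    { induction n as [|n IH]; [reflexivity|]. rewrite pre_S, <- IH. reflexivity. }
    assert (hz : forall n, fst (snd (x n)) = fold_left st (pre d n) z0).
    { induction n as [|n IH]; [reflexivity|]. rewrite pre_S, fold_left_app, <- IH. reflexivity. }
    assert (hWr : forall n, Wr (snd (x n))).
    { induction n as [|n IH]; [assumption|]. eapply (sw_closed hU); [exact IH|].
      exact (hadv (snd (x n), l (fst (x n))) IH). }
    specialize (hl d). rewrite hW in hl. apply (Par_excl hl).
    assert (hp := sw_par hU (fun n => snd (x n)) h0).
    revert hp. intros hp. eapply Par_ext; [|apply hp].
    + intros n. unfold gprio. f_equal.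
      apply (@drunfrom_unique _ D _ (fun n => snd (snd (x n)))); [reflexivity|].
      intros k. rewrite <- hz, <- hv. reflexivity.
    + intros n. exact (hadv (snd (x n), l (fst (x n))) (hWr n)).
  - intros [Wr [U [hU h0]]].
    destruct (sw_move hU _ h0) as [g0 _].
    destruct (@choose (Z * dst D) Gam (fun p g => Wr p -> forall d, U p (gnext p g d))) as [g hg].
    { intros p. destruct (classic (Wr p)) as [hp|hp]; [|exists g0; tauto].
      destruct (sw_move hU _ hp) as [g hg]. exists g; auto. }
    set (pos := fun v => fold_left (fun p d => gnext p (g p) d) v (z0, dst0 D)).
    exists (fun v => g (pos v)). intros d. rewrite hW.
    assert (hS : forall n, pos (pre d (S n)) = gnext (pos (pre d n)) (g (pos (pre d n))) (d n)).
    { intros n. unfold pos. rewrite pre_S, fold_left_app. reflexivity. }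
    assert (hz : forall n, fst (pos (pre d n)) = fold_left st (pre d n) z0).
    { induction n as [|n IH]; [reflexivity|]. rewrite hS, (pre_S d n), fold_left_app, <- IH.
      reflexivity. }
    assert (hWr : forall n, Wr (pos (pre d n))).
    { induction n as [|n IH]; [assumption|]. rewrite hS. eapply (sw_closed hU); [exact IH|].
      apply hg; assumption. }
    eapply Par_ext; [|apply (sw_par hU (fun n => pos (pre d n)))].
    + intros n. unfold gprio. f_equal.
      apply (@drunfrom_unique _ D _ (fun n => snd (pos (pre d n)))); [reflexivity|].
      intros k. rewrite hS, <- hz. reflexivity.
    + assumption.
    + intros n. rewrite hS. apply hg, hWr.
Qed.

End Arena.

(** A nondeterministic tree automaton in disguise: [l] is a run, written as the transition chosen at
    each vertex, and [W] checks consistency and acceptance on every branch. *)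
Definition rec (Dir Sig : Type) (K : (list Dir -> Sig) -> Prop) : Prop :=
  exists (Gam : Type) (W : (nat -> Sig * Gam * Dir) -> Prop), finite_type Gam /\ oreg W /\
    forall t, K t <-> exists l : list Dir -> Gam, forall d,
      W (fun n => (t (pre d n), l (pre d n), d n)).

Section Recognisable.
Variables (Dir : Type) (hDir : finite_type Dir).

Lemma rec_ext (Sig : Type) (K K' : (list Dir -> Sig) -> Prop) :
  (forall t, K t <-> K' t) -> rec K -> rec K'.
Proof.
  intros h [Gam [W [hG [hW H]]]]. exists Gam, W; split; [|split]; try assumption.
  intros t. rewrite <- h. apply H.
Qed.

Lemma rec_paths (Sig : Type) (W : (nat -> Sig * Dir) -> Prop) : oreg W ->
  rec (fun t => forall d, W (fun n => (t (pre d n), d n))).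
Proof.
  intros hW. exists unit, (fun w => W (fun n => (fst (fst (w n)), snd (w n)))).
  split; [apply fin_unit|split].
  - apply (oreg_pre (fun x : Sig * unit * Dir => (fst (fst x), snd x)) hW).
  - intros t; split; [intros h; exists (fun _ => tt); exact h|intros [l h]; exact h].
Qed.

Lemma rec_pre (Sig Sig' : Type) (f : Sig' -> Sig) (K : (list Dir -> Sig) -> Prop) :
  rec K -> rec (fun t => K (fun v => f (t v))).
Proof.
  intros [Gam [W [hG [hW H]]]].
  exists Gam, (fun w => W (fun n => (f (fst (fst (w n))), snd (fst (w n)), snd (w n)))).
  split; [assumption|split].
  - apply (oreg_pre (fun x : Sig' * Gam * Dir => (f (fst (fst x)), snd (fst x), snd x)) hW).
  - intros t. apply H.
Qed.

Lemma rec_and (Sig : Type) (K K' : (list Dir -> Sig) -> Prop) :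
  rec K -> rec K' -> rec (fun t => K t /\ K' t).
Proof.
  intros [G [W [hG [hW H]]]] [G' [W' [hG' [hW' H']]]].
  exists (G * G')%type, (fun w =>
     W (fun n => (fst (fst (w n)), fst (snd (fst (w n))), snd (w n))) /\
     W' (fun n => (fst (fst (w n)), snd (snd (fst (w n))), snd (w n)))).
  split; [apply fin_prod; assumption|split].
  - apply oreg_and.
    + apply (oreg_pre (fun x : Sig * (G * G') * Dir => (fst (fst x), fst (snd (fst x)), snd x)) hW).
    + apply (oreg_pre (fun x : Sig * (G * G') * Dir => (fst (fst x), snd (snd (fst x)), snd x)) hW').
  - intros t. rewrite H, H'. split.
    + intros [[l hl] [l' hl']]. exists (fun v => (l v, l' v)). intros d. split; [apply hl|apply hl'].
    + intros [l hl]. split; [exists (fun v => fst (l v))|exists (fun v => snd (l v))];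
        intros d; apply (hl d).
Qed.

Lemma rec_proj (Sig Y : Type) (K : (list Dir -> Sig * Y) -> Prop) : finite_type Y ->
  rec K -> rec (fun t => exists y, K (fun v => (t v, y v))).
Proof.
  intros hY [G [W [hG [hW H]]]].
  exists (Y * G)%type, (fun w =>
     W (fun n => ((fst (fst (w n)), fst (snd (fst (w n)))), snd (snd (fst (w n))), snd (w n)))).
  split; [apply fin_prod; assumption|split].
  - apply (oreg_pre (fun x : Sig * (Y * G) * Dir =>
      ((fst (fst x), fst (snd (fst x))), snd (snd (fst x)), snd x)) hW).
  - intros t. split.
    + intros [y hy]. apply H in hy. destruct hy as [l hl].
      exists (fun v => (y v, l v)). exact hl.
    + intros [l hl]. exists (fun v => fst (l v)). apply H. exists (fun v => snd (l v)). exact hl.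
Qed.

(* A tree is rejected iff player 2 wins the game; his positional strategy, which maps the
   state of the automaton and the proposed label to a direction, labels the tree. *)
Lemma rec_not (Sig : Type) (K : (list Dir -> Sig) -> Prop) : finite_type Sig ->
  rec K -> rec (fun t => ~ K t).
Proof.
  intros hS [G [W [hG [hW H]]]]. destruct (determinise hW) as [D hD].
  set (Y := (Sig * (dst D -> G -> Dir) * Dir * (dst D * G))%type).
  assert (hY : finite_type Y).
  { pose proof (dst_fin D). repeat (apply fin_prod || apply fin_fun); assumption. }
  set (ys := fun y : Y => fst (fst (fst y))). set (yt := fun y : Y => snd (fst (fst y))).
  set (yd := fun y : Y => snd (fst y)). set (ym := fun y : Y => fst (snd y)).
  set (yg := fun y : Y => snd (snd y)).
  (* [ys], [yt] and [yd] are visible on the branch; [ym] and [yg] are guessed. [B] says that the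
     branch follows the strategy against the guessed labels and that these labels are accepted on
     it. *)
  set (B := fun y : nat -> Y => ym (y 0) = dst0 D /\
     (forall n, ym (y (S n)) = dtr D (ym (y n)) (ys (y n), yg (y n), yd (y n)) /\
                yt (y n) (ym (y n)) (yg (y n)) = yd (y n)) /\
     W (fun n => (ys (y n), yg (y n), yd (y n)))).
  assert (hB : oreg B).
  { apply oreg_and; [exact (oreg_first (fun y => ym y = dst0 D))|apply oreg_and].
    - exact (oreg_step (fun y y' => ym y' = dtr D (ym y) (ys y, yg y, yd y) /\
         yt y (ym y) (yg y) = yd y) hY).
    - exact (oreg_pre (fun y => (ys y, yg y, yd y)) hW). }
  exists (dst D -> G -> Dir), (fun w => ~ exists y, (forall n, fst (y n) = w n) /\ B y).
  split; [|split].
  { pose proof (dst_fin D). repeat apply fin_fun; assumption. }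
  { apply oreg_not, (oreg_image (fun y : Y => fst y) hB). }
  intros t. split.
  - intros hK.
    destruct (fin_code hDir) as [cd hcd]. destruct (list_code _ hcd) as [code hcode].
    set (st := fun (z : list Dir) d => z ++ [d]).
    assert (hst : forall v, fold_left st v [] = v).
    { induction v as [|d v IH] using rev_ind; [reflexivity|].
      rewrite fold_left_app, IH. reflexivity. }
    destruct (arena_determined D st t code hcode ([], dst0 D)) as [h|[Wr [U [hU h0]]]].
    { exfalso. apply hK, H. apply (@arena_spec Dir Sig G _ D st t W code [] hD hcode) in h.
      destruct h as [l hl]. exists l. intros d. specialize (hl d). revert hl.
      replace (fun n => (t (fold_left st (pre d n) []), l (pre d n), d n))
         with (fun n => (t (pre d n), l (pre d n), d n)); [auto|].
      apply functional_extensionality; intros n. rewrite hst. reflexivity. }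
    destruct (@choose (list Dir * dst D * G) Dir (fun x d => Wr (fst x) ->
       U (fst x) (gnext D st t (fst x) (snd x) d))) as [adv hadv].
    { intros [p g]. simpl. destruct (classic (Wr p)) as [hp|hp].
      - pose proof (sw_move hU _ hp) as h. rewrite arena_dual in h.
        destruct (h g) as [d hd]. exists d; auto.
      - pose proof (sw_move hU _ h0) as h. rewrite arena_dual in h.
        destruct (h g) as [d hd]. exists d; tauto. }
    exists (fun v m g => adv ((v, m), g)). intros d [y [hy [hB0 [hBs hBW]]]].
    assert (hys : forall n, ys (y n) = t (pre d n)) by (intros n; unfold ys; rewrite hy; reflexivity).
    assert (hyd : forall n, yd (y n) = d n) by (intros n; unfold yd; rewrite hy; reflexivity).
    assert (hyt : forall n m g, yt (y n) m g = adv ((pre d n, m), g)).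
    { intros n m g. unfold yt. rewrite hy. reflexivity. }
    set (s := fun n => (pre d n, ym (y n))).
    assert (hs : forall n, gnext D st t (s n) (yg (y n)) (d n) = s (S n)).
    { intros n. unfold gnext, s. simpl. f_equal; [symmetry; apply pre_S|].
      rewrite (proj1 (hBs n)), hys, hyd. reflexivity. }
    assert (hU' : forall n, Wr (s n) -> U (s n) (s (S n))).
    { intros n hn. rewrite <- hs. pose proof (hadv (s n, yg (y n)) hn) as h. simpl in h.
      replace (d n) with (adv (s n, yg (y n))); [assumption|].
      destruct (hBs n) as [_ h']. rewrite hyt, hyd in h'. exact h'. }
    assert (hWr : forall n, Wr (s n)).
    { induction n as [|n IH]; [unfold s; rewrite hB0; exact h0|].
      eapply (sw_closed hU); [exact IH|]. apply hU', IH. }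
    apply hD in hBW. apply (Par_excl hBW).
    eapply Par_ext; [|apply (sw_par hU s (hWr 0) (fun n => hU' n (hWr n)))].
    intros n. unfold gprio. f_equal. simpl.
    apply (@drunfrom_unique _ D _ (fun n => ym (y n))); [assumption|]. intros k; apply hBs.
  - intros [tau htau] hK. apply H in hK. destruct hK as [l hl].
    (* Playing [tau] against the labels [l] selects a branch that follows [tau]; since [l] is
       accepted on it, it violates the condition on [tau]. *)
    set (x := fun n => Nat.iter n (fun x : list Dir * dst D =>
       let d := tau (fst x) (snd x) (l (fst x)) in
       (fst x ++ [d], dtr D (snd x) (t (fst x), l (fst x), d))) ([], dst0 D)).
    set (d := fun n => tau (fst (x n)) (snd (x n)) (l (fst (x n)))).
    assert (hv : forall n, fst (x n) = pre d n).
    { induction n as [|n IH]; [reflexivity|]. rewrite pre_S, <- IH. reflexivity. }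
    apply (htau d). exists (fun n => ((t (pre d n), tau (pre d n), d n), (snd (x n), l (pre d n)))).
    split; [reflexivity|]. split; [reflexivity|split].
    + intros n. unfold ym, ys, yg, yd, yt. simpl. rewrite <- hv. split; reflexivity.
    + apply (hl d).
Qed.

End Recognisable.

(** * From monadic second-order logic to recognisable sets *)

Lemma branch_through (Dir : Type) (d0 : Dir) (v : list Dir) :
  exists d, pre d (length v) = v.
Proof.
  exists (fun n => nth n v d0). apply nth_error_ext. intros k. unfold pre.
  destruct (Nat.lt_ge_cases k (length v)) as [h|h].
  - rewrite slice_nth by lia. simpl. symmetry; apply nth_error_nth'. assumption.
  - rewrite (proj2 (nth_error_None _ _)) by (rewrite slice_length; lia).
    symmetry; apply nth_error_None; assumption.
Qed.

Lemma pre_length (Dir : Type) (d : nat -> Dir) n : length (pre d n) = n.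
Proof. unfold pre. rewrite slice_length; lia. Qed.

Lemma app_inj_length (X : Type) (u v x y : list X) :
  length u = length v -> u ++ x = v ++ y -> u = v.
Proof.
  revert v; induction u as [|a u IH]; intros [|b v] hl e; try discriminate; [reflexivity|].
  inversion e. inversion hl. f_equal. eauto.
Qed.

Section Paths.
Variables (Dir Sig : Type).
Hypothesis (hDir : finite_type Dir) (hSig : finite_type Sig).

Lemma rec_step (phi : Sig * Dir -> Sig * Dir -> Prop) :
  rec (fun t => forall (d : nat -> Dir) n,
         phi (t (pre d n), d n) (t (pre d (S n)), d (S n))).
Proof.
  refine (rec_paths (W := fun w : nat -> Sig * Dir => forall n, phi (w n) (w (S n))) _).
  apply oreg_step, fin_prod; assumption.
Qed.

Lemma rec_vertices (phi : Sig -> Prop) (d0 : Dir) :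
  rec (fun t : list Dir -> Sig => forall v, phi (t v)).
Proof.
  eapply rec_ext; [|exact (rec_step (fun x _ => phi (fst x)))].
  intros t; split; intros h; simpl in *.
  - intros v. destruct (branch_through d0 v) as [d <-]. apply h.
  - intros d n; apply h.
Qed.

End Paths.

(* [p] points from each vertex of a path to the next one, [o] holds on that path, and the
   path must stop; [b] holds at its end. *)
Definition pointer (Dir : Type) (b o : list Dir -> Prop) (p : list Dir -> option Dir) : Prop :=
  o [] /\ (forall v d, o (v ++ [d]) <-> o v /\ p v = Some d) /\
  (forall v, b v <-> o v /\ p v = None) /\
  forall d : nat -> Dir, ~ forall n, o (pre d n).

(** Turns a global property into a condition on branches. Following the pointers from the root gives
    the only path on which [o] can hold; it has to stop, and [b] holds exactly where it does.
    Conversely [o] consists of the prefixes of [v0]. *)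
Lemma pointer_singleton (Dir : Type) (d0 : Dir) (b : list Dir -> Prop) :
  (exists o p, pointer b o p) <-> exists v0, forall v, b v <-> v = v0.
Proof.
  split.
  - intros [o [p [h0 [hS [hb hn]]]]].
    set (x := fun n => Nat.iter n (fun v => match p v with Some d => v ++ [d] | None => v ++ [d0] end) []).
    set (d := fun n => match p (x n) with Some d => d | None => d0 end).
    assert (hx : forall n, x n = pre d n).
    { induction n as [|n IH]; [reflexivity|]. rewrite pre_S, <- IH. unfold d. simpl.
      fold (x n). destruct (p (x n)); reflexivity. }
    destruct (@least (fun n => p (x n) = None)) as [n [h1 h2]].
    { apply NNPP; intros hnn. apply (hn d). induction n as [|n IH]; [assumption|].
      rewrite pre_S. apply hS. split; [assumption|]. rewrite <- hx. unfold d.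
      destruct (p (x n)) eqn:E; [reflexivity|]. exfalso; apply hnn.
      exists n. assumption. }
    assert (ho : forall k, k <= n -> o (x k)).
    { induction k as [|k IH]; intros hk; [assumption|].
      rewrite hx, pre_S. apply hS. rewrite <- hx. split; [apply IH; lia|].
      unfold d. destruct (p (x k)) eqn:E; [reflexivity|]. specialize (h2 k E). lia. }
    assert (hu : forall v, o v -> v = x (length v)).
    { induction v as [|c v IH] using rev_ind; intros hv; [reflexivity|].
      apply hS in hv. destruct hv as [hv hc]. rewrite length_app, Nat.add_1_r, hx, pre_S, <- hx.
      rewrite <- (IH hv). unfold d. rewrite <- (IH hv), hc. reflexivity. }
    exists (x n). intros v. rewrite hb. split.
    + intros [h3 h4]. pose proof (hu v h3) as e. rewrite e in h4 |- *. f_equal.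
      specialize (h2 _ h4). destruct (Nat.eq_dec (length v) n) as [|hne]; [assumption|exfalso].
      assert (h5 : o (x (S n))).
      { replace (x (S n)) with (firstn (S n) v).
        - assert (H : forall k u, o (u ++ k) -> o u).
          { intros k. induction k as [|c k IH] using rev_ind; intros u hu'.
            - rewrite app_nil_r in hu'; assumption.
            - rewrite app_assoc in hu'. apply hS in hu'. apply IH, hu'. }
          apply (H (skipn (S n) v)). rewrite firstn_skipn. assumption.
        - rewrite hx. rewrite e at 1. rewrite hx. symmetry.
          unfold pre. rewrite (@slice_app _ d 0 (S n) (length v)) by lia.
          rewrite firstn_app, slice_length.
          replace (S n - (S n - 0)) with 0 by lia. rewrite firstn_all2 by (rewrite slice_length; lia).
          rewrite firstn_O, app_nil_r. reflexivity. }
      rewrite hx, pre_S in h5. apply hS in h5. destruct h5 as [_ h5]. rewrite <- hx in h5. congruence.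
    + intros ->. split; [apply ho; lia|assumption].
  - intros [v0 h].
    exists (fun v => exists u, v0 = v ++ u), (fun v => nth_error v0 (length v)).
    split; [exists v0; reflexivity|split; [|split]].
    + intros v d; split.
      * intros [u ->]. split; [exists (d :: u); rewrite <- app_assoc; reflexivity|].
        rewrite <- app_assoc, nth_error_app2, Nat.sub_diag by lia. reflexivity.
      * intros [[[|c u] ->] e].
        -- rewrite app_nil_r, (proj2 (nth_error_None _ _)) in e by lia. discriminate.
        -- rewrite nth_error_app2, Nat.sub_diag in e by lia. simpl in e. inversion e; subst.
           exists u. rewrite <- app_assoc. reflexivity.
    + intros v. rewrite h. split.
      * intros ->. split; [exists []; rewrite app_nil_r; reflexivity|].
        apply nth_error_None; lia.
      * intros [[u ->] e]. apply nth_error_None in e. rewrite length_app in e.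
        destruct u; [rewrite app_nil_r; reflexivity|simpl in e; lia].
    + intros d hd. destruct (hd (S (length v0))) as [u hu].
      apply (f_equal (@length _)) in hu. rewrite length_app, pre_length in hu. lia.
Qed.

Lemma rec_singleton (Dir : Type) (d0 : Dir) : finite_type Dir ->
  rec (fun b : list Dir -> Prop => exists v0, forall v, b v <-> v = v0).
Proof.
  intros hDir.
  set (Y := (Prop * option Dir)%type).
  assert (hY : finite_type Y) by (apply fin_prod; [apply fin_Prop|apply fin_option, hDir]).
  assert (hS : finite_type (Prop * Y)) by (apply fin_prod; [apply fin_Prop|assumption]).
  assert (hSD : finite_type (Prop * Y * Dir)) by (apply fin_prod; assumption).
  set (o := fun x : Prop * Y * Dir => fst (snd (fst x))).
  set (p := fun x : Prop * Y * Dir => snd (snd (fst x))).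
  set (W := fun w : nat -> Prop * Y * Dir => o (w 0) /\
    (forall n, (o (w (S n)) <-> o (w n) /\ p (w n) = Some (snd (w n))) /\
               (fst (fst (w n)) <-> o (w n) /\ p (w n) = None)) /\ ~ forall n, o (w n)).
  assert (hW : oreg W).
  { apply oreg_and; [apply (oreg_first o)|apply oreg_and].
    - exact (oreg_step (fun x x' => (o x' <-> o x /\ p x = Some (snd x)) /\
         (fst (fst x) <-> o x /\ p x = None)) hSD).
    - apply oreg_not, (oreg_all o hSD). }
  eapply rec_ext; [|exact (rec_proj hY (rec_paths hW))]. intros b. simpl.
  rewrite <- (pointer_singleton d0). split.
  - intros [y hy]. exists (fun v => fst (y v)), (fun v => snd (y v)). split; [|split; [|split]].
    + apply (hy (fun _ => d0)).
    + intros v c. destruct (branch_through d0 (v ++ [c])) as [d hd].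
      rewrite length_app, Nat.add_1_r, pre_S in hd. apply app_inj_tail in hd. destruct hd as [hd hc].
      destruct (hy d) as [_ [h _]]. destruct (h (length v)) as [h' _]. simpl in h'.
      unfold o, p in h'; simpl in h'. rewrite pre_S, hd, hc in h'. exact h'.
    + intros v. destruct (branch_through d0 v) as [d hd].
      destruct (hy d) as [_ [h _]]. destruct (h (length v)) as [_ h'].
      unfold o, p in h'; simpl in h'. rewrite hd in h'. exact h'.
    + intros d. apply (hy d).
  - intros [o' [p' [h1 [h2 [h3 h4]]]]]. exists (fun v => (o' v, p' v)). intros d.
    unfold W, o, p; simpl. split; [exact h1|split; [|apply h4]].
    intros n. split; [|apply h3]. rewrite pre_S. apply h2.
Qed.

Section MSO.
Variables (A : PosW) (n R : nat).
Hypothesis hA : finite_type {k : nat & A k}.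
Hypothesis hR : forall k, A k -> k < R.
Hypothesis hR0 : 0 < R.

Definition Dir : Type := {i | i < R}.
Definition dir0 : Dir := exist _ 0 hR0.

Definition addr (v : list Dir) : list nat := map (@proj1_sig nat _) v.

Lemma addr_app u v : addr (u ++ v) = addr u ++ addr v.
Proof. apply map_app. Qed.

Lemma addr_inj u v : addr u = addr v -> u = v.
Proof.
  revert v; induction u as [|a u IH]; intros [|b v] h; try discriminate; [reflexivity|].
  inversion h. f_equal; [apply sig_ext; assumption|auto].
Qed.

(** Bounding the variables keeps the alphabet [lbl] finite. *)
Definition ok_label (o : option (label A)) : Prop := forall i, o = Some (Var i) -> i < n.
Definition lbl : Type := {o | ok_label o}.

Lemma fin_lbl : finite_type lbl.
Proof using hA.
  apply fin_sig. destruct hA as [l hl].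
  exists (None :: map (fun c : {k : nat & A k} => Some (Node (projT1 c) (projT2 c))) l ++
          map (fun i => Some (Var i)) (seq 0 n)).
  intros [[k a|i]|] h.
  - right. apply in_app_iff; left. apply in_map_iff. exists (existT _ k a). split; auto.
  - right. apply in_app_iff; right. apply in_map_iff. exists i. split; [reflexivity|].
    apply in_seq. split; [apply Nat.le_0_l|exact (h i eq_refl)].
  - left; reflexivity.
Qed.

Lemma fin_Dir : finite_type Dir.
Proof. apply fin_lt. Qed.

Lemma wf_ok (t : Tcar A n) w : ok_label (proj1_sig t w).
Proof. intros i h. destruct (proj2_sig t) as [_ [hv _]]. eapply hv; eassumption. Qed.

Lemma dom_addr (t : Tcar A n) w : proj1_sig t w <> None -> exists v, addr v = w.
Proof.
  induction w as [|c w IH] using rev_ind; intros h; [exists []; reflexivity|].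
  destruct (proj2_sig t) as [_ [_ hc]]. apply hc in h. destruct h as [k [a [h1 h2]]].
  destruct IH as [v hv]; [congruence|].
  assert (hcR : c < R) by (pose proof (hR k a); lia).
  exists (v ++ [exist _ c hcR]). rewrite addr_app, hv. reflexivity.
Qed.

Definition ltree (t : Tcar A n) (v : list Dir) : lbl :=
  exist _ (proj1_sig t (addr v)) (wf_ok t (addr v)).

Variable N : nat.
Definition bits : Type := {x | x < N} -> Prop.
Definition letter : Type := (lbl * (bits * bits))%type.

Lemma fin_letter : finite_type letter.
Proof.
  apply fin_prod; [apply fin_lbl|apply fin_prod; apply fin_pred, fin_lt].
Qed.

Definition lab_of (s : letter) : option (label A) := proj1_sig (fst s).
Definition get (b : bits) (x : nat) : Prop := exists h : x < N, b (exist _ x h).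
Definition set_bit (b : bits) (x : nat) (c : Prop) : bits :=
  fun y => if Nat.eqb (proj1_sig y) x then c else b y.

(** The valuation becomes part of the tree: a letter carries one bit for each variable with name
    below [N]. *)
Definition enc (t : Tcar A n) (fo : nat -> list nat) (so : nat -> list nat -> Prop)
  (v : list Dir) : letter :=
  (ltree t v, (fun x => fo (proj1_sig x) = addr v, fun x => so (proj1_sig x) (addr v))).

Lemma get_spec (g : nat -> Prop) x : x < N ->
  (get (fun y : {x | x < N} => g (proj1_sig y)) x <-> g x).
Proof. intros hx. split; [intros [h h']; exact h'|intros h; exists hx; exact h]. Qed.

Lemma get_fo t fo so v x : x < N -> (get (fst (snd (enc t fo so v))) x <-> fo x = addr v).
Proof. apply (get_spec (fun x => fo x = addr v)). Qed.

Lemma get_so t fo so v x : x < N -> (get (snd (snd (enc t fo so v))) x <-> so x (addr v)).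
Proof. apply (get_spec (fun x => so x (addr v))). Qed.

Definition fbit (x : nat) (s : letter) : Prop := get (fst (snd s)) x.
Definition sbit (x : nat) (s : letter) : Prop := get (snd (snd s)) x.

(** The guard on [fo] makes every first-order value an address over [Dir], so that it is visible in
    the encoded tree. *)
Definition mso_rec (f : mso {k : nat & A k}) : Prop :=
  exists K : (list Dir -> letter) -> Prop, rec K /\
    forall t fo so, (forall x, proj1_sig t (fo x) <> None) ->
      (sat (proj1_sig t) fo so f <-> K (enc t fo so)).

(** Exactly one vertex is marked by [x], so a property of this vertex can be checked as a condition
    on all marked vertices. *)
Lemma mso_vertices f x (phi : letter -> Prop) : x < N ->
  (forall t fo so v, fo x = addr v ->
     (sat (proj1_sig t) fo so f <-> phi (enc t fo so v))) -> mso_rec f.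
Proof.
  intros hx h. eexists; split.
  - exact (rec_vertices fin_Dir fin_letter (fun s => fbit x s -> phi s) dir0).
  - intros t fo so hd. destruct (dom_addr t (fo x) (hd x)) as [v hv]. split.
    + intros hs u hu. apply get_fo in hu; [|assumption]. apply (h t fo so u); assumption.
    + intros H. apply (h t fo so v); [auto|]. apply H. apply get_fo; auto.
Qed.

Lemma mso_rec_succ i x y : x < N -> y < N -> mso_rec (MSucc i x y).
Proof.
  intros hx hy. eexists; split.
  - apply rec_and.
    + exact (rec_paths (oreg_first (fun s : letter * Dir => ~ fbit y (fst s)))).
    + exact (rec_step fin_Dir fin_letter (fun s s' =>
        fbit y (fst s') -> fbit x (fst s) /\ proj1_sig (snd s) = i)).
  - intros t fo so hd. simpl sat. split.
    + intros e. split.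
      * intros d h. apply get_fo in h; [|assumption]. rewrite e in h.
        apply app_eq_nil in h. destruct h; discriminate.
      * intros d m h. apply get_fo in h; [|assumption]. rewrite pre_S, addr_app, e in h.
        apply app_inj_tail in h. destruct h as [h1 h2]. split; [apply get_fo; assumption|auto].
    + intros [h1 h2]. destruct (dom_addr t (fo y) (hd y)) as [v hv].
      destruct (branch_through dir0 v) as [d e]. revert hv e.
      induction v as [|c v _] using rev_ind; intros hv e.
      * exfalso. apply (h1 d). apply get_fo; auto.
      * rewrite length_app, Nat.add_1_r in e. specialize (h2 d (length v)). simpl fst in h2.
        rewrite e in h2. destruct h2 as [h3 h4]; [apply get_fo; auto|].
        rewrite pre_S in e. apply app_inj_tail in e. destruct e as [e1 e2].
        apply get_fo in h3; [|assumption]. rewrite <- hv, h3, e1, addr_app.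
        simpl in h4. simpl. rewrite <- h4, e2. reflexivity.
Qed.

(** On each branch an auxiliary bit, guessed and verified step by step, records whether [x] has been
    seen; it must be set when [y] is met. *)
Lemma mso_rec_le x y : x < N -> y < N -> mso_rec (MLe x y).
Proof.
  intros hx hy.
  set (W := fun w : nat -> letter * Dir =>
     exists z : nat -> letter * Dir * Prop, (forall m, fst (z m) = w m) /\
       ((snd (z 0) <-> fbit x (fst (fst (z 0)))) /\
       (forall m, (snd (z (S m)) <-> snd (z m) \/ fbit x (fst (fst (z (S m))))) /\
                  (fbit y (fst (fst (z m))) -> snd (z m))))).
  assert (hSD : finite_type (letter * Dir * Prop)).
  { apply fin_prod; [apply fin_prod; [apply fin_letter|apply fin_Dir]|apply fin_Prop]. }
  assert (hW : oreg W).
  { apply (oreg_image (fun z : letter * Dir * Prop => fst z)). apply oreg_and.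
    - exact (oreg_first (fun z : letter * Dir * Prop => snd z <-> fbit x (fst (fst z)))).
    - exact (oreg_step (fun z z' : letter * Dir * Prop =>
         (snd z' <-> snd z \/ fbit x (fst (fst z'))) /\ (fbit y (fst (fst z)) -> snd z)) hSD). }
  assert (hW' : forall w, W w <-> forall m, fbit y (fst (w m)) -> exists k, k <= m /\ fbit x (fst (w k))).
  { intros w. split.
    - intros [z [hz [h0 hS]]] m hm.
      assert (H : forall m, snd (z m) -> exists k, k <= m /\ fbit x (fst (w k))).
      { clear m hm. induction m as [|m IH]; intros h.
        - exists 0. rewrite <- hz. split; [lia|apply h0, h].
        - apply hS in h. destruct h as [h|h].
          + destruct (IH h) as [k [hk hk']]. exists k; split; [lia|assumption].
          + exists (S m). rewrite <- hz. split; [lia|assumption]. }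
      apply H, hS. rewrite hz. assumption.
    - intros h. exists (fun m => (w m, exists k, k <= m /\ fbit x (fst (w k)))).
      split; [reflexivity|]. simpl. split.
      + split; [intros [k [hk hx']]|intros hx'; exists 0; auto]. replace 0 with k by lia; assumption.
      + intros m. split; [|apply h]. split.
        * intros [k [hk hx']]. destruct (Nat.eq_dec k (S m)) as [->|]; [auto|].
          left; exists k; split; [lia|assumption].
        * intros [[k [hk hx']]|hx']; [exists k|exists (S m)]; split; auto. }
  eexists; split; [exact (rec_paths hW)|].
  intros t fo so hd. simpl sat. split.
  - intros [u hu] d. apply hW'. simpl. intros m hm. apply get_fo in hm; [|assumption].
    rewrite hu in hm. exists (length (fo x)).
    assert (hl : length (fo x) <= m).
    { apply (f_equal (@length _)) in hm. unfold addr in hm.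
      rewrite length_app, length_map, pre_length in hm. lia. }
    split; [assumption|]. apply get_fo; [assumption|].
    unfold pre in hm. rewrite (@slice_app _ d 0 (length (fo x)) m), addr_app in hm by lia.
    refine (app_inj_length _ _ _ _ _ hm).
    unfold addr. rewrite length_map, slice_length. lia.
  - intros h. destruct (dom_addr t (fo y) (hd y)) as [v hv]. destruct (branch_through dir0 v) as [d e].
    specialize (h d). rewrite hW' in h. destruct (h (length v)) as [k [hk hx']].
    { simpl. rewrite e. apply get_fo; auto. }
    simpl in hx'. apply get_fo in hx'; [|assumption]. rewrite hx', <- hv, <- e.
    unfold pre. rewrite (@slice_app _ d 0 k (length v)) by lia. rewrite addr_app. eauto.
Qed.

Lemma enc_ext (s : list Dir -> letter) t fo so :
  (forall v, fst (s v) = ltree t v) ->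
  (forall v x, fst (snd (s v)) x <-> fo (proj1_sig x) = addr v) ->
  (forall v x, snd (snd (s v)) x <-> so (proj1_sig x) (addr v)) -> s = enc t fo so.
Proof.
  intros h1 h2 h3. apply functional_extensionality; intros v.
  specialize (h1 v); specialize (h2 v); specialize (h3 v). unfold enc.
  destruct (s v) as [l [f g]]; simpl in *. f_equal; [assumption|]. f_equal; apply pred_ext; auto.
Qed.

Lemma mso_rec_ex x f : x < N -> mso_rec f -> mso_rec (MEx x f).
Proof.
  intros hx [K [hK H]].
  set (h := fun s : letter * Prop =>
    ((fst (fst s), (set_bit (fst (snd (fst s))) x (snd s), snd (snd (fst s)))) : letter)).
  assert (hSP : finite_type (letter * Prop)) by (apply fin_prod; [apply fin_letter|apply fin_Prop]).
  eexists; split.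
  - exact (rec_proj fin_Prop (rec_and (rec_pre h hK) (rec_and
      (rec_pre (fun s : letter * Prop => snd s) (rec_singleton dir0 fin_Dir))
      (rec_vertices fin_Dir hSP (fun s => snd s -> lab_of (fst s) <> None) dir0)))).
  - intros t fo so hd. simpl sat.
    assert (E : forall y w, (forall v, y v <-> addr v = w) ->
      (fun v => h (enc t fo so v, y v)) = enc t (upd fo x w) so).
    { intros y w hy. apply enc_ext; simpl.
      - reflexivity.
      - intros v z. unfold set_bit, upd. destruct (Nat.eqb (proj1_sig z) x); [|tauto].
        rewrite hy. split; auto.
      - tauto. }
    assert (hd' : forall w, proj1_sig t w <> None -> forall z, proj1_sig t (upd fo x w z) <> None).
    { intros w hw z. unfold upd. destruct (Nat.eqb z x); auto. }
    split.
    + intros [w [hw hs]]. destruct (dom_addr t w hw) as [v0 hv0].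
      exists (fun v => v = v0). split; [|split].
      * rewrite (E _ w); [apply H; [apply hd'; assumption|assumption]|].
        intros v; split; [intros ->; assumption|intros e; apply addr_inj; congruence].
      * exists v0; simpl; tauto.
      * simpl. intros v ->. unfold lab_of; simpl. rewrite hv0. assumption.
    + intros [y [h1 [[v0 h2] h3]]]. simpl in h2, h3.
      assert (hw : proj1_sig t (addr v0) <> None).
      { apply (h3 v0). apply h2; reflexivity. }
      exists (addr v0). split; [assumption|]. apply H; [apply hd'; assumption|].
      rewrite <- (E y); [assumption|]. intros v. rewrite h2. split; [congruence|apply addr_inj].
Qed.

Lemma mso_rec_exS x f : x < N -> mso_rec f -> mso_rec (MExS x f).
Proof.
  intros hx [K [hK H]].
  set (h := fun s : letter * Prop =>
    ((fst (fst s), (fst (snd (fst s)), set_bit (snd (snd (fst s))) x (snd s))) : letter)).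
  assert (hSP : finite_type (letter * Prop)) by (apply fin_prod; [apply fin_letter|apply fin_Prop]).
  eexists; split.
  - exact (rec_proj fin_Prop (rec_and (rec_pre h hK)
      (rec_vertices fin_Dir hSP (fun s => snd s -> lab_of (fst s) <> None) dir0))).
  - intros t fo so hd. simpl sat.
    assert (E : forall (y : list Dir -> Prop) T, (forall v, y v <-> T (addr v)) ->
      (fun v => h (enc t fo so v, y v)) = enc t fo (upd so x T)).
    { intros y T hy. apply enc_ext; simpl.
      - reflexivity.
      - tauto.
      - intros v z. unfold set_bit, upd. destruct (Nat.eqb (proj1_sig z) x); [apply hy|tauto]. }
    split.
    + intros [T [hT hs]]. exists (fun v => T (addr v)). split.
      * rewrite (E _ T); [apply H; assumption|tauto].
      * intros v. apply hT.
    + intros [y [h1 h2]]. simpl in h2.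
      exists (fun w => exists v, addr v = w /\ y v). split.
      * intros w [v [<- hv]]. apply (h2 v hv).
      * apply H; [assumption|]. rewrite <- (E y); [assumption|].
        intros v; split; [eauto|]. intros [v' [e hv']]. apply addr_inj in e; subst; assumption.
Qed.

Fixpoint vars_below (f : mso {k : nat & A k}) : Prop :=
  match f with
  | MLe x y | MSucc _ x y | MEq x y | MIn x y => x < N /\ y < N
  | MLab _ x | MVarLab _ x | MRoot x => x < N
  | MNot g => vars_below g
  | MAnd g h => vars_below g /\ vars_below h
  | MEx x g | MExS x g => x < N /\ vars_below g
  end.

Lemma mso_rec_all f : vars_below f -> mso_rec f.
Proof.
  induction f as [x y|i x y|c x|i x|x|x y|x y|g IH|g IHg h IHh|x g IH|x g IH]; simpl; intros hN.
  - apply mso_rec_le; tauto.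
  - apply mso_rec_succ; tauto.
  - apply mso_vertices with (x := x) (phi := fun s => exists k a,
      lab_of s = Some (Node k a) /\ existT _ k a = c); [assumption|].
    intros t fo so v e. simpl. rewrite e. reflexivity.
  - apply mso_vertices with (x := x) (phi := fun s => lab_of s = Some (Var i)); [assumption|].
    intros t fo so v e. simpl. rewrite e. reflexivity.
  - eexists; split; [exact (rec_paths (oreg_first (fun s : letter * Dir => fbit x (fst s))))|].
    intros t fo so hd. simpl. split.
    + intros e d. apply get_fo; assumption.
    + intros h. specialize (h (fun _ => dir0)). apply get_fo in h; assumption.
  - apply mso_vertices with (x := x) (phi := fbit y); [tauto|].
    intros t fo so v e. simpl. unfold fbit. rewrite get_fo by tauto. rewrite e. split; auto.
  - apply mso_vertices with (x := x) (phi := sbit y); [tauto|].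
    intros t fo so v e. simpl. unfold sbit. rewrite get_so by tauto. rewrite e. reflexivity.
  - destruct (IH hN) as [K [hK H]]. eexists; split; [exact (rec_not fin_Dir fin_letter hK)|].
    intros t fo so hd. simpl. rewrite H by assumption. reflexivity.
  - destruct (IHg (proj1 hN)) as [K [hK H]]. destruct (IHh (proj2 hN)) as [K' [hK' H']].
    eexists; split; [exact (rec_and hK hK')|].
    intros t fo so hd. simpl. rewrite H, H' by assumption. reflexivity.
  - apply mso_rec_ex; tauto.
  - apply mso_rec_exS; tauto.
Qed.

End MSO.

Lemma vars_below_mono (A : PosW) N N' (f : mso {k : nat & A k}) :
  N <= N' -> vars_below A N f -> vars_below A N' f.
Proof. intros h. induction f; simpl; intuition lia. Qed.

Lemma vars_below_exists (A : PosW) (f : mso {k : nat & A k}) : exists N, vars_below A N f.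
Proof.
  induction f as [x y|i x y|c x|i x|x|x y|x y|g [N IH]|g [N IHg] h [N' IHh]|x g [N IH]|x g [N IH]];
    simpl.
  1, 2, 6, 7: exists (S (x + y)); lia.
  1, 2, 3: exists (S x); lia.
  - exists N; assumption.
  - exists (N + N'). split; eapply vars_below_mono; try eassumption; lia.
  - exists (S (x + N)). split; [lia|eapply vars_below_mono; try eassumption; lia].
  - exists (S (x + N)). split; [lia|eapply vars_below_mono; try eassumption; lia].
Qed.

(** In [mso_definable] every first-order variable starts at the root and every set variable is
    empty. The guessed bit, forced to hold at the root only, provides this valuation. *)
Theorem definable_rec (A : PosW) (n R : nat) (L : Tcar A n -> Prop) (hR0 : 0 < R) :
  finite_type {k : nat & A k} -> (forall k, A k -> k < R) -> mso_definable L ->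
  exists K : (list (Dir R) -> lbl A n) -> Prop, rec K /\ forall t, L t <-> K (ltree t).
Proof.
  intros hA hR [f [_ hf]]. destruct (vars_below_exists A f) as [N hN].
  destruct (@mso_rec_all A n R hA hR hR0 N f hN) as [K [hK H]].
  set (h := fun s : lbl A n * Prop =>
     ((fst s, (fun _ => snd s, fun _ => False)) : letter A n N)).
  assert (hP : finite_type (lbl A n * Prop)) by (apply fin_prod; [exact (fin_lbl A n hA)|apply fin_Prop]).
  eexists; split.
  - exact (rec_proj fin_Prop (rec_and (rec_pre h hK) (rec_and
      (rec_paths (oreg_first (fun s : lbl A n * Prop * Dir R => snd (fst s))))
      (rec_step (fin_Dir R) hP (fun _ s' => ~ snd (fst s')))))).
  - intros t. rewrite hf, H.
    2: { intros _ e0. destruct (proj2_sig t) as [[k [a e]] _]. discriminate (eq_trans (eq_sym e) e0). }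
    assert (E : forall y : list (Dir R) -> Prop, (forall v, y v <-> v = []) ->
      (fun v => h (ltree t v, y v)) = enc N t (fun _ => []) (fun _ _ => False)).
    { intros y hy. apply enc_ext; simpl; try tauto.
      intros v _. rewrite hy. split; [intros ->; reflexivity|].
      destruct v; [reflexivity|discriminate]. }
    split.
    + intros hk. exists (fun v => v = []). split; [rewrite E; [assumption|tauto]|].
      split; [reflexivity|]. intros d m. rewrite pre_S. intros e.
      apply app_eq_nil in e. destruct e; discriminate.
    + intros [y [h1 [h2 h3]]]. rewrite E in h1; [assumption|].
      intros v. destruct (branch_through (dir0 hR0) v) as [d hd].
      split.
      * intros hv. destruct v as [|c v]; [reflexivity|]. exfalso. apply (h3 d (length v)).
        simpl in hd. rewrite hd. assumption.
      * intros ->. apply (h2 d).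
Qed.

(** * Automata over infinite ranked alphabets *)

(* The tree is extended by [None] to all addresses, so that every branch is infinite and
   leaving the tree is one more letter. *)
Definition infrec (A : PosW) (n : nat) (K : Tcar A n -> Prop) : Prop :=
  exists (B : Type) (Mv : option (label A) -> (nat -> B) -> Prop) (W : (nat -> B) -> Prop),
    finite_type B /\ oreg W /\
    forall t : Tcar A n, K t <-> exists mu : list nat -> nat -> B,
      (forall v, Mv (proj1_sig t v) (mu v)) /\ forall d, W (fun i => mu (pre d i) (d i)).

Lemma infrec_ext (A : PosW) n (K K' : Tcar A n -> Prop) :
  (forall t, K t <-> K' t) -> infrec K -> infrec K'.
Proof.
  intros h [B [Mv [W [hB [hW H]]]]]. exists B, Mv, W; split; [|split]; try assumption.
  intros t. rewrite <- h. apply H.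
Qed.

Lemma infrec_map (A C : PosW) n (f : forall k, A k -> C k) (K : Tcar C n -> Prop) :
  infrec K -> infrec (fun t : Tcar A n => K (Tmap f t)).
Proof.
  intros [B [Mv [W [hB [hW H]]]]].
  exists B, (fun l => Mv (option_map (lab_map f) l)), W. split; [|split]; try assumption.
  intros t. apply H.
Qed.

Lemma infrec_and (A : PosW) n (K K' : Tcar A n -> Prop) :
  infrec K -> infrec K' -> infrec (fun t => K t /\ K' t).
Proof.
  intros [B [Mv [W [hB [hW H]]]]] [B' [Mv' [W' [hB' [hW' H']]]]].
  exists (B * B')%type,
    (fun l mu => Mv l (fun d => fst (mu d)) /\ Mv' l (fun d => snd (mu d))),
    (fun w => W (fun i => fst (w i)) /\ W' (fun i => snd (w i))).
  split; [apply fin_prod; assumption|split].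
  - apply oreg_and; [exact (oreg_pre (fun x : B * B' => fst x) hW)|
                     exact (oreg_pre (fun x : B * B' => snd x) hW')].
  - intros t. rewrite H, H'. split.
    + intros [[mu [h1 h2]] [mu' [h1' h2']]]. exists (fun v d => (mu v d, mu' v d)). simpl.
      split; [auto|intros d; split; [apply h2|apply h2']].
    + intros [mu [h1 h2]]. split.
      * exists (fun v d => fst (mu v d)). split; [apply h1|intros d; apply (h2 d)].
      * exists (fun v d => snd (mu v d)). split; [apply h1|intros d; apply (h2 d)].
Qed.

(** * Substituting trees for the letters *)

Section Substitution.
Variables (X E : PosW) (tc : forall k, X k -> Tcar E k).

(** A variable of the outer tree counts as a tree with one vertex, so that entering it is a jump
    like any other. *)
Definition utree (l : option (label X)) : rawtree E :=
  match l with
  | Some (Node _ c) => proj1_sig (tc _ c)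
  | Some (Var j) => fun p => match p with [] => Some (Var j) | _ => None end
  | None => fun _ => None
  end.

Lemma utree_prefix l p : utree l p = None -> forall u, utree l (p ++ u) = None.
Proof.
  intros h u. induction u as [|c u IH] using rev_ind; [rewrite app_nil_r; assumption|].
  rewrite app_assoc. destruct l as [[k a|j]|]; simpl in *; [|destruct p; [discriminate|]|reflexivity].
  - apply NNPP; intros hn. destruct (proj2_sig (tc _ a)) as [_ [_ hc]].
    apply hc in hn. destruct hn as [k' [a' [h1 _]]]. congruence.
  - simpl. reflexivity.
Qed.

Variables (n : nat) (t : Tcar X n).

Definition zpos : Type := (list nat * list nat)%type.

(* Position (v, p) stands for the vertex p of the tree substituted at the vertex v. *)
Definition zlab (z : zpos) : option (label E) := utree (proj1_sig t (fst z)) (snd z).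

(** A variable leaf of a substituted tree is never visited; the step goes on to the root of the next
    one. Outside the tree the address just grows. *)
Definition zst (z : zpos) (c : nat) : zpos :=
  match utree (proj1_sig t (fst z)) (snd z ++ [c]) with
  | Some (Var i) => (fst z ++ [i], [])
  | _ => (fst z, snd z ++ [c])
  end.

Definition subst_tree : Tcar E n := flat (Tmap (B := TPos E) tc t).

(** Simulation between the walk of [flat] and positions. [FBad] forgets where the tree was left
    while the position moves on, so the invariant speaks of everything below it. *)
Definition zrel (s : fstate) (z : zpos) : Prop :=
  match s with
  | FIn v p => z = (v, p) /\ exists k a, zlab z = Some (Node k a)
  | FOut j => exists v, z = (v, []) /\ proj1_sig t v = Some (Var j)
  | FBad => forall u, utree (proj1_sig t (fst z)) (snd z ++ u) = None
  end.

Lemma utree_node l p k a : utree l p = Some (Node k a) ->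
  exists k' c, l = Some (Node k' c).
Proof. destruct l as [[k' c|j]|]; simpl; [eauto|destruct p; discriminate|discriminate]. Qed.

Lemma inner_utree v p k c : proj1_sig t v = Some (Node k c) ->
  inner (Tmap (B := TPos E) tc t) v p = utree (proj1_sig t v) p.
Proof. intros h. unfold inner. simpl. unfold Tmap_raw. rewrite h. reflexivity. Qed.

Lemma zrel_init : zrel (FIn [] []) ([], []).
Proof.
  split; [reflexivity|]. unfold zlab; simpl.
  destruct (proj2_sig t) as [[k [c h]] _]. rewrite h. simpl. apply (proj2_sig (tc _ c)).
Qed.

Lemma zrel_step s z c : zrel s z -> zrel (fstep (Tmap (B := TPos E) tc t) s c) (zst z c).
Proof.
  destruct s as [v p|j|]; simpl.
  - intros [-> [k [a h]]]. unfold zlab in h; simpl in h.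
    destruct (utree_node _ _ h) as [k' [c' hv]].
    rewrite !(inner_utree _ _ hv), h. unfold zst; simpl.
    destruct (utree (proj1_sig t v) (p ++ [c])) as [[k1 a1|i]|] eqn:e.
    + split; [reflexivity|]. exists k1, a1. exact e.
    + unfold Tmap_raw. destruct (proj1_sig t (v ++ [i])) as [[k2 a2|j]|] eqn:e2; simpl.
      * split; [reflexivity|]. unfold zlab; simpl. rewrite e2. simpl. apply (proj2_sig (tc _ a2)).
      * exists (v ++ [i]). auto.
      * rewrite e2. reflexivity.
    + intros u. simpl. apply utree_prefix, e.
  - intros [v [-> hv]]. unfold zst; simpl. rewrite hv. simpl. intros u. rewrite hv. reflexivity.
  - intros h. unfold zst. rewrite h. simpl. intros u. rewrite <- app_assoc. apply h.
Qed.

Lemma zrel_lab s z : zrel s z -> flab (Tmap (B := TPos E) tc t) s = zlab z.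
Proof.
  destruct s as [v p|j|]; simpl.
  - intros [-> [k [a h]]]. rewrite h. unfold zlab in h; simpl in h.
    destruct (utree_node _ _ h) as [k' [c' hv]]. rewrite (inner_utree _ _ hv), h. reflexivity.
  - intros [v [-> hv]]. unfold zlab; simpl. rewrite hv. reflexivity.
  - intros h. specialize (h []). rewrite app_nil_r in h. symmetry; exact h.
Qed.

Lemma subst_tree_spec w : proj1_sig subst_tree w = zlab (fold_left zst w ([], [])).
Proof.
  simpl. unfold flat_raw. apply zrel_lab.
  induction w as [|c w IH] using rev_ind; [apply zrel_init|].
  rewrite !fold_left_app. simpl. apply zrel_step, IH.
Qed.

End Substitution.

(** * Effects of the substituted trees on the automaton *)

Section Effects.
Variables (X E : PosW) (tc : forall k, X k -> Tcar E k) (n R : nat) (Gam : Type).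
Variable D : dpa (lbl E n * Gam * Dir R).

Lemma ok_None : ok_label (A := E) n None.
Proof. intros i h; discriminate h. Qed.

(** Variables of a substituted tree are not bounded by [n], so raw labels have to be forced into the
    finite alphabet. On the vertices of [subst_tree], [wrap_ok] applies. *)
Definition wrap (o : option (label E)) : lbl E n :=
  match excluded_middle_informative (ok_label n o) with
  | left h => exist (ok_label n) o h
  | right _ => exist (ok_label n) None ok_None
  end.

Lemma wrap_ok o : ok_label n o -> proj1_sig (wrap o) = o.
Proof. intros h. unfold wrap. destruct (excluded_middle_informative _); [reflexivity|tauto]. Qed.

Definition is_var (o : option (label E)) : Prop := exists i, o = Some (Var i).

(** The choice [g] may depend on the state of the automaton, as a positional strategy in the arena
    does. *)
Definition ilocal (l : option (label X)) (g : list nat -> dst D -> Gam)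
  (e : nat -> Dir R) (x : nat -> dst D) (j : nat) : Prop :=
  x (S j) = dtr D (x j) (wrap (utree tc l (addr (pre e j))), g (addr (pre e j)) (x j), e j).

Definition iloses l g (m : dst D) : Prop :=
  exists e x, x 0 = m /\ (forall j, ilocal l g e x j) /\
    (forall j, ~ is_var (utree tc l (addr (pre e (S j))))) /\
    ~ Par true (fun j => dprio D (x j)).

Definition ireach l g (i : nat) (m : dst D) (V : dst D -> Prop) (m' : dst D) : Prop :=
  exists k e x, x 0 = m /\ (forall j, j <= k -> ilocal l g e x j) /\
    (forall j, j < k -> ~ is_var (utree tc l (addr (pre e (S j))))) /\
    utree tc l (addr (pre e (S k))) = Some (Var i) /\ x (S k) = m' /\
    V = (fun m => exists j, j <= k /\ x j = m).

(* What the rest of the tree needs to know about a choice of labels inside the tree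
   substituted at a vertex: the states from which it is possible to lose inside, and the
   triples (m, V, m') such that, starting in state m, one may leave through the given
   direction in state m', having visited the set V of states. *)
Definition eletter : Type :=
  ((dst D -> Prop) * (dst D -> (dst D -> Prop) -> dst D -> Prop))%type.

Definition effect l g (i : nat) : eletter := (iloses l g, ireach l g i).

Definition emove (l : option (label X)) (mu : nat -> eletter) : Prop :=
  exists g, forall i, mu i = effect l g i.

(** The parity condition for segments of unbounded length: whether a priority recurs depends only on
    the set of states visited in each segment. *)
Definition vpar (V : nat -> dst D -> Prop) : Prop :=
  exists k, Nat.even k = true /\ Inf (fun i => exists m, V i m /\ dprio D m = k) /\
    ~ Inf (fun i => exists m, V i m /\ dprio D m < k).

(** The optional state is the one in which the current substituted tree is entered. [None] means
    that player 2 stayed in an earlier one forever and won there. *)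
Definition estep (y y' : eletter * (option (dst D) * (dst D -> Prop))) : Prop :=
  match fst (snd y) with
  | None => fst (snd y') = None
  | Some m => (fst (snd y') = None /\ fst (fst y) m) \/
      exists m', fst (snd y') = Some m' /\ snd (fst y) m (snd (snd y)) m'
  end.

Definition losing (y : nat -> eletter * (option (dst D) * (dst D -> Prop))) : Prop :=
  fst (snd (y 0)) = Some (dst0 D) /\ (forall i, estep (y i) (y (S i))) /\
  ((exists i, fst (snd (y i)) = None) \/ ~ vpar (fun i => snd (snd (y i)))).

(** Player 1 has to refute all plays along the branch at once. The quantifier is absorbed by
    [oreg_image], so this is still omega-regular. *)
Definition ewins (w : nat -> eletter) : Prop :=
  ~ exists y, (forall i, fst (y i) = w i) /\ losing y.

Lemma fin_eletter : finite_type eletter.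
Proof.
  pose proof (dst_fin D). apply fin_prod; [apply fin_pred; assumption|].
  apply fin_fun; [assumption|]. apply fin_fun; [apply fin_pred; assumption|].
  apply fin_pred; assumption.
Qed.

Lemma oreg_ewins : oreg ewins.
Proof.
  pose proof (dst_fin D) as hD.
  set (Y := (eletter * (option (dst D) * (dst D -> Prop)))%type).
  assert (hY : finite_type Y).
  { apply fin_prod; [apply fin_eletter|].
    apply fin_prod; [apply fin_option; assumption|apply fin_pred; assumption]. }
  apply oreg_not, (oreg_image (fun y : Y => fst y)).
  apply oreg_and; [exact (oreg_first (fun y : Y => fst (snd y) = Some (dst0 D)))|].
  apply oreg_and; [exact (oreg_step estep hY)|].
  apply oreg_or; [exact (oreg_ex (fun y : Y => fst (snd y) = None) hY)|].
  apply oreg_not. destruct (dpa_bound D) as [B hB].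
  eapply oreg_ext; [|apply (@oreg_ex_lt Y (fun k y => Nat.even k = true /\
    Inf (fun i => exists m, snd (snd (y i)) m /\ dprio D m = k) /\
    ~ Inf (fun i => exists m, snd (snd (y i)) m /\ dprio D m < k)) B)].
  - intros y; split.
    + intros [k [_ h]]. exists k; exact h.
    + intros [k h]. exists k; split; [|exact h].
      destruct h as [_ [h _]]. destruct (h 0) as [i [_ [m [_ <-]]]]. apply hB.
  - intros k. apply oreg_and; [apply oreg_const|apply oreg_and].
    + exact (oreg_Inf (fun y : Y => exists m, snd (snd y) m /\ dprio D m = k)).
    + apply oreg_not. exact (oreg_Inf (fun y : Y => exists m, snd (snd y) m /\ dprio D m < k)).
Qed.

Lemma vpar_cut (c : nat -> nat) (x : nat -> dst D) (V : nat -> dst D -> Prop) : cut c ->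
  (forall i m, V i m <-> exists j, c i <= j < c (S i) /\ x j = m) ->
  (vpar V <-> Par true (fun j => dprio D (x j))).
Proof.
  intros hc hV.
  assert (hE : forall k, Inf (fun i => exists m, V i m /\ dprio D m = k) <->
     Inf (fun i => exists j, c i <= j < c (S i) /\ dprio D (x j) = k)).
  { intros k. split; apply Inf_impl; intros i.
    - intros [m [h1 h2]]. apply hV in h1. destruct h1 as [j [h1 <-]]. eauto.
    - intros [j [h1 h2]]. exists (x j). rewrite hV. eauto. }
  split.
  - intros [k [h1 [h2 h3]]]. exists k; split; [|assumption]. apply (minf_cut _ _ hc).
    split; [apply hE, h2|]. apply not_Inf in h3. destruct h3 as [N hN]. exists N.
    intros i hi j hj. destruct (Nat.le_gt_cases k (dprio D (x j))) as [|hlt]; [assumption|exfalso].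
    apply (hN i hi). exists (x j). rewrite hV. eauto.
  - intros [k [h1 h2]]. apply (minf_cut _ _ hc) in h1. destruct h1 as [h1 [N hN]].
    exists k; split; [assumption|]. split; [apply hE, h1|]. intros h.
    destruct (h N) as [i [hi [m [hm hlt]]]]. apply hV in hm. destruct hm as [j [hj <-]].
    specialize (hN i hi j hj). lia.
Qed.

Variable t : Tcar X n.

Definition ast (z : zpos) (d : Dir R) : zpos := zst tc t z (proj1_sig d).
Definition alab (z : zpos) : lbl E n := wrap (zlab tc t z).
Definition apos : Type := (zpos * dst D)%type.

Lemma gnext_inner v p m g (d : Dir R) :
  ~ is_var (utree tc (proj1_sig t v) (p ++ [proj1_sig d])) ->
  gnext D ast alab ((v, p), m) g d =
  ((v, p ++ [proj1_sig d]), dtr D m (wrap (utree tc (proj1_sig t v) p), g, d)).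
Proof.
  intros h. unfold gnext, ast, alab, zst, zlab; simpl. f_equal.
  destruct (utree tc (proj1_sig t v) (p ++ [proj1_sig d])) as [[k a|i]|] eqn:e; try reflexivity.
  exfalso; apply h; exists i; reflexivity.
Qed.

Lemma gnext_jump v p m g (d : Dir R) i :
  utree tc (proj1_sig t v) (p ++ [proj1_sig d]) = Some (Var i) ->
  gnext D ast alab ((v, p), m) g d =
  ((v ++ [i], []), dtr D m (wrap (utree tc (proj1_sig t v) p), g, d)).
Proof.
  intros h. unfold gnext, ast, alab, zst, zlab; simpl. rewrite h. reflexivity.
Qed.

Lemma addr_snoc (e : nat -> Dir R) j : addr (pre e (S j)) = addr (pre e j) ++ [proj1_sig (e j)].
Proof. rewrite pre_S. unfold addr. rewrite map_app. reflexivity. Qed.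

(** A positional winning strategy gives a choice of labels inside each substituted tree. A losing
    word of effects would be realised by inner paths which together form a play that follows this
    strategy and loses. *)
Lemma win_effects : Win (arena D ast alab) true (gprio D (Z := zpos)) (([], []), dst0 D) ->
  exists mu : list nat -> nat -> eletter,
    (forall v, emove (proj1_sig t v) (mu v)) /\ forall d, ewins (fun i => mu (pre d i) (d i)).
Proof.
  intros [Wr [U [hU h0]]].
  destruct (sw_move hU _ h0) as [g0 _].
  destruct (@choose apos Gam (fun p g => Wr p -> forall d, U p (gnext D ast alab p g d)))
    as [gam hgam].
  { intros p. destruct (classic (Wr p)) as [hp|hp]; [|exists g0; tauto].
    destruct (sw_move hU _ hp) as [g hg]. exists g; auto. }
  set (g := fun v p m => gam ((v, p), m)).
  exists (fun v i => effect (proj1_sig t v) (g v) i). split; [intros v; exists (g v); auto|].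
  intros d [y [hy [hy0 [hyS hyL]]]].
  set (play := fun v (e : nat -> Dir R) (x : nat -> dst D) j => (((v, addr (pre e j)), x j) : apos)).
  assert (Hstep : forall v e x j, ilocal (proj1_sig t v) (g v) e x j ->
    ~ is_var (utree tc (proj1_sig t v) (addr (pre e (S j)))) ->
    Wr (play v e x j) -> U (play v e x j) (play v e x (S j))).
  { intros v e x j h1 h2 h3. unfold play at 2. rewrite addr_snoc in h2 |- *. rewrite h1.
    rewrite <- gnext_inner by assumption. apply hgam, h3. }
  assert (Hjump : forall v e x j i, ilocal (proj1_sig t v) (g v) e x j ->
    utree tc (proj1_sig t v) (addr (pre e (S j))) = Some (Var i) ->
    Wr (play v e x j) -> U (play v e x j) ((v ++ [i], []), x (S j))).
  { intros v e x j i h1 h2 h3. rewrite addr_snoc in h2. rewrite h1.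
    rewrite <- gnext_jump by assumption. apply hgam, h3. }
  assert (Hseg : forall v e x k, (forall j, j < k -> ilocal (proj1_sig t v) (g v) e x j) ->
    (forall j, j < k -> ~ is_var (utree tc (proj1_sig t v) (addr (pre e (S j))))) ->
    Wr ((v, []), x 0) -> forall j, j <= k -> Wr (play v e x j)).
  { intros v e x k h1 h2 h3. induction j as [|j IH]; intros hj; [exact h3|].
    eapply (sw_closed hU); [apply IH; lia|]. apply Hstep; [apply h1; lia|apply h2; lia|apply IH; lia]. }
  assert (HWr : forall i m, fst (snd (y i)) = Some m -> Wr ((pre d i, []), m)).
  { induction i as [|i IH]; intros m hm.
    - rewrite hy0 in hm. inversion hm; subst. exact h0.
    - pose proof (hyS i) as hs. unfold estep in hs.
      destruct (fst (snd (y i))) as [m1|]; [|congruence].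
      destruct hs as [[hs _]|[m' [hs1 hs2]]]; [congruence|].
      rewrite hs1 in hm; inversion hm; subst m'; clear hm.
      rewrite hy in hs2. simpl in hs2. destruct hs2 as [k [e [x [h1 [h2 [h3 [h4 [h5 h6]]]]]]]].
      rewrite pre_S, <- h5.
      assert (hk : Wr (play (pre d i) e x k)).
      { apply (Hseg _ _ _ k); auto; [|rewrite h1; apply IH; reflexivity].
        intros j hj; apply h2; lia. }
      eapply (sw_closed hU); [exact hk|]. apply Hjump; auto. }
  destruct (classic (exists i, fst (snd (y i)) = None)) as [hN|hN].
  - destruct (@least (fun i => fst (snd (y i)) = None) hN) as [i [hi hmin]].
    destruct i as [|i]; [congruence|].
    pose proof (hyS i) as hs. unfold estep in hs.
    destruct (fst (snd (y i))) as [m|] eqn:em; [|specialize (hmin i em); lia].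
    destruct hs as [[_ hs]|[m' [hs _]]]; [|congruence].
    rewrite hy in hs. simpl in hs. destruct hs as [e [x [h1 [h2 [h3 h4]]]]].
    assert (hW : forall j, Wr (play (pre d i) e x j)).
    { intros j. apply (Hseg _ _ _ j); auto. rewrite h1. apply HWr, em. }
    apply h4. refine (sw_par hU (play (pre d i) e x) (hW 0) _). intros j; apply Hstep; auto.
  - destruct hyL as [hyL|hyL]; [tauto|apply hyL].
    destruct (@choose nat (nat * (nat -> Dir R) * (nat -> dst D)) (fun i a =>
      let k := fst (fst a) in let e := snd (fst a) in let x := snd a in
      Some (x 0) = fst (snd (y i)) /\
      (forall j, j <= k -> ilocal (proj1_sig t (pre d i)) (g (pre d i)) e x j) /\
      (forall j, j < k -> ~ is_var (utree tc (proj1_sig t (pre d i)) (addr (pre e (S j))))) /\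
      utree tc (proj1_sig t (pre d i)) (addr (pre e (S k))) = Some (Var (d i)) /\
      Some (x (S k)) = fst (snd (y (S i))) /\
      snd (snd (y i)) = (fun m => exists j, j <= k /\ x j = m))) as [f hf].
    { intros i. pose proof (hyS i) as hs. unfold estep in hs.
      destruct (fst (snd (y i))) as [m1|] eqn:em; [|exfalso; eauto].
      destruct hs as [[hs _]|[m' [hs1 hs2]]]; [exfalso; eauto|].
      rewrite hy in hs2. simpl in hs2. destruct hs2 as [k [e [x [h1 [h2 [h3 [h4 [h5 h6]]]]]]]].
      exists ((k, e), x). simpl. rewrite h1, h5, hs1. repeat split; auto. }
    set (K := fun i => fst (fst (f i))). set (e := fun i => snd (fst (f i))).
    set (x := fun i => snd (f i)).
    (* Segment [i] has [K i + 1] positions; its last move is the jump to the next substituted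
       tree. *)
    set (c := fix c i := match i with 0 => 0 | S i => c i + S (K i) end).
    assert (hc : cut c) by (split; [reflexivity|intros i; simpl; lia]).
    destruct (@glue apos c (fun i => map (play (pre d i) (e i) (x i)) (seq 0 (S (K i)))) hc)
      as [s hs].
    { intros i. rewrite length_map, length_seq. simpl. lia. }
    assert (hsj : forall i j, j <= K i -> s (c i + j) = play (pre d i) (e i) (x i) j).
    { intros i j hj. specialize (hs i). apply (f_equal (fun l => nth_error l j)) in hs.
      rewrite slice_nth in hs by (simpl; lia). rewrite nth_error_map, nth_error_seq in hs.
      destruct (Nat.ltb_spec j (S (K i))); [|lia]. simpl in hs. congruence. }
    assert (hWi : forall i j, j <= K i -> Wr (s (c i + j))).
    { intros i j hj. rewrite hsj by assumption. destruct (hf i) as [h1 [h2 [h3 _]]].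
      refine (Hseg _ _ _ (K i) _ h3 _ j hj).
      - intros j' hj'; apply h2. fold (K i); lia.
      - apply HWr. symmetry; exact h1. }
    assert (hsU : forall q, U (s q) (s (S q))).
    { intros q. destruct (cut_idx q hc) as [i hi]. simpl in hi.
      set (j := q - c i). replace q with (c i + j) by (unfold j; lia).
      destruct (hf i) as [h1 [h2 [h3 [h4 [h5 _]]]]]. fold (K i) (e i) (x i) in h1, h2, h3, h4, h5.
      assert (hj : j <= K i) by (unfold j; lia).
      pose proof (hWi i j hj) as hw. rewrite hsj in hw |- * by assumption.
      destruct (Nat.eq_dec j (K i)) as [ej|ej].
      - replace (S (c i + j)) with (c (S i) + 0) by (simpl; lia).
        rewrite hsj by lia.
        change (U (play (pre d i) (e i) (x i) j) ((pre d (S i), []), x (S i) 0)).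
        destruct (hf (S i)) as [h1' _]. fold (x (S i)) in h1'.
        assert (h5' : x i (S (K i)) = x (S i) 0) by congruence.
        rewrite <- h5', pre_S, <- ej. rewrite <- ej in h4. apply Hjump; auto.
      - replace (S (c i + j)) with (c i + S j) by lia. rewrite hsj by lia.
        apply Hstep; auto. apply h3; lia. }
    apply (@vpar_cut c (fun q => snd (s q)) _ hc).
    + intros i m. destruct (hf i) as [_ [_ [_ [_ [_ h6]]]]]. fold (K i) (x i) in h6.
      rewrite h6. split.
      * intros [j [hj <-]]. exists (c i + j). split; [simpl; lia|]. rewrite hsj by assumption.
        reflexivity.
      * intros [q [hq <-]]. simpl in hq. exists (q - c i). split; [lia|].
        replace q with (c i + (q - c i)) at 2 by lia. rewrite hsj by lia. reflexivity.
    + refine (sw_par hU s _ hsU). exact (hWi 0 0 (Nat.le_0_l _)).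
Qed.

(** The choices behind the effects form a strategy. A lost play, divided at its jumps, would be a
    losing word of effects along the branch that it follows in [t]. *)
Lemma effects_win (mu : list nat -> nat -> eletter) :
  (forall v, emove (proj1_sig t v) (mu v)) -> (forall d, ewins (fun i => mu (pre d i) (d i))) ->
  Win (arena D ast alab) true (gprio D (Z := zpos)) (([], []), dst0 D).
Proof.
  intros hmu hd.
  destruct (@choose (list nat) (list nat -> dst D -> Gam)
    (fun v g => forall i, mu v i = effect (proj1_sig t v) g i)) as [g hg]; [exact hmu|].
  apply win_reach with (U := fun p q => exists d,
    q = gnext D ast alab p (g (fst (fst p)) (snd (fst p)) (snd p)) d).
  { intros p. exists (g (fst (fst p)) (snd (fst p)) (snd p)). intros d; eauto. }
  intros s h0 hs. apply NNPP; intros hpar.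
  destruct (@choose nat (Dir R) (fun i d => s (S i) =
    gnext D ast alab (s i) (g (fst (fst (s i))) (snd (fst (s i))) (snd (s i))) d) hs) as [e he].
  clear hs.
  set (v := fun i => fst (fst (s i))). set (p := fun i => snd (fst (s i))).
  set (m := fun i => snd (s i)).
  assert (es : forall i, s i = ((v i, p i), m i)).
  { intros i. unfold v, p, m. destruct (s i) as [[a b] c]; reflexivity. }
  set (out := fun i => utree tc (proj1_sig t (v i)) (p i ++ [proj1_sig (e i)])).
  destruct (@choose nat nat (fun i k => is_var (out i) -> out i = Some (Var k))) as [ix hix].
  { intros i. destruct (classic (is_var (out i))) as [[k hk]|h]; [exists k; auto|exists 0; tauto]. }
  (* [nj a] is the first time from [a] on at which the play jumps, if there is one. *)
  destruct (@choose nat (option nat) (fun a o => match o with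
     | Some b => a <= b /\ is_var (out b) /\ forall j, a <= j -> j < b -> ~ is_var (out j)
     | None => forall j, a <= j -> ~ is_var (out j) end)) as [nj hnj].
  { intros a. destruct (classic (exists b, a <= b /\ is_var (out b))) as [h|h].
    - destruct (@least (fun b => a <= b /\ is_var (out b)) h) as [b [[h1 h2] h3]]. exists (Some b). split; [assumption|split; [assumption|]].
      intros j hj hjb hv. specialize (h3 j (conj hj hv)). lia.
    - exists None. intros j hj hv; apply h; eauto. }
  assert (hin : forall i, ~ is_var (out i) -> v (S i) = v i /\ p (S i) = p i ++ [proj1_sig (e i)]).
  { intros i hi. unfold v at 1, p at 1. rewrite he, es, gnext_inner by exact hi. split; reflexivity. }
  assert (hjump : forall i, is_var (out i) -> v (S i) = v i ++ [ix i] /\ p (S i) = []).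
  { intros i hi. apply hix in hi. unfold v at 1, p at 1. rewrite he, es.
    rewrite (gnext_jump _ _ _ _ _ hi). split; reflexivity. }
  assert (hm : forall i, m (S i) =
    dtr D (m i) (wrap (utree tc (proj1_sig t (v i)) (p i)), g (v i) (p i) (m i), e i)).
  { intros i. unfold m at 1. rewrite he. reflexivity. }
  assert (hseg : forall a k, p a = [] -> (forall j, j < k -> ~ is_var (out (a + j))) ->
    forall j, j <= k -> v (a + j) = v a /\ p (a + j) = addr (pre (fun i => e (a + i)) j)).
  { intros a k ha hk. induction j as [|j IH]; intros hj.
    - rewrite Nat.add_0_r. split; [reflexivity|exact ha].
    - destruct (IH ltac:(lia)) as [h1 h2]. rewrite Nat.add_succ_r.
      destruct (hin (a + j)) as [h3 h4]; [apply hk; lia|]. rewrite h3, h4, addr_snoc, h1, h2.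
      split; reflexivity. }
  assert (hloc : forall a k, p a = [] -> (forall j, j < k -> ~ is_var (out (a + j))) ->
    forall j, j <= k -> ilocal (proj1_sig t (v a)) (g (v a)) (fun i => e (a + i)) (fun i => m (a + i)) j).
  { intros a k ha hk j hj. destruct (hseg a k ha hk j hj) as [h1 h2]. unfold ilocal.
    rewrite Nat.add_succ_r, hm, h1, h2. reflexivity. }
  assert (hout : forall a k, p a = [] -> (forall j, j < k -> ~ is_var (out (a + j))) ->
    forall j, j <= k -> utree tc (proj1_sig t (v a)) (addr (pre (fun i => e (a + i)) (S j))) = out (a + j)).
  { intros a k ha hk j hj. destruct (hseg a k ha hk j hj) as [h1 h2]. unfold out.
    rewrite addr_snoc, h1, h2. reflexivity. }
  (* [ck i] is the time of entry into the substituted tree number [i], and [None] once the play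
     stays inside one forever. The branch [d] then continues with the default 0. *)
  set (ck := fix ck i := match i with 0 => Some 0 | S i =>
     match ck i with None => None | Some a => match nj a with None => None | Some b => Some (S b) end end end).
  set (d := fun i => match ck i with Some a => match nj a with Some b => ix b | None => 0 end | None => 0 end).
  assert (hck : forall i a, ck i = Some a -> v a = pre d i /\ p a = []).
  { induction i as [|i IH]; intros a ha.
    - inversion ha; subst. unfold v, p. rewrite h0. split; reflexivity.
    - simpl in ha. rewrite pre_S. destruct (ck i) as [a'|] eqn:e1; [|discriminate].
      destruct (nj a') as [b|] eqn:e2; [|discriminate]. inversion ha; subst a; clear ha.
      destruct (IH a' eq_refl) as [h1 h2]. pose proof (hnj a') as h3. rewrite e2 in h3.
      destruct h3 as [h3 [h4 h5]]. destruct (hjump b h4) as [h6 h7]. split; [|assumption].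
      rewrite h6. unfold d at 2. rewrite e1, e2. f_equal. rewrite <- h1.
      destruct (hseg a' (b - a') h2) with (j := b - a') as [h8 _]; [|lia|].
      + intros j hj. apply h5; lia.
      + replace (a' + (b - a')) with b in h8 by lia. assumption. }
  set (V := fun i => match ck i with Some a => match nj a with
     | Some b => fun x => exists j, a <= j < S b /\ m j = x | None => fun _ => False end
     | None => fun _ => False end).
  apply (hd d). exists (fun i => (mu (pre d i) (d i), (option_map m (ck i), V i))).
  split; [reflexivity|]. split; [|split].
  - simpl. unfold m. rewrite h0. reflexivity.
  - intros i. unfold estep. simpl. destruct (ck i) as [a|] eqn:e1; simpl; [|reflexivity].
    destruct (hck i a e1) as [h1 h2]. rewrite hg, <- h1. pose proof (hnj a) as h3.
    destruct (nj a) as [b|] eqn:e2.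
    + right. destruct h3 as [h3 [h4 h5]]. exists (m (S b)). split; [reflexivity|].
      assert (h6 : forall j, j < b - a -> ~ is_var (out (a + j))) by (intros j hj; apply h5; lia).
      exists (b - a), (fun i => e (a + i)), (fun i => m (a + i)).
      split; [rewrite Nat.add_0_r; reflexivity|].
      split; [apply (hloc a (b - a)); assumption|].
      split; [|split; [|split]].
      * intros j hj. rewrite (hout a (b - a)) by (assumption || lia). apply h6; assumption.
      * rewrite (hout a (b - a)) by (assumption || lia). replace (a + (b - a)) with b by lia.
        unfold d. rewrite e1, e2. apply hix, h4.
      * f_equal; lia.
      * unfold V. rewrite e1, e2. apply pred_ext. intros x. split.
        -- intros [j [hj <-]]. exists (j - a). split; [lia|f_equal; lia].
        -- intros [j [hj <-]]. exists (a + j). split; [lia|reflexivity].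
    + left. split; [reflexivity|].
      assert (h6 : forall j, ~ is_var (out (a + j))) by (intros j; apply h3; lia).
      exists (fun i => e (a + i)), (fun i => m (a + i)).
      split; [rewrite Nat.add_0_r; reflexivity|].
      split; [intros j; apply (hloc a j); auto|split].
      * intros j. rewrite (hout a j) by auto. apply h6.
      * intros hp. apply hpar. apply (Par_shift true (fun j => dprio D (m j)) a) in hp.
        exact hp.
  - simpl. destruct (classic (exists i, ck i = None)) as [[i hi]|hn].
    { left. exists i. rewrite hi. reflexivity. }
    right. intros hv. apply hpar.
    destruct (@choose nat nat (fun i a => ck i = Some a)) as [c hc].
    { intros i. destruct (ck i) as [a|] eqn:e1; [eauto|exfalso; eauto]. }
    assert (hcS : forall i, exists b, nj (c i) = Some b /\ c (S i) = S b /\ c i <= b).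
    { intros i. pose proof (hc (S i)) as h. simpl in h. rewrite hc in h.
      pose proof (hnj (c i)) as h'. destruct (nj (c i)) as [b|]; [|discriminate].
      inversion h. exists b. split; [reflexivity|]. split; [reflexivity|apply h']. }
    assert (hcut : cut c).
    { split.
      - pose proof (hc 0) as h. simpl in h. congruence.
      - intros i. destruct (hcS i) as [b [_ [h1 h2]]]. lia. }
    apply (@vpar_cut c m V hcut); [|exact hv].
    intros i x. destruct (hcS i) as [b [h1 [h2 _]]]. unfold V. rewrite hc, h1, h2. reflexivity.
Qed.

End Effects.

(** The substituted tree lies in [K] iff player 1 wins the arena, and the winner depends only on the
    effects chosen at the vertices of [t]. These range over a finite set even if [X] is infinite. *)
Theorem infrec_subst (X E : PosW) (tc : forall k, X k -> Tcar E k) (n R : nat)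
  (K : (list (Dir R) -> lbl E n) -> Prop) : rec K ->
  infrec (fun t : Tcar X n => K (ltree (R := R) (subst_tree tc t))).
Proof.
  intros [Gam [W [hG [hW H]]]]. destruct (determinise hW) as [D hD].
  exists (eletter D), (emove tc (D := D)), (ewins (D := D)).
  split; [apply fin_eletter|split; [apply oreg_ewins|]].
  intros t. rewrite H.
  destruct (@list_code nat (fun i => i)) as [cl hcl]; [auto|].
  destruct (prod_code _ _ hcl hcl) as [code hcode].
  pose proof (@arena_spec _ _ _ _ D (ast tc t) (alab tc t) W code ([], []) hD hcode) as hA.
  assert (E1 : forall v : list (Dir R), alab tc t (fold_left (ast tc t) v ([], [])) =
     ltree (subst_tree tc t) v).
  { intros v. apply sig_ext. unfold alab.
    assert (e : zlab tc t (fold_left (ast tc t) v ([], [])) = proj1_sig (subst_tree tc t) (addr v)).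
    { rewrite subst_tree_spec. f_equal. unfold addr.
      rewrite <- (fold_left_map (zst tc t) (@proj1_sig nat _)). reflexivity. }
    rewrite wrap_ok; rewrite e; [reflexivity|]. apply (wf_ok (subst_tree tc t)). }
  assert (E2 : (exists l : list (Dir R) -> Gam, forall d, W (fun m => (ltree (subst_tree tc t) (pre d m), l (pre d m), d m)))
     <-> Win (arena D (ast tc t) (alab tc t)) true (gprio D (Z := zpos)) (([], []), dst0 D)).
  { rewrite <- hA. split; intros [l hl]; exists l; intros d; specialize (hl d); revert hl;
    match goal with |- W ?f -> W ?g => replace g with f; [auto|] end;
    apply functional_extensionality; intros m; rewrite E1; reflexivity. }
  rewrite E2. split.
  - apply win_effects.
  - intros [mu [h1 h2]]. eapply effects_win; eassumption.
Qed.

(** * Finitely many labels suffice *)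

Definition finlab (A : PosW) (n : nat) (t : Tcar A n) : Prop :=
  exists l : list {k : nat & A k}, forall w k a,
    proj1_sig t w = Some (Node k a) -> In (existT _ k a) l.

(** Makes well-formedness local: what is allowed at a vertex follows from the label of its parent
    and its own index, so three values suffice as memory, whatever the arities. *)
Inductive kind := KRoot | KIn | KOut.

Lemma fin_kind : finite_type kind.
Proof. exists [KRoot; KIn; KOut]. intros []; simpl; auto. Qed.

Definition allowed (A : PosW) (n : nat) (c : kind) (l : option (label A)) : Prop :=
  match c, l with
  | KRoot, Some (Node _ _) | KIn, Some (Node _ _) | KOut, None => True
  | KIn, Some (Var i) => i < n
  | _, _ => False
  end.

Definition next_kind (A : PosW) (l : option (label A)) (d : nat) : kind :=
  match l with
  | Some (Node k _) => if d <? k then KIn else KOut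
  | _ => KOut
  end.

Lemma allowed_next (A : PosW) (n : nat) (t : Tcar A n) v d :
  allowed n (next_kind (proj1_sig t v) d) (proj1_sig t (v ++ [d])).
Proof.
  destruct (proj2_sig t) as [_ [hv hc]]. specialize (hc v d).
  assert (hN : ~ (exists k a, proj1_sig t v = Some (Node k a) /\ d < k) ->
     proj1_sig t (v ++ [d]) = None).
  { intros hn. apply NNPP; intros h. apply hn, hc, h. }
  destruct (proj1_sig t v) as [[k a|i]|] eqn:e; simpl.
  - destruct (Nat.ltb_spec d k) as [h|h].
    + destruct (proj1_sig t (v ++ [d])) as [[k' a'|i]|] eqn:e'; simpl; [trivial| |].
      * eapply hv; eassumption.
      * apply hc; [|reflexivity]. exists k, a. split; [reflexivity|exact h].
    + rewrite hN; simpl; [trivial|]. intros [k' [a' [h1 h2]]].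
      inversion h1; subst; lia.
  - rewrite hN; simpl; [trivial|]. intros [k' [a' [h1 h2]]].
    discriminate h1.
  - rewrite hN; simpl; [trivial|]. intros [k' [a' [h1 h2]]].
    discriminate h1.
Qed.

(* Player 1 builds a tree together with choices of the automaton, player 2 selects a branch.
   A tree in K is a winning strategy; a positional one uses finitely many labels only,
   because there are finitely many positions. *)
Theorem finite_choice (A : PosW) (n : nat) (K : Tcar A n -> Prop) : infrec K ->
  forall t, K t -> exists t', K t' /\ finlab t'.
Proof.
  intros [B [Mv [W [hB [hW H]]]]] t ht. apply H in ht. destruct ht as [mu [hmu hmuW]].
  destruct (determinise hW) as [D hD].
  set (P := (dst D * kind)%type).
  assert (hP : finite_type P) by (apply fin_prod; [apply dst_fin|apply fin_kind]).
  set (next := fun (p : P) (l : option (label A)) (m : nat -> B) (d : nat) =>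
     ((dtr D (fst p) (m d), next_kind l d) : P)).
  set (F := fun (p : P) (U : P -> Prop) => exists l m,
     allowed n (snd p) l /\ Mv l m /\ forall d, U (next p l m d)).
  assert (hm : mono F).
  { intros p U U' hU [l [m [h1 [h2 h3]]]]. exists l, m; auto. }
  set (pr := fun p : P => dprio D (fst p)). set (p0 := (dst0 D, KRoot) : P).
  destruct (fin_code hP) as [code hcode]. destruct (dpa_bound D) as [bd hbd].
  destruct (@determinacy P code pr hcode bd (fun p => hbd (fst p)) F true hm p0)
    as [[Wr [U [hU h0]]]|[Wr [U [hU h0]]]].
  - destruct (sw_move hU _ h0) as [l0 [m0 _]].
    destruct (@choose P (option (label A) * (nat -> B)) (fun p x => Wr p ->
       allowed n (snd p) (fst x) /\ Mv (fst x) (snd x) /\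
       forall d, U p (next p (fst x) (snd x) d))) as [f hf].
    { intros p. destruct (classic (Wr p)) as [hp|hp]; [|exists (l0, m0); tauto].
      destruct (sw_move hU _ hp) as [l [m h]]. exists (l, m). intros _; exact h. }
    set (step := fun p d => next p (fst (f p)) (snd (f p)) d).
    set (pos := fun v => fold_left step v p0).
    assert (hposS : forall v d, pos (v ++ [d]) = step (pos v) d).
    { intros v d. unfold pos. rewrite fold_left_app. reflexivity. }
    assert (hWr : forall v, Wr (pos v)).
    { induction v as [|d v IH] using rev_ind; [exact h0|]. rewrite hposS.
      eapply (sw_closed hU); [exact IH|]. apply hf, IH. }
    set (t' := fun v => fst (f (pos v))).
    assert (hal : forall v, allowed n (snd (pos v)) (t' v)) by (intros v; apply hf, hWr).
    assert (hkind : forall v d, snd (pos (v ++ [d])) = next_kind (t' v) d).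
    { intros v d. rewrite hposS. reflexivity. }
    assert (hwf : wf A n t').
    { split; [|split].
      - specialize (hal []). simpl in hal. destruct (t' []) as [[k a|i]|]; simpl in hal;
          [eauto|contradiction|contradiction].
      - intros w i e. specialize (hal w). rewrite e in hal.
        destruct (snd (pos w)); simpl in hal; tauto.
      - intros w c. specialize (hal (w ++ [c])). rewrite hkind in hal.
        destruct (t' w) as [[k a|i]|]; simpl in hal.
        + destruct (Nat.ltb_spec c k) as [h|h].
          * split; [intros _; eauto|]. intros _ e. rewrite e in hal. exact hal.
          * split; [intros hn; destruct (t' (w ++ [c])); [contradiction|congruence]|].
            intros [k' [a' [h1 h2]]]. inversion h1; subst; lia.
        + split; [intros hn; destruct (t' (w ++ [c])); [contradiction|congruence]|].
          intros [k' [a' [h1 h2]]]; discriminate.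
        + split; [intros hn; destruct (t' (w ++ [c])); [contradiction|congruence]|].
          intros [k' [a' [h1 h2]]]; discriminate. }
    exists (exist _ t' hwf). split.
    + apply H. exists (fun v => snd (f (pos v))). simpl. split.
      { intros v; apply hf, hWr. }
      intros d. apply hD. eapply Par_ext; [|apply (sw_par hU (fun i => pos (pre d i)))].
      * intros i. unfold pr. f_equal.
        apply (@drunfrom_unique _ D _ (fun i => fst (pos (pre d i)))); [reflexivity|].
        intros j. rewrite pre_S, hposS. reflexivity.
      * exact h0.
      * intros i. rewrite pre_S, hposS. apply hf, hWr.
    + destruct hP as [lp hlp].
      (* The label at [w] is a function of [pos w], so it is enough to list one label for each
         position. *)
      exists (flat_map (fun p => match fst (f p) with Some (Node k a) => [existT _ k a] | _ => [] end) lp).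
      intros w k a e. simpl in e. apply in_flat_map. exists (pos w). split; [apply hlp|].
      unfold t' in e. rewrite e. left; reflexivity.
  - exfalso.
    (* The strategy of player 2 is played against [t] and [mu]. It selects a branch on which [W]
       holds, although the play is won by player 2. *)
    destruct (@choose (list nat * P) nat (fun x d => Wr (snd x) ->
       allowed n (snd (snd x)) (proj1_sig t (fst x)) ->
       U (snd x) (next (snd x) (proj1_sig t (fst x)) (mu (fst x)) d))) as [adv hadv].
    { intros [v p]. simpl. destruct (classic (Wr p /\ allowed n (snd p) (proj1_sig t v))) as [[h1 h2]|h];
        [|exists 0; tauto].
      pose proof (sw_move hU _ h1) as h3. apply NNPP; intros hn. apply h3.
      exists (proj1_sig t v), (mu v). split; [assumption|split; [apply hmu|]].
      intros d hd. apply hn. exists d; auto. }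
    set (x := fun i => Nat.iter i (fun x : list nat * P =>
      (fst x ++ [adv x], next (snd x) (proj1_sig t (fst x)) (mu (fst x)) (adv x))) ([], p0)).
    set (d := fun i => adv (x i)).
    assert (hv : forall i, fst (x i) = pre d i).
    { induction i as [|i IH]; [reflexivity|]. rewrite pre_S, <- IH. reflexivity. }
    assert (hal : forall i, allowed n (snd (snd (x i))) (proj1_sig t (fst (x i)))).
    { intros [|i].
      - simpl. destruct (proj2_sig t) as [[k [a e]] _]. rewrite e. exact I.
      - exact (allowed_next t (fst (x i)) (adv (x i))). }
    assert (hWr : forall i, Wr (snd (x i))).
    { induction i as [|i IH]; [exact h0|]. eapply (sw_closed hU); [exact IH|].
      exact (hadv (x i) IH (hal i)). }
    specialize (hmuW d). rewrite hD in hmuW. apply (Par_excl hmuW).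
    eapply Par_ext; [|apply (sw_par hU (fun i => snd (x i)))].
    + intros i. unfold pr. f_equal.
      apply (@drunfrom_unique _ D _ (fun i => fst (snd (x i)))); [reflexivity|].
      intros j. rewrite <- hv. reflexivity.
    + exact h0.
    + intros i. exact (hadv (x i) (hWr i) (hal i)).
Qed.

(** * The monad of trees with finitely many labels *)

Lemma tree_ext (A : PosW) n (s t : Tcar A n) :
  (forall w, proj1_sig s w = proj1_sig t w) -> s = t.
Proof. intros h. apply sig_ext, functional_extensionality, h. Qed.

Lemma Tmap_comp (A B C : PosW) (f : forall k, A k -> B k) (g : forall k, B k -> C k) n
  (t : Tcar A n) : Tmap g (Tmap f t) = Tmap (fun k a => g k (f k a)) t.
Proof.
  apply tree_ext; intros w. simpl. unfold Tmap_raw.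
  destruct (proj1_sig t w) as [[k a|i]|]; reflexivity.
Qed.

Lemma Tmap_id (A : PosW) (f : forall k, A k -> A k) n (t : Tcar A n) :
  (forall k a, f k a = a) -> Tmap f t = t.
Proof.
  intros h. apply tree_ext; intros w. simpl. unfold Tmap_raw.
  destruct (proj1_sig t w) as [[k a|i]|]; simpl; [rewrite h|..]; reflexivity.
Qed.

Lemma Tmap_ext (A B : PosW) (f g : forall k, A k -> B k) n (t : Tcar A n) :
  (forall k a, f k a = g k a) -> Tmap f t = Tmap g t.
Proof.
  intros h. apply tree_ext; intros w. simpl. unfold Tmap_raw.
  destruct (proj1_sig t w) as [[k a|i]|]; simpl; [rewrite h|..]; reflexivity.
Qed.

Lemma Tmap_mono (A B : PosW) (f : forall k, A k -> B k) n (s t : Tcar A n) :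
  monotone A B f -> Tle s t -> Tle (Tmap f s) (Tmap f t).
Proof.
  intros hf h w. specialize (h w). simpl. unfold Tmap_raw.
  destruct (proj1_sig s w) as [[k a|i]|], (proj1_sig t w) as [[k' a'|i']|]; simpl in *; auto.
  destruct h as [e h]. subst k'. exists eq_refl. apply hf, h.
Qed.

Lemma Tmap_sing (A B : PosW) (f : forall k, A k -> B k) n (a : A n) :
  Tmap f (sing a) = sing (f n a).
Proof.
  apply tree_ext; intros w. simpl. unfold Tmap_raw, sing_raw.
  destruct w as [|i [|j w]]; try reflexivity. destruct (i <? n); reflexivity.
Qed.

Lemma sing_mono (A : PosW) n (a b : A n) : le (A n) a b -> Tle (sing a) (sing b).
Proof.
  intros h w. simpl. unfold sing_raw. destruct w as [|i [|j w]]; simpl.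
  - exists eq_refl. exact h.
  - destruct (i <? n); simpl; auto.
  - exact I.
Qed.

Lemma wf_prefix (A : PosW) n (t : rawtree A) w : wf A n t -> t w = None ->
  forall u, t (w ++ u) = None.
Proof.
  intros [_ [_ hc]] h u. induction u as [|c u IH] using rev_ind; [rewrite app_nil_r; exact h|].
  rewrite app_assoc. apply NNPP; intros hn. apply hc in hn.
  destruct hn as [k [a [h1 _]]]. congruence.
Qed.

Lemma wf_child (A : PosW) n (t : rawtree A) w k a c : wf A n t -> t w = Some (Node k a) ->
  (t (w ++ [c]) <> None <-> c < k).
Proof.
  intros [_ [_ hc]] h. rewrite hc, h. split; [|eauto].
  intros [k' [a' [h1 h2]]]. inversion h1; subst; assumption.
Qed.

(** Even the arity is dropped: [fstep] never inspects it. *)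
Definition shape (A : PosW) (o : option (label A)) : option (option nat) :=
  match o with
  | None => None
  | Some (Node _ _) => Some None
  | Some (Var i) => Some (Some i)
  end.

Lemma opt_le_shape (A : PosW) (o o' : option (label A)) : opt_le o o' -> shape o = shape o'.
Proof.
  destruct o as [[k a|i]|], o' as [[k' a'|i']|]; simpl; intros h; try contradiction; congruence.
Qed.

Lemma shape_map (A B : PosW) (f : forall k, A k -> B k) o :
  shape (option_map (lab_map f) o) = shape o.
Proof. destruct o as [[k a|i]|]; reflexivity. Qed.

(** Serves both monotonicity and naturality of [flat]: trees of the same shape are walked in the
    same way, and only the labels read at the end differ. *)
Lemma fstep_shape (A B : PosW) n (S : Tcar (TPos A) n) (T : Tcar (TPos B) n) s c :
  (forall v p, shape (inner S v p) = shape (inner T v p)) ->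
  (forall v, shape (proj1_sig S v) = shape (proj1_sig T v)) -> fstep S s c = fstep T s c.
Proof.
  intros h1 h2. destruct s as [v p|j|]; simpl; try reflexivity.
  pose proof (h1 v p) as e1. pose proof (h1 v (p ++ [c])) as e2.
  destruct (inner S v p) as [[k a|i]|], (inner T v p) as [[k' a'|i']|]; simpl in e1;
    try discriminate; try reflexivity.
  destruct (inner S v (p ++ [c])) as [[k1 a1|i]|], (inner T v (p ++ [c])) as [[k1' a1'|i']|];
    simpl in e2; try discriminate; try reflexivity.
  inversion e2; subst i'. pose proof (h2 (v ++ [i])) as e3.
  destruct (proj1_sig S (v ++ [i])) as [[k2 a2|j]|], (proj1_sig T (v ++ [i])) as [[k2' a2'|j']|];
    simpl in e3; try discriminate; congruence.
Qed.

Lemma fold_fstep_shape (A B : PosW) n (S : Tcar (TPos A) n) (T : Tcar (TPos B) n) w s :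
  (forall v p, shape (inner S v p) = shape (inner T v p)) ->
  (forall v, shape (proj1_sig S v) = shape (proj1_sig T v)) ->
  fold_left (fstep S) w s = fold_left (fstep T) w s.
Proof.
  intros h1 h2. revert s; induction w as [|c w IH]; intros s; simpl; [reflexivity|].
  rewrite (fstep_shape S T s c h1 h2). apply IH.
Qed.

Lemma flat_mono (A : PosW) n (S T : Tcar (TPos A) n) : Tle S T -> Tle (flat S) (flat T).
Proof.
  intros h.
  assert (hi : forall v p, opt_le (inner S v p) (inner T v p)).
  { intros v p. specialize (h v). unfold inner.
    destruct (proj1_sig S v) as [[k s|i]|], (proj1_sig T v) as [[k' t|i']|]; simpl in h;
      try contradiction; simpl; auto.
    destruct h as [e h]. subst k'. apply (h p). }
  intros w. simpl. unfold flat_raw.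
  rewrite (fold_fstep_shape S T) by (intros; apply opt_le_shape; auto).
  destruct (fold_left (fstep T) w (FIn [] [])) as [v p|j|]; simpl; auto.
  specialize (hi v p).
  destruct (inner S v p) as [[k s|i]|], (inner T v p) as [[k' t|i']|]; simpl in *; auto.
Qed.

Lemma flat_nat (A B : PosW) (f : forall k, A k -> B k) n (T : Tcar (TPos A) n) :
  Tmap f (flat T) = flat (Tmap (A := TPos A) (B := TPos B) (fun k => Tmap f (n := k)) T).
Proof.
  set (T' := Tmap (A := TPos A) (B := TPos B) (fun k => Tmap f (n := k)) T).
  assert (hi : forall v p, inner T' v p = option_map (lab_map f) (inner T v p)).
  { intros v p. unfold inner, T'; simpl. unfold Tmap_raw.
    destruct (proj1_sig T v) as [[k s|i]|]; reflexivity. }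
  assert (hT : forall v, shape (proj1_sig T' v) = shape (proj1_sig T v)).
  { intros v. unfold T'; simpl. unfold Tmap_raw. apply shape_map. }
  apply tree_ext; intros w. simpl. unfold Tmap_raw, flat_raw.
  rewrite (fold_fstep_shape T' T) by (intros; rewrite ?hi, ?shape_map; auto).
  destruct (fold_left (fstep T) w (FIn [] [])) as [v p|j|]; simpl; try reflexivity.
  rewrite hi. destruct (inner T v p) as [[k s|i]|]; reflexivity.
Qed.

(** The simulation principle behind both unit laws; [I] relates the state of the walk to the address
    in [t]. *)
Lemma flat_invariant (A : PosW) n (T : Tcar (TPos A) n) (t : Tcar A n)
  (I : fstate -> list nat -> Prop) : I (FIn [] []) [] ->
  (forall s w c, I s w -> I (fstep T s c) (w ++ [c])) ->
  (forall s w, I s w -> flab T s = proj1_sig t w) -> flat T = t.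
Proof.
  intros h0 hS hl. apply tree_ext; intros w. simpl. unfold flat_raw. apply hl.
  induction w as [|c w IH] using rev_ind; [exact h0|]. rewrite fold_left_app. simpl. auto.
Qed.

Lemma flat_sing (A : PosW) n (t : Tcar A n) : flat (sing (A := TPos A) t) = t.
Proof.
  set (T := sing (A := TPos A) t).
  apply flat_invariant with (I := fun s w => match s with
    | FIn v p => v = [] /\ p = w /\ exists k a, proj1_sig t w = Some (Node k a)
    | FOut j => proj1_sig t w = Some (Var j)
    | FBad => proj1_sig t w = None end).
  - split; [reflexivity|]. split; [reflexivity|]. apply (proj2_sig t).
  - intros s w c. destruct s as [v p|j|].
    + intros [-> [-> [k [a h]]]]. cbn [fstep]. change (inner T [] w) with (proj1_sig t w).
      change (inner T [] (w ++ [c])) with (proj1_sig t (w ++ [c])). rewrite h.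
      destruct (proj1_sig t (w ++ [c])) as [[k' a'|i]|] eqn:e; [eauto| |reflexivity].
      change (proj1_sig T ([] ++ [i])) with (if i <? n then Some (@Var (TPos A) i) else None).
      destruct (proj2_sig t) as [_ [hv _]]. apply hv in e as hi. apply Nat.ltb_lt in hi.
      rewrite hi. first [exact e|reflexivity].
    + intros h. cbn [fstep]. apply NNPP; intros hn.
      destruct (proj2_sig t) as [_ [_ hc]]. apply hc in hn. destruct hn as [k [a [h1 _]]].
      discriminate (eq_trans (eq_sym h) h1).
    + intros h. exact (wf_prefix _ (proj2_sig t) h [c]).
  - intros s w. destruct s as [v p|j|]; simpl.
    + intros [-> [-> [k [a h]]]]. change (inner T [] w) with (proj1_sig t w). rewrite h.
      reflexivity.
    + intros h. symmetry; exact h.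
    + intros h. symmetry; exact h.
Qed.

Lemma flat_map_sing (A : PosW) n (t : Tcar A n) :
  flat (Tmap (A := A) (B := TPos A) (fun k => sing (n := k)) t) = t.
Proof.
  set (T := Tmap (A := A) (B := TPos A) (fun k => sing (n := k)) t).
  assert (hin : forall v p k a, proj1_sig t v = Some (Node k a) -> inner T v p = sing_raw a p).
  { intros v p k a h. unfold inner, T; simpl. unfold Tmap_raw. rewrite h. reflexivity. }
  apply flat_invariant with (I := fun s w => match s with
    | FIn v p => v = w /\ p = [] /\ exists k a, proj1_sig t w = Some (Node k a)
    | FOut j => proj1_sig t w = Some (Var j)
    | FBad => proj1_sig t w = None end).
  - split; [reflexivity|]. split; [reflexivity|]. apply (proj2_sig t).
  - intros s w c. destruct s as [v p|j|].
    + intros [-> [-> [k [a h]]]]. cbn [fstep]. rewrite !(hin _ _ _ _ h). simpl.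
      pose proof (wf_child w c (proj2_sig t) h) as hc.
      destruct (Nat.ltb_spec c k) as [hk|hk].
      * unfold Tmap_raw. destruct (proj1_sig t (w ++ [c])) as [[k' a'|i]|] eqn:e; simpl.
        -- eauto.
        -- first [exact e|reflexivity].
        -- first [exact e|reflexivity].
      * apply NNPP; intros hn. apply hc in hn. lia.
    + intros h. cbn [fstep]. apply NNPP; intros hn.
      destruct (proj2_sig t) as [_ [_ hc]]. apply hc in hn. destruct hn as [k [a [h1 _]]].
      discriminate (eq_trans (eq_sym h) h1).
    + intros h. exact (wf_prefix _ (proj2_sig t) h [c]).
  - intros s w. destruct s as [v p|j|]; simpl.
    + intros [-> [-> [k [a h]]]]. rewrite (hin _ _ _ _ h). symmetry; exact h.
    + intros h. symmetry; exact h.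
    + intros h. symmetry; exact h.
Qed.

Lemma flat_root (A : PosW) n (t : Tcar A n) : exists k a, proj1_sig t [] = Some (Node k a).
Proof. apply (proj2_sig t). Qed.

(** A vertex is given by three addresses: [V] in [TT], [q] in the tree [tau] at [V], and [p] in the
    tree at [q]. One side combines [V] and [q] into [v], the other one [q] and [p] into [P]; the
    invariant matches the two groupings. *)
Lemma flat_assoc (A : PosW) n (TT : Tcar (TPos (TPos A)) n) :
  flat (flat TT) =
  flat (Tmap (A := TPos (TPos A)) (B := TPos A) (fun k => flat (n := k)) TT).
Proof.
  set (S := flat TT).
  set (T' := Tmap (A := TPos (TPos A)) (B := TPos A) (fun k => flat (n := k)) TT).
  set (run := fun v => fold_left (fstep TT) v (FIn [] [])).
  assert (hS : forall v, proj1_sig S v = flab TT (run v)) by reflexivity.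
  assert (hT' : forall V, proj1_sig T' V = option_map (lab_map (A := TPos (TPos A)) (B := TPos A) (fun k => flat (n := k))) (proj1_sig TT V))
    by reflexivity.
  assert (hrun : forall v i, run (v ++ [i]) = fstep TT (run v) i).
  { intros v i. unfold run. rewrite fold_left_app. reflexivity. }
  set (I := fun s z => match s, z with
    | FIn v p, FIn V P => exists q k (tau : Tcar (TPos A) k),
        run v = FIn V q /\ proj1_sig TT V = Some (@Node (TPos (TPos A)) k tau) /\
        fold_left (fstep tau) P (FIn [] []) = FIn q p /\
        exists k' a, inner tau q p = Some (Node k' a)
    | FOut i, FOut j => i = j
    | FBad, FBad => True
    | _, _ => False end).
  assert (hlabS : forall v V q k (tau : Tcar (TPos A) k) p, run v = FIn V q ->
    proj1_sig TT V = Some (@Node (TPos (TPos A)) k tau) -> inner S v p = inner tau q p).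
  { intros v V q k tau p h1 h2. unfold inner at 1. rewrite hS, h1. simpl. unfold inner.
    rewrite h2. destruct (proj1_sig tau q) as [[k' t|i]|]; reflexivity. }
  assert (hlabT : forall V P k (tau : Tcar (TPos A) k),
    proj1_sig TT V = Some (@Node (TPos (TPos A)) k tau) ->
    inner T' V P = flab tau (fold_left (fstep tau) P (FIn [] []))).
  { intros V P k tau h. unfold inner. rewrite hT', h. reflexivity. }
  assert (hinit : forall v V k (tau : Tcar (TPos A) k), run v = FIn V [] ->
    proj1_sig TT V = Some (@Node (TPos (TPos A)) k tau) -> I (FIn v []) (FIn V [])).
  { intros v V k tau h1 h2. exists [], k, tau. split; [assumption|]. split; [assumption|].
    split; [reflexivity|]. apply (good_init tau). }
  assert (hI : forall w, I (fold_left (fstep S) w (FIn [] [])) (fold_left (fstep T') w (FIn [] []))).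
  { induction w as [|c w IH] using rev_ind.
    - simpl fold_left. destruct (flat_root TT) as [k [tau h]]. apply (hinit [] [] k tau); [reflexivity|exact h].
    - rewrite !fold_left_app. cbn [fold_left]. revert IH.
      generalize (fold_left (fstep S) w (FIn [] [])) (fold_left (fstep T') w (FIn [] [])).
      intros s z. destruct s as [v p|j|], z as [V P|j'|]; cbn [I]; try contradiction;
        try (intros; exact Logic.I).
      intros [q [k [tau [h1 [h2 [h3 [k' [a h4]]]]]]]].
      assert (h5 : fold_left (fstep tau) (P ++ [c]) (FIn [] []) = fstep tau (FIn q p) c).
      { rewrite fold_left_app, h3. reflexivity. }
      cbn [fstep]. rewrite !(hlabS _ _ _ _ tau _ h1 h2), h4.
      rewrite !(hlabT _ _ _ tau h2), h5, h3. cbn [flab fstep]. rewrite h4.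
      destruct (inner tau q (p ++ [c])) as [[k1 a1|i]|] eqn:e1; cbn [flab].
      + rewrite e1. exists q, k, tau. split; [assumption|]. split; [assumption|].
        split; [rewrite h5; cbn [fstep]; rewrite h4, e1; reflexivity|eauto].
      + rewrite hS, hrun, h1.
        assert (e0 : exists k1 a1, inner TT V q = Some (@Node (TPos A) k1 a1)).
        { unfold inner in h4 |- *. rewrite h2.
          destruct (proj1_sig tau q) as [[k1 a1|i1]|]; try discriminate. eauto. }
        destruct e0 as [k1 [a1 e0]].
        assert (eTT : inner TT V (q ++ [i]) = proj1_sig tau (q ++ [i])).
        { unfold inner. rewrite h2. reflexivity. }
        assert (hst : fstep TT (FIn V q) i = match proj1_sig tau (q ++ [i]) with
           | Some (Node _ _) => FIn V (q ++ [i])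
           | Some (Var j) => match proj1_sig TT (V ++ [j]) with
              | Some (Node _ _) => FIn (V ++ [j]) [] | Some (Var j') => FOut j' | None => FBad end
           | None => FBad end).
        { cbn [fstep]. rewrite e0, eTT. reflexivity. }
        rewrite hst.
        destruct (proj1_sig tau (q ++ [i])) as [[k2 t2|j]|] eqn:e2.
        * cbn [flab]. rewrite eTT.
          destruct (root_node tau (q ++ [i]) e2) as [k3 [a3 h6]]. rewrite h6.
          exists (q ++ [i]), k, tau. split; [rewrite hrun, h1; exact hst|].
          split; [assumption|]. split; [rewrite h5; cbn [fstep]; rewrite h4, e1, e2; reflexivity|eauto].
        * cbn [flab]. rewrite hT'.
          destruct (proj1_sig TT (V ++ [j])) as [[k3 t3|j']|] eqn:e3; cbn [option_map lab_map flab].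
          -- destruct (root_node TT (V ++ [j]) e3) as [k4 [a4 h6]]. rewrite h6.
             apply (hinit (v ++ [i]) (V ++ [j]) k3 t3); [rewrite hrun, h1; exact hst|exact e3].
          -- reflexivity.
          -- exact Logic.I.
        * exact Logic.I.
      + exact Logic.I. }
  apply tree_ext; intros w. simpl. unfold flat_raw. specialize (hI w).
  destruct (fold_left (fstep S) w (FIn [] [])) as [v p|j|],
    (fold_left (fstep T') w (FIn [] [])) as [V P|j'|]; cbn [I] in hI; try contradiction.
  - destruct hI as [q [k [tau [h1 [h2 [h3 [k' [a h4]]]]]]]]. cbn [flab].
    rewrite (hlabS _ _ _ _ tau _ h1 h2), (hlabT _ _ _ tau h2), h3. cbn [flab].
    rewrite h4. reflexivity.
  - cbn. congruence.
  - reflexivity.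
Qed.

Lemma node_existT (A : PosW) k (a : A k) k' (b : A k') :
  Some (Node k a) = Some (Node k' b) -> existT (fun k => car (A k)) k a = existT _ k' b.
Proof. intros h. inversion h. reflexivity. Qed.

Lemma map_node (A B : PosW) (f : forall k, A k -> B k) o k (b : B k) :
  option_map (lab_map f) o = Some (Node k b) -> exists a, o = Some (Node k a) /\ f k a = b.
Proof.
  destruct o as [[k' a|i]|]; simpl; intros h; try discriminate.
  apply node_existT in h. pose proof (projT1_eq h) as e. simpl in e. subst k'.
  exists a. split; [reflexivity|]. exact (inj_pair2_eq_dec _ Nat.eq_dec _ _ _ _ h).
Qed.

Lemma finlab_map (A B : PosW) (f : forall k, A k -> B k) n (t : Tcar A n) :
  finlab t -> finlab (Tmap f t).
Proof.
  intros [l hl]. exists (map (fun e => existT _ (projT1 e) (f _ (projT2 e))) l).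
  intros w k b. simpl. unfold Tmap_raw.
  destruct (proj1_sig t w) as [[k' a|i]|] eqn:e; simpl; intros h; inversion h; subst.
  apply (in_map (fun e => existT _ (projT1 e) (f _ (projT2 e))) l (existT _ k a)).
  eapply hl; eassumption.
Qed.

Lemma finlab_sing (A : PosW) n (a : A n) : finlab (sing a).
Proof.
  exists [existT _ n a]. intros w k b h. simpl in h. unfold sing_raw in h.
  destruct w as [|i [|j w]]; [left; inversion h; reflexivity|
    destruct (i <? n); discriminate|discriminate].
Qed.

Lemma finlab_flat (A : PosW) n (T : Tcar (TPos A) n) : finlab T ->
  (forall v k (s : Tcar A k), proj1_sig T v = Some (@Node (TPos A) k s) -> finlab s) ->
  finlab (flat T).
Proof.
  intros [l hl] hT.
  destruct (@choose {k : nat & Tcar A k} (list {k : nat & A k}) (fun e l => finlab (projT2 e) ->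
     forall w k a, proj1_sig (projT2 e) w = Some (Node k a) -> In (existT _ k a) l)) as [f hf].
  { intros [k s]. destruct (classic (finlab s)) as [[l' h]|h]; [exists l'; auto|].
    exists []; simpl; tauto. }
  exists (flat_map f l). intros w k a h. simpl in h. unfold flat_raw in h.
  destruct (fold_left (fstep T) w (FIn [] [])) as [v p|j|]; simpl in h; try discriminate.
  unfold inner in h. destruct (proj1_sig T v) as [[k' s|i]|] eqn:e; try discriminate.
  destruct (proj1_sig s p) as [[k1 a1|i]|] eqn:e'; try discriminate. inversion h; subst.
  apply in_flat_map. exists (existT _ k' s). split; [eapply hl; exact e|].
  eapply (hf (existT _ k' s)); [eapply hT; exact e|exact e'].
Qed.

Definition FT (A : PosW) : PosW := fun n => @SubPos (TPos A n) (@finlab A n).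

Definition FTval (A : PosW) : hom (FT A) (TPos A) :=
  {| hfun := fun n (x : FT A n) => proj1_sig x : TPos A n; hmono := fun n x y h => h |}.

Definition FTmap (A B : PosW) (f : hom A B) : hom (FT A) (FT B).
Proof.
  refine {| hfun := fun n (x : FT A n) =>
    exist _ (Tmap f (proj1_sig x)) (finlab_map B f (proj2_sig x)) : FT B n |}.
  intros n x y h. apply Tmap_mono; [apply hmono|exact h].
Defined.

Definition FTunit (A : PosW) : hom A (FT A).
Proof.
  refine {| hfun := fun n a => exist _ (sing a) (finlab_sing A n a) : FT A n |}.
  intros n x y h. apply sing_mono, h.
Defined.

Lemma finlab_mult (A : PosW) n (x : FT (FT A) n) :
  finlab (flat (Tmap (FTval A) (proj1_sig x))).
Proof.
  apply finlab_flat; [apply finlab_map, (proj2_sig x)|].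
  intros v k s h. apply map_node in h. destruct h as [y [_ <-]]. exact (proj2_sig y).
Qed.

Definition FTmult (A : PosW) : hom (FT (FT A)) (FT A).
Proof.
  refine {| hfun := fun n (x : FT (FT A) n) =>
    exist _ (flat (Tmap (FTval A) (proj1_sig x))) (finlab_mult x) : FT A n |}.
  intros n x y h. apply flat_mono, Tmap_mono; [apply hmono|exact h].
Defined.

Definition FTmonad : Monad.
Proof.
  refine {| MO := FT; Mmap := FTmap; Munit := FTunit; Mmult := FTmult |}.
  - intros A n x. apply sig_ext. simpl. apply Tmap_id; reflexivity.
  - intros A B C f g n x. apply sig_ext. simpl. rewrite Tmap_comp. reflexivity.
  - intros A B f n x. apply sig_ext. simpl. apply Tmap_sing.
  - intros A B f n x. apply sig_ext. simpl. rewrite flat_nat, !Tmap_comp. reflexivity.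
  - intros A n x. apply sig_ext. simpl. rewrite Tmap_sing. apply flat_sing.
  - intros A n x. apply sig_ext. simpl. rewrite Tmap_comp. apply flat_map_sing.
  - intros A n x. apply sig_ext. simpl.
    rewrite flat_nat, flat_assoc, !Tmap_comp. reflexivity.
Defined.

(** * Directed colimits of ordered sets *)

(** The union of the images is a cocone too. The induced map into it, followed by the inclusion, is
    the identity by uniqueness. *)
Lemma colimit_surj (D : DDiag) (L : PosW) (c : forall i, hom (dobj D i) L) :
  is_colimit (dI D) (dle D) (dobj D) (dmap D) L c ->
  forall n (y : L n), exists i x, c i n x = y.
Proof.
  intros [hc hu] n y.
  set (P := fun n (y : L n) => exists i x, c i n x = y).
  set (x := fun i =>
    {| hfun := fun n x => exist _ (c i n x) (ex_intro _ i (ex_intro _ x eq_refl)) : Sub L P n;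
       hmono := fun n x y h => hmono (c i) n x y h |} : hom (dobj D i) (Sub L P)).
  destruct (hu (Sub L P) x) as [u [h1 _]].
  { intros i j h m z. apply sig_ext. apply hc. }
  destruct (hu L c hc) as [u0 [_ h3]].
  set (inc := {| hfun := incl P; hmono := fun n x y h => h |} : hom (Sub L P) L).
  assert (e1 := h3 (idh L) (fun i n y => eq_refl) n y).
  assert (e2 : comph inc u n y = u0 n y).
  { apply h3. intros i m z. simpl. unfold incl. rewrite h1. reflexivity. }
  simpl in e1, e2. rewrite <- e1 in e2. unfold incl in e2. rewrite <- e2.
  exact (proj2_sig (u n y)).
Qed.

(** Implication is reversed so that the monotone maps into it are the down-sets. *)
Definition PropPos : Pos.
Proof.
  refine {| car := Prop; le := fun P Q => Q -> P |}; auto.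
  intros P Q h1 h2. apply propositional_extensionality; split; auto.
Defined.

(* Tested against the down-set of y, an element x of stage i lies below y in the colimit
   only if it does so at some later stage. *)
Lemma colimit_le (D : DDiag) (L : PosW) (c : forall i, hom (dobj D i) L) :
  is_colimit (dI D) (dle D) (dobj D) (dmap D) L c ->
  forall n i j (x : dobj D i n) (y : dobj D j n), le (L n) (c i n x) (c j n y) ->
  exists k (hi : dle D i k) (hj : dle D j k),
    le (dobj D k n) (dmap D i k hi n x) (dmap D j k hj n y).
Proof.
  intros [_ hu] n i j x y hle.
  (* The test map is needed at every arity; the equation [e] makes it false at arities other than
     [n]. *)
  set (P := fun i m (z : dobj D i m) => exists (e : n = m) k (hi : dle D i k) (hj : dle D j k),
     le (dobj D k m) (dmap D i k hi m z) (dmap D j k hj m (eq_rect n (fun m => dobj D j m) y m e))).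
  assert (hP : forall i, monotone (dobj D i) (fun _ => PropPos) (P i)).
  { intros i' m z z' hz [e [k [hi [hj h]]]]. exists e, k, hi, hj.
    eapply le_trans; [|exact h]. apply hmono, hz. }
  destruct (hu (fun _ => PropPos) (fun i => @Build_hom (dobj D i) (fun _ => PropPos) (P i) (hP i))) as [u [h1 _]].
  { intros a b hab m z. simpl. apply propositional_extensionality. split.
    - intros [e [k [hi [hj h]]]].
      exists e, k, (dle_trans D _ _ _ hab hi), hj.
      rewrite (dmap_comp D a b k hab hi). exact h.
    - intros [e [k [hi [hj h]]]]. destruct (d_upper D b k) as [k' [hb hk]].
      exists e, k', hb, (dle_trans D _ _ _ hj hk).
      rewrite (dmap_comp D j k k' hj hk), <- (dmap_comp D a b k' hab hb (dle_trans D _ _ _ hi hk)).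
      rewrite (dmap_comp D a k k' hi hk). apply hmono, h. }
  pose proof (hmono u n _ _ hle) as H. rewrite !h1 in H. simpl in H.
  destruct H as [e [k [hi [hj h]]]].
  - exists eq_refl, j, (dle_refl D j), (dle_refl D j). apply le_refl.
  - rewrite (UIP_refl_nat _ e) in h. exists k, hi, hj. exact h.
Qed.

(** The mediating map is defined on chosen representatives; as the order is detected at some stage,
    the result is monotone and independent of the choice. *)
Lemma colimit_intro (I : Type) (lei : I -> I -> Prop) (obj : I -> PosW)
  (mp : forall i j, lei i j -> hom (obj i) (obj j)) (L : PosW) (c : forall i, hom (obj i) L) :
  is_cocone I lei obj mp L c ->
  (forall n (y : L n), exists i x, c i n x = y) ->
  (forall n i j (x : obj i n) (y : obj j n), le (L n) (c i n x) (c j n y) ->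
     exists k (hi : lei i k) (hj : lei j k), le (obj k n) (mp i k hi n x) (mp j k hj n y)) ->
  is_colimit I lei obj mp L c.
Proof.
  intros hc hs hl. split; [assumption|]. intros X x hx.
  assert (hmon : forall n i j (a : obj i n) (b : obj j n), le (L n) (c i n a) (c j n b) ->
     le (X n) (x i n a) (x j n b)).
  { intros n i j a b h. destruct (hl n i j a b h) as [k [hi [hj h']]].
    rewrite <- (hx i k hi), <- (hx j k hj). apply hmono, h'. }
  assert (hs' : forall n (y : L n), exists s : {i : I & obj i n}, c (projT1 s) n (projT2 s) = y).
  { intros n y. destruct (hs n y) as [i [a h]]. exists (existT _ i a). exact h. }
  set (r := fun n y => proj1_sig (constructive_indefinite_description _ (hs' n y))).
  assert (hr : forall n y, c (projT1 (r n y)) n (projT2 (r n y)) = y).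
  { intros n y. exact (proj2_sig (constructive_indefinite_description _ (hs' n y))). }
  assert (hu : monotone L X (fun n y => x (projT1 (r n y)) n (projT2 (r n y)))).
  { intros n y y' h. apply hmon. rewrite !hr. exact h. }
  exists {| hfun := fun n y => x (projT1 (r n y)) n (projT2 (r n y)); hmono := hu |}.
  split; simpl.
  - intros i n y. apply le_antisym; apply hmon; rewrite hr; apply le_refl.
  - intros u' hu' n y. rewrite <- (hr n y) at 1. apply hu'.
Qed.

Lemma directed_list (D : DDiag) (Y : Type) (Q : dI D -> Y -> Prop) (l : list Y) (i0 : dI D) :
  (forall y, In y l -> exists k, forall k', dle D k k' -> Q k' y) ->
  exists k, dle D i0 k /\ forall k', dle D k k' -> forall y, In y l -> Q k' y.
Proof.
  induction l as [|y l IH]; intros h.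
  - exists i0. split; [apply dle_refl|]. intros k' _ y [].
  - destruct IH as [k1 [h1 h2]]; [intros; apply h; right; assumption|].
    destruct (h y (or_introl eq_refl)) as [k2 h3].
    destruct (d_upper D k1 k2) as [k [hk1 hk2]].
    exists k. split; [eapply dle_trans; eassumption|].
    intros k' hk' z [<-|hz].
    + apply h3. eapply dle_trans; eassumption.
    + apply h2; [eapply dle_trans; eassumption|assumption].
Qed.

(** In contrast to [shape] this keeps the arities, on which [wf] depends. *)
Definition same_shape (A B : PosW) (o : option (label A)) (o' : option (label B)) : Prop :=
  match o, o' with
  | Some (Node k _), Some (Node k' _) => k = k'
  | Some (Var i), Some (Var j) => i = j
  | None, None => True
  | _, _ => False
  end.

Lemma wf_same_shape (A B : PosW) n (t : rawtree A) (t' : rawtree B) :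
  (forall w, same_shape (t w) (t' w)) -> wf A n t -> wf B n t'.
Proof.
  intros h [[k [a hr]] [hv hc]]. split; [|split].
  - specialize (h []). rewrite hr in h. destruct (t' []) as [[k' b|i]|]; simpl in h; try tauto. eauto.
  - intros w i e. specialize (h w). rewrite e in h.
    destruct (t w) as [[k' a'|j]|] eqn:e'; simpl in h; try tauto. subst j. eapply hv; eassumption.
  - intros w d. pose proof (h (w ++ [d])) as h1. pose proof (h w) as h2. specialize (hc w d).
    assert (E1 : t (w ++ [d]) <> None <-> t' (w ++ [d]) <> None).
    { destruct (t (w ++ [d])) as [[k1 a1|i1]|], (t' (w ++ [d])) as [[k2 a2|i2]|]; simpl in h1;
        try tauto; split; congruence. }
    rewrite <- E1, hc.
    destruct (t w) as [[k1 a1|i1]|], (t' w) as [[k2 a2|i2]|]; simpl in h2; try tauto;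
      split; intros [k0 [a0 [h3 h4]]]; inversion h3; subst; eauto.
Qed.

(** Finiteness of the label set is what is used: the finitely many labels of a tree lift to a common
    stage, and an inequality between two trees amounts to finitely many inequalities between labels,
    which hold together at some stage. *)
Theorem FT_preserves : preserves_directed_colimits FTmonad.
Proof.
  intros D L c hcol.
  pose proof (@colimit_surj D L c hcol) as hs. pose proof (@colimit_le D L c hcol) as hl.
  apply colimit_intro.
  - intros i j h n x. apply sig_ext. simpl. rewrite Tmap_comp. apply Tmap_ext.
    intros k a. apply (proj1 hcol).
  - intros n [t [l ht]].
    assert (H : exists i (l' : list {k : nat & dobj D i k}), forall e, In e l ->
      exists x, In (existT _ (projT1 e) x) l' /\ c i (projT1 e) x = projT2 e).
    { clear t ht. induction l as [|[k a] l [i [l' IH]]].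
      - destruct (d_inhabited D) as [i]. exists i, []. intros e [].
      - destruct (hs k a) as [j [x hx]]. destruct (d_upper D i j) as [m [hi hj]].
        exists m, (existT _ k (dmap D j m hj k x) ::
                   map (fun e => existT _ (projT1 e) (dmap D i m hi _ (projT2 e))) l').
        intros e [<-|h]; simpl.
        + exists (dmap D j m hj k x). split; [left; reflexivity|].
          rewrite <- hx. apply (proj1 hcol).
        + destruct (IH e h) as [z [hz1 hz2]]. exists (dmap D i m hi _ z). split.
          * right. apply (in_map (fun e => existT _ (projT1 e) (dmap D i m hi _ (projT2 e))) l'
              (existT _ (projT1 e) z)), hz1.
          * rewrite <- hz2. apply (proj1 hcol). }
    destruct H as [i [l' hl']].
    destruct (@choose (list nat) (option (label (dobj D i))) (fun w o =>
       option_map (lab_map (c i)) o = proj1_sig t w /\ same_shape (proj1_sig t w) o /\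
       forall k x, o = Some (Node k x) -> In (existT _ k x) l')) as [t' ht'].
    { intros w. destruct (proj1_sig t w) as [[k a|j]|] eqn:e.
      - destruct (hl' (existT _ k a)) as [x [h1 h2]]; [eapply ht; eassumption|]. simpl in x, h1, h2.
        exists (Some (Node k x)). simpl. rewrite h2. split; [reflexivity|split; [reflexivity|]].
        intros k' x' h. rewrite <- (node_existT h). assumption.
      - exists (Some (Var j)). simpl. split; [reflexivity|split; [reflexivity|]]. discriminate.
      - exists None. simpl. split; [reflexivity|split; [trivial|]]. discriminate. }
    assert (hwf : wf (dobj D i) n t').
    { apply (@wf_same_shape L _ n (proj1_sig t)); [|apply (proj2_sig t)]. intros w; apply ht'. }
    assert (hfin : finlab (exist _ t' hwf)).
    { exists l'. intros w k x. apply ht'. }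
    exists i, (exist _ (exist _ t' hwf) hfin). apply sig_ext. apply tree_ext.
    intros w. simpl. unfold Tmap_raw. apply ht'.
  - intros n i j [t [lt ht]] [s [ls hs']] hle.
    change (Tle (Tmap (c i) t) (Tmap (c j) s)) in hle.
    set (Q := fun k (p : {m : nat & dobj D i m} * {m : nat & dobj D j m}) =>
      forall (hi : dle D i k) (hj : dle D j k),
        lab_le (Node _ (c i _ (projT2 (fst p)))) (Node _ (c j _ (projT2 (snd p)))) ->
        lab_le (Node _ (dmap D i k hi _ (projT2 (fst p)))) (Node _ (dmap D j k hj _ (projT2 (snd p))))).
    destruct (d_upper D i j) as [i0 [hi0 hj0]].
    destruct (@directed_list D _ Q (list_prod lt ls) i0) as [k [hk H]].
    { intros [[m a] [m' b]] _. unfold Q; simpl.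
      destruct (classic (lab_le (Node m (c i m a)) (Node m' (c j m' b)))) as [h|h].
      - simpl in h. destruct h as [e h]. subst m'. simpl in h.
        destruct (hl m i j a b h) as [k [hi [hj h']]]. exists k. intros k' hk' hi' hj' _.
        exists eq_refl. simpl. rewrite (dmap_comp D i k k' hi hk'), (dmap_comp D j k k' hj hk').
        apply hmono, h'.
      - exists i0. intros; contradiction. }
    exists k, (dle_trans D _ _ _ hi0 hk), (dle_trans D _ _ _ hj0 hk).
    change (Tle (Tmap (dmap D i k (dle_trans D _ _ _ hi0 hk)) t) (Tmap (dmap D j k (dle_trans D _ _ _ hj0 hk)) s)).
    intros w. specialize (hle w). simpl in hle |- *. unfold Tmap_raw in *.
    destruct (proj1_sig t w) as [[m a|u]|] eqn:e1, (proj1_sig s w) as [[m' b|u']|] eqn:e2;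
      simpl in hle |- *; try contradiction; auto.
    refine (H k (dle_refl D k) (existT _ m a, existT _ m' b) _ _ _ hle).
    apply in_prod; [eapply ht|eapply hs']; eassumption.
Qed.

Lemma FT_morphism : monad_morphism FTmonad FTval.
Proof.
  split; [|split].
  - reflexivity.
  - reflexivity.
  - intros A n x. reflexivity.
Qed.

(** * MSO-definable algebras *)

Lemma rec_all_in (Dir Sig Y : Type) (K : Y -> (list Dir -> Sig) -> Prop) (l : list Y) :
  (forall y, rec (K y)) -> rec (fun t => forall y, In y l -> K y t).
Proof.
  intros h. induction l as [|y l IH].
  - eapply rec_ext; [|exact (rec_paths (oreg_const (Sig * Dir) True))].
    intros t; split; [intros _ y []|trivial].
  - eapply rec_ext; [|exact (rec_and (h y) IH)]. intros t; split.
    + intros [h1 h2] y' [<-|hy]; auto.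
    + intros h'; split; [apply h'; left; reflexivity|]. intros; apply h'; right; assumption.
Qed.

(** Definability concerns the sets of trees with product above some [b]. Since the sort is finite,
    having product [a] is a conjunction of such sets and complements, according to whether [b] is
    below [a]. Replacing each label by a tree of generators with that product does not change the
    product. *)
Lemma infrec_mso (X : Alg) : MSO_alg X -> forall n (a : acar X n),
  infrec (fun t : Tcar (acar X) n => api X n t = a).
Proof.
  intros [[hfin [C [hC hgen]]] hdef] n a.
  set (E := Sub (acar X) C).
  assert (htc : forall k, exists f : acar X k -> Tcar E k, forall c, api X k (Tincl (f c)) = c).
  { intros k. apply (choose (fun c s => api X k (Tincl s) = c)). intros c. apply hgen. }
  set (tc := fun k => proj1_sig (constructive_indefinite_description _ (htc k))).
  assert (htc' : forall k c, api X k (Tincl (tc k c)) = c).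
  { intros k. exact (proj2_sig (constructive_indefinite_description _ (htc k))). }
  assert (hE : finite_type {k : nat & E k}).
  { destruct hC as [l hl].
    apply fin_surj with (A := {e : {k : nat & acar X k} | C (projT1 e) (projT2 e)})
      (f := fun e : {e : {k : nat & acar X k} | C (projT1 e) (projT2 e)} =>
        existT (fun k => car (E k)) (projT1 (proj1_sig e))
          (exist (C _) (projT2 (proj1_sig e)) (proj2_sig e))).
    - apply fin_sig. exists l. intros [k c] h. apply hl, h.
    - intros [k [c h]]. exists (exist (fun e => C (projT1 e) (projT2 e)) (existT _ k c) h). reflexivity. }
  destruct (fin_bound (fun e : {k : nat & E k} => projT1 e) hE) as [R hR].
  (* The successor ensures that there is at least one direction. *)
  assert (hR' : forall k, E k -> k < S R).
  { intros k e. specialize (hR (existT _ k e)). simpl in hR. lia. }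
  assert (hK : forall b : acar X n, exists K : (list (Dir (S R)) -> lbl E n) -> Prop, rec K /\
     forall s : Tcar E n, le (acar X n) b (api X n (Tincl s)) <-> K (ltree s)).
  { intros b. apply (definable_rec (A := E) (Nat.lt_0_succ R) hE hR' (hdef C hC n b)). }
  destruct (choose _ hK) as [K hK'].
  destruct (hfin n) as [l hl].
  assert (hrec : rec (fun s : list (Dir (S R)) -> lbl E n =>
     forall b, In b l -> if excluded_middle_informative (le (acar X n) b a) then K b s else ~ K b s)).
  { apply rec_all_in. intros b. destruct (excluded_middle_informative _).
    - apply hK'.
    - apply rec_not; [apply fin_Dir|apply fin_lbl, hE|apply hK']. }
  eapply infrec_ext; [|exact (@infrec_subst (acar X) E tc n (S R) _ hrec)].
  intros t. simpl.
  assert (e : api X n (Tincl (subst_tree tc t)) = api X n t).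
  { unfold subst_tree, Tincl. rewrite flat_nat, Tmap_comp, (alg_flat X), Tmap_comp.
    f_equal. apply Tmap_id. intros k c. apply htc'. }
  split.
  - intros h.
    assert (h' : forall b, le (acar X n) b (api X n t) <-> le (acar X n) b a).
    { intros b. specialize (h b (hl b)). rewrite <- e, (proj2 (hK' b)).
      destruct (excluded_middle_informative _); tauto. }
    apply le_antisym; [apply (proj1 (h' _))|apply (proj2 (h' _))]; apply le_refl.
  - intros h b _. destruct (excluded_middle_informative _);
      rewrite <- (proj2 (hK' b)), e, h; assumption.
Qed.

Lemma infrec_closure (Q : RawAlg) : prod_closure MSO_alg Q -> forall n (a : rcar Q n),
  infrec (fun t : Tcar (rcar Q) n => rpi Q n t = a).
Proof.
  induction 1 as [X hX|X Y hX IHX hY IHY].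
  - apply infrec_mso, hX.
  - intros n [a b].
    eapply infrec_ext; [|exact (infrec_and
      (@infrec_map (ProdW (rcar X) (rcar Y)) _ n (fun k z => fst z) _ (IHX n a))
      (@infrec_map (ProdW (rcar X) (rcar Y)) _ n (fun k z => snd z) _ (IHY n b)))].
    intros t. simpl. split; [intros [-> ->]; reflexivity|intros h; inversion h; auto].
Qed.

Theorem theorem10p1 : essentially_finitary MSO_alg.
Proof.
  exists FTmonad, FTval. split; [apply FT_preserves|split; [apply FT_morphism|]].
  intros X hX C n s.
  (* Having the same product as [s] is recognised over the labels in [C] themselves, so the new tree
     uses no others. *)
  pose proof (@infrec_map (Sub (rcar X) C) _ n (incl C) _ (infrec_closure hX n (rpi X n (Tincl s)))) as h.
  destruct (finite_choice h s eq_refl) as [t [h1 h2]].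
  exists (exist _ t h2). exact h1.
Qed.
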